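(* Assume the strong 3SUM-hardness assumption (stated in the context). Consider the jumbled indexing problem with text size $s$ over an alphabet of size $r \ge 4$. Then for any fixed $\epsilon > 0$, any algorithm for jumbled indexing satisfies at least one of the following: (1) its preprocessing time is $\Omega(s^{2-\frac{2}{r-1}-\epsilon})$, or (2) its query time is $\Omega(s^{1-\frac{1}{r-1}-\epsilon})$.
   Context: Model: Word RAM with words of $O(\log n)$ bits. The Parikh vector of a string $S$ over alphabet $\Sigma=\{\sigma_1,\dots,\sigma_{|\Sigma|}\}$ is $\psi(S)=(c_1(S),\dots,c_{|\Sigma|}(S))$, where $c_i(S)$ is the number of occurrences of $\sigma_i$ in $S$. Jumbled indexing: preprocess a text $S$ of length $s$ over alphabet $\Sigma$ so that, given a query vector $\psi\in\mathbb{N}^{|\Sigma|}$, one can decide whether some substring $S'$ of $S$ has Parikh vector $\psi(S')=\psi$. Convolution-3SUM: given integers $x_1,\dots,x_n$, decide whether there exist distinct indices $i,j$ with $x_i - x_j = x_{i-j}$. Strong 3SUM-hardness assumption: any (possibly randomized) algorithm for Convolution-3SUM requires $n^{2-o(1)}$ expected time to decide, for input $\{x_1,\dots,x_n\}\subset\{-n,\dots,n\}$, whether there is a pair $x_i,x_j$ with $x_i-x_j=x_{i-j}$. *)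

(* Defs.v *)
From Stdlib Require Export Reals ZArith List.
From Coquelicot Require Export Rbar Lub Lim_seq Hierarchy Rcomplements.
Export ListNotations.
Open Scope R_scope.

(** * Randomized Word RAM *)

(* [wrap w] is reduction modulo 2^w to the two's complement range
   [-2^(w-1), 2^(w-1)). *)
Definition wrap (w : nat) (z : Z) : Z :=
  let h := (2 ^ (Z.of_nat w - 1))%Z in
  ((z + h) mod (2 ^ Z.of_nat w) - h)%Z.

(* "Words of O(log n) bits": the constant [c] belongs to the algorithm. *)
Definition word_size (c n : nat) : nat := (c * (Nat.log2 n + 1))%nat.

Inductive binop := Add | Sub | Mul | Div | Mod | And | Or | Xor | Shl | Shr.

Definition eval_binop (o : binop) : Z -> Z -> Z :=
  match o with
  | Add => Z.add | Sub => Z.sub | Mul => Z.mul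
  | Div => Z.div | Mod => Z.modulo
  | And => Z.land | Or => Z.lor | Xor => Z.lxor
  | Shl => Z.shiftl | Shr => Z.shiftr
  end.

Inductive instr :=
| Const (d : nat) (z : Z)               (* R[d] := z *)
| Op (o : binop) (d a b : nat)          (* R[d] := R[a] o R[b] *)
| Read (d a : nat)                      (* R[d] := M[R[a]] *)
| Write (a b : nat)                     (* M[R[a]] := R[b] *)
| Flip (d : nat)                        (* R[d] := fair coin in {0,1} *)
| BranchEq (a b l : nat)                (* if R[a] = R[b] goto l *)
| BranchLt (a b l : nat).               (* if R[a] < R[b] goto l *)

Definition program := list instr.

(* Registers are indexed by program constants, so a program uses finitely many
   of them; memory is addressed by words. *)
Record config := Config { pc : nat; regs : nat -> Z; mem : Z -> Z }.

Definition upd_reg (f : nat -> Z) (i : nat) (v : Z) : nat -> Z :=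
  fun j => if Nat.eqb j i then v else f j.

Definition upd_mem (f : Z -> Z) (a v : Z) : Z -> Z :=
  fun b => if Z.eqb b a then v else f b.

(* A run halts when it leaves the program. *)
Definition halted (P : program) (c : config) : bool :=
  Nat.leb (length P) (pc c).

(* Every step receives a fresh coin [b], which only [Flip] looks at. *)
Definition step (P : program) (w : nat) (b : bool) (c : config) : config :=
  let R := regs c in
  let M := mem c in
  let set d v := Config (S (pc c)) (upd_reg R d v) M in
  match nth_error P (pc c) with
  | None => c
  | Some (Const d z) => set d (wrap w z)
  | Some (Op o d x y) => set d (wrap w (eval_binop o (R x) (R y)))
  | Some (Read d x) => set d (M (R x))
  | Some (Write x y) => Config (S (pc c)) R (upd_mem M (R x) (R y))
  | Some (Flip d) => set d (if b then 1%Z else 0%Z)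
  | Some (BranchEq x y l) =>
      Config (if Z.eqb (R x) (R y) then l else S (pc c)) R M
  | Some (BranchLt x y l) =>
      Config (if Z.ltb (R x) (R y) then l else S (pc c)) R M
  end.

(* The run on the coins [bs], cut off after [length bs] steps. *)
Fixpoint exec (P : program) (w : nat) (bs : list bool) (c : config) : config :=
  match bs with
  | [] => c
  | b :: bs' => if halted P c then c else exec P w bs' (step P w b c)
  end.

Fixpoint steps (P : program) (w : nat) (bs : list bool) (c : config) : nat :=
  match bs with
  | [] => 0%nat
  | b :: bs' => if halted P c then 0%nat else S (steps P w bs' (step P w b c))
  end.

(* Expectation of [f] over [t] independent fair coins. *)
Fixpoint coin_mean (t : nat) (f : list bool -> R) : R :=
  match t with
  | O => f []
  | S t' => (coin_mean t' (fun bs => f (true :: bs)) +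
             coin_mean t' (fun bs => f (false :: bs))) / 2
  end.

(* E[T] = sup_t E[min(T, t)], equal to +oo if it diverges or if the run fails
   to halt with positive probability. *)
Definition expected_time (P : program) (w : nat) (c : config) : Rbar :=
  Sup_seq (fun t => Finite (coin_mean t (fun bs => INR (steps P w bs c)))).

Definition start (R : nat -> Z) (M : Z -> Z) : config := Config 0 R M.

(* Input sequence in cells 0, 1, ..., all other cells 0. *)
Definition input_mem (l : list Z) : Z -> Z :=
  fun a => if Z.leb 0 a then nth (Z.to_nat a) l 0%Z else 0%Z.

(* Input length in register 0, all other registers 0. *)
Definition input_config (l : list Z) : config :=
  start (upd_reg (fun _ => 0%Z) 0 (Z.of_nat (length l))) (input_mem l).

Definition accepts (c : config) : Prop := regs c 0%nat <> 0%Z.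

Definition worst_case {A : Type} (input : A -> Prop) (cost : A -> Rbar) : Rbar :=
  Rbar_lub (fun y => exists a, input a /\ y = cost a).

(** * Convolution-3SUM *)

Definition conv3sum (xs : list Z) : Prop :=
  let x i := nth (i - 1) xs 0%Z in
  exists i j : nat,
    (1 <= j)%nat /\ (j < i)%nat /\ (i <= length xs)%nat /\
    (x i - x j)%Z = x (i - j)%nat.

Definition conv3sum_input (n : nat) (xs : list Z) : Prop :=
  length xs = n /\
  Forall (fun z => (- Z.of_nat n <= z <= Z.of_nat n)%Z) xs.

Record algorithm := Algorithm { code : program; word_const : nat }.

(* Zero-error randomized algorithms.  [2 <= word_const A] makes the input fit
   into words. *)
Definition solves_conv3sum (A : algorithm) : Prop :=
  (2 <= word_const A)%nat /\
  forall (n : nat) (xs : list Z) (bs : list bool),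
    conv3sum_input n xs ->
    let c := exec (code A) (word_size (word_const A) n) bs (input_config xs) in
    halted (code A) c = true -> (accepts c <-> conv3sum xs).

Definition conv3sum_time (A : algorithm) (n : nat) : Rbar :=
  worst_case (conv3sum_input n)
    (fun xs => expected_time (code A) (word_size (word_const A) n)
                 (input_config xs)).

(* "Requires n^(2-o(1)) time": as for any worst-case lower bound, no algorithm
   is faster for all large n, i.e. the bound is met for infinitely many n. *)
Definition strong_3SUM_hardness : Prop :=
  forall A : algorithm, solves_conv3sum A ->
  exists h : nat -> R, is_lim_seq h 0 /\
    forall n0 : nat, exists n : nat, (n0 <= n)%nat /\
      Rbar_le (Finite (Rpower (INR n) (2 - h n))) (conv3sum_time A n).

(** * Jumbled indexing *)

Definition text (r s : nat) (S : list nat) : Prop :=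
  length S = s /\ Forall (fun a => (a < r)%nat) S.

Definition parikh (r : nat) (S : list nat) : list nat :=
  map (count_occ Nat.eq_dec S) (seq 0 r).

Definition substring (S' S : list nat) : Prop :=
  exists U V : list nat, S = U ++ S' ++ V.

Definition jumbled_match (r : nat) (S psi : list nat) : Prop :=
  exists S' : list nat, substring S' S /\ parikh r S' = psi.

Record index_algorithm := IndexAlgorithm
  { pre_code : program; query_code : program; index_word_const : nat }.

(* r is constant, so this is O(log s); adding r makes letters fit even when s
   is small. *)
Definition index_word_size (r : nat) (J : index_algorithm) (s : nat) : nat :=
  word_size (index_word_const J) (s + r).

Definition query_vector (r : nat) (J : index_algorithm) (s : nat) (psi : list nat) : Prop :=
  length psi = r /\
  Forall (fun k => (Z.of_nat k < 2 ^ (Z.of_nat (index_word_size r J s) - 1))%Z) psi.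

Definition pre_config (S : list nat) : config :=
  input_config (map Z.of_nat S).

(* A query finds its vector in registers 0, ..., r-1 and the index in the
   memory left by preprocessing. *)
Definition query_config (c : config) (psi : list nat) : config :=
  start (fun i => Z.of_nat (nth i psi 0%nat)) (mem c).

Definition solves_jumbled_indexing (r : nat) (J : index_algorithm) : Prop :=
  (2 <= index_word_const J)%nat /\
  forall (s : nat) (S psi : list nat) (bs bs' : list bool),
    text r s S -> query_vector r J s psi ->
    let w := index_word_size r J s in
    let c := exec (pre_code J) w bs (pre_config S) in
    halted (pre_code J) c = true ->
    let c' := exec (query_code J) w bs' (query_config c psi) in
    halted (query_code J) c' = true ->
    (accepts c' <-> jumbled_match r S psi).

Definition preprocessing_time (r : nat) (J : index_algorithm) (s : nat) : Rbar :=
  worst_case (text r s)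
    (fun S => expected_time (pre_code J) (index_word_size r J s) (pre_config S)).

(* Expectation over the coins of both preprocessing and query. *)
Definition expected_query_time (r : nat) (J : index_algorithm) (s : nat) (S psi : list nat) : Rbar :=
  let w := index_word_size r J s in
  Sup_seq (fun t => Finite (coin_mean t (fun bs =>
    let c := exec (pre_code J) w bs (pre_config S) in
    if halted (pre_code J) c then
      coin_mean t (fun bs' => INR (steps (query_code J) w bs' (query_config c psi)))
    else 0))).

Definition query_time (r : nat) (J : index_algorithm) (s : nat) : Rbar :=
  worst_case (fun p => text r s (fst p) /\ query_vector r J s (snd p))
    (fun p => expected_query_time r J s (fst p) (snd p)).

(* f is not o(g).  The "for all large s" variant of Omega would make the
   dichotomy false: an index may preprocess everything for even s and nothing
   for odd s, so that neither time is large for all large s. *)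
Definition is_Omega (f : nat -> Rbar) (g : nat -> R) : Prop :=
  exists k : R, 0 < k /\
    forall s0 : nat, exists s : nat, (s0 <= s)%nat /\
      Rbar_le (Finite (k * g s)) (f s).

(* Main.v *)
(** An index for alphabet size [r = k + 3] is turned into a program for
    Convolution-3SUM.  Write the numbers in a base [B] of size about
    [n^(1/(k+1))] with [k + 1] digits.  The text has a block for each pair of
    consecutive inputs [x], [y]: letter [a] occurs [y_a - x_a + 3B] times in
    it, a filler letter pads the block to a fixed length, and a separator ends
    it.  Digit differences telescope along consecutive blocks, so [h] blocks
    starting at [x_j] encode the digits of [x_(j+h)] and [x_j]; the condition
    [x_(j+h) - x_j = x_h] holds iff they differ by the digits of [x_h] for one
    of the [2^k] possible carry vectors.  Prescribing the length and the number
    of separators of a substring forces it to consist of whole blocks, hence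
    [O(n)] queries to a text of length [O(n^(1+1/(k+1)))] decide the instance.

    The program simulates the index on its longer words.  A query may destroy
    the index, so its writes go to a time-stamped overlay.  Linearity of
    expectation bounds the expected time by that of the preprocessing plus that
    of the queries, up to a constant factor and the time to write the text. *)

Require Import Defs.
From Stdlib Require Import Lia Lra Classical.
Set Bullet Behavior "Strict Subproofs".

(** * Coin means and expected decisions *)

Lemma coin_mean_le (t : nat) (f g : list bool -> R) :
  (forall bs, f bs <= g bs) -> coin_mean t f <= coin_mean t g.
Proof.
  revert f g; induction t as [|t IH]; intros f g Hfg; simpl; [apply Hfg|].
  pose proof (IH (fun bs => f (true :: bs)) (fun bs => g (true :: bs))
                 (fun bs => Hfg (true :: bs))).
  pose proof (IH (fun bs => f (false :: bs)) (fun bs => g (false :: bs))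
                 (fun bs => Hfg (false :: bs))).
  lra.
Qed.

Lemma coin_mean_ext (t : nat) (f g : list bool -> R) :
  (forall bs, f bs = g bs) -> coin_mean t f = coin_mean t g.
Proof.
  intros Hfg; apply Rle_antisym; apply coin_mean_le; intros bs; rewrite Hfg; lra.
Qed.

Lemma coin_mean_const (t : nat) (a : R) : coin_mean t (fun _ => a) = a.
Proof. induction t as [|t IH]; simpl; [reflexivity | rewrite IH; lra]. Qed.

Lemma coin_mean_plus (t : nat) (f g : list bool -> R) :
  coin_mean t (fun bs => f bs + g bs) = coin_mean t f + coin_mean t g.
Proof.
  revert f g; induction t as [|t IH]; intros f g; simpl; [reflexivity|].
  rewrite !IH; lra.
Qed.

Lemma coin_mean_scal (t : nat) (a : R) (f : list bool -> R) :
  coin_mean t (fun bs => a * f bs) = a * coin_mean t f.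
Proof.
  revert f; induction t as [|t IH]; intros f; simpl; [reflexivity|].
  rewrite !IH; lra.
Qed.

Lemma coin_mean_nonneg (t : nat) (f : list bool -> R) :
  (forall bs, 0 <= f bs) -> 0 <= coin_mean t f.
Proof. intros Hf; rewrite <- (coin_mean_const t 0); now apply coin_mean_le. Qed.

Lemma Sup_seq_ge (u : nat -> R) (t : nat) :
  Rbar_le (Finite (u t)) (Sup_seq (fun t => Finite (u t))).
Proof. apply (Sup_seq_minor_le (fun t => Finite (u t)) _ t), Rbar_le_refl. Qed.

Lemma Sup_seq_le_bound (u : nat -> R) (b : R) :
  (forall t, u t <= b) -> Rbar_le (Sup_seq (fun t => Finite (u t))) (Finite b).
Proof.
  intros Hu; apply (proj2 (is_sup_seq_lub _ _ (Sup_seq_correct (fun t => Finite (u t))))).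
  intros y [t Ey]; rewrite Ey; apply Hu.
Qed.

Lemma worst_case_ge {A : Type} (input : A -> Prop) (cost : A -> Rbar) (a : A) :
  input a -> Rbar_le (cost a) (worst_case input cost).
Proof.
  intros Ha; unfold worst_case, Rbar_lub.
  destruct (Rbar_ex_lub _) as [l [Hub Hlub]]; apply Hub; eauto.
Qed.

Lemma worst_case_le {A : Type} (input : A -> Prop) (cost : A -> Rbar) (b : Rbar) :
  (forall a, input a -> Rbar_le (cost a) b) -> Rbar_le (worst_case input cost) b.
Proof.
  intros Hb; unfold worst_case, Rbar_lub.
  destruct (Rbar_ex_lub _) as [l [Hub Hlub]]; apply Hlub.
  intros y (a & Ha & Ey); rewrite Ey; auto.
Qed.

Definition fair (f : bool -> R) : R := (f true + f false) / 2.

Section Runs.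

Variables (P : program) (w : nat).

Definition mean_steps (t : nat) (c : config) : R :=
  coin_mean t (fun bs => INR (steps P w bs c)).

Lemma mean_steps_halted t c : halted P c = true -> mean_steps t c = 0.
Proof.
  intros Hc; unfold mean_steps.
  rewrite (coin_mean_ext _ _ (fun _ => 0)); [apply coin_mean_const|].
  intros [|b bs]; simpl; [|rewrite Hc]; reflexivity.
Qed.

Lemma mean_steps_S t c :
  halted P c = false ->
  mean_steps (S t) c = 1 + fair (fun b => mean_steps t (step P w b c)).
Proof.
  intros Hc; unfold mean_steps, fair; simpl coin_mean; rewrite Hc.
  assert (first_step : forall b,
    coin_mean t (fun bs => INR (S (steps P w bs (step P w b c)))) =
    1 + coin_mean t (fun bs => INR (steps P w bs (step P w b c)))).
  { intros b; rewrite <- (coin_mean_const t 1) at 1; rewrite <- coin_mean_plus.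
    apply coin_mean_ext; intros bs; rewrite S_INR; lra. }
  rewrite !first_step; lra.
Qed.

Lemma mean_steps_nonneg t c : 0 <= mean_steps t c.
Proof. apply coin_mean_nonneg; intros bs; apply pos_INR. Qed.

Lemma mean_steps_succ t c : mean_steps t c <= mean_steps (S t) c.
Proof.
  revert c; induction t as [|t IH]; intros c.
  - replace (mean_steps 0 c) with 0 by reflexivity; apply mean_steps_nonneg.
  - destruct (halted P c) eqn:Hc; [rewrite !mean_steps_halted by easy; lra|].
    rewrite !(mean_steps_S _ _ Hc); unfold fair.
    pose proof (IH (step P w true c)); pose proof (IH (step P w false c)); lra.
Qed.

Lemma mean_steps_mono t t' c : (t <= t')%nat -> mean_steps t c <= mean_steps t' c.
Proof.
  induction 1 as [|t' _ IH]; [lra|].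
  pose proof (mean_steps_succ t' c); lra.
Qed.

Definition halting_mean (t : nat) (c : config) (G : config -> R) : R :=
  coin_mean t (fun bs => let c' := exec P w bs c in if halted P c' then G c' else 0).

Lemma halting_mean_halted t c G : halted P c = true -> halting_mean t c G = G c.
Proof.
  intros Hc; unfold halting_mean.
  rewrite (coin_mean_ext _ _ (fun _ => G c)); [apply coin_mean_const|].
  intros [|b bs]; simpl; rewrite ?Hc; reflexivity.
Qed.

Lemma halting_mean_S t c G :
  halted P c = false ->
  halting_mean (S t) c G = fair (fun b => halting_mean t (step P w b c) G).
Proof. intros Hc; unfold halting_mean; simpl; rewrite Hc; reflexivity. Qed.

Lemma halting_mean_nonneg t c G : (forall c, 0 <= G c) -> 0 <= halting_mean t c G.
Proof.
  intros HG; apply coin_mean_nonneg; intros bs; cbv zeta.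
  destruct (halted P _); [apply HG | lra].
Qed.

Lemma halting_mean_plus t c G G' :
  halting_mean t c (fun c => G c + G' c) = halting_mean t c G + halting_mean t c G'.
Proof.
  unfold halting_mean; rewrite <- coin_mean_plus; apply coin_mean_ext; intros bs; cbv zeta.
  destruct (halted P _); lra.
Qed.

Lemma halting_mean_scal t c a G :
  halting_mean t c (fun c => a * G c) = a * halting_mean t c G.
Proof.
  unfold halting_mean; rewrite <- coin_mean_scal; apply coin_mean_ext; intros bs; cbv zeta.
  destruct (halted P _); lra.
Qed.

Lemma halting_mean_const_le t c a : 0 <= a -> halting_mean t c (fun _ => a) <= a.
Proof.
  intros Ha; eapply Rle_trans; [|apply Req_le, (coin_mean_const t)].
  apply coin_mean_le; intros bs; cbv zeta; destruct (halted P _); lra.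
Qed.

Lemma halted_at p R M i :
  nth_error P p = Some i -> halted P (Config p R M) = false.
Proof.
  intros Hp; apply Nat.leb_gt; simpl.
  apply nth_error_Some; rewrite Hp; discriminate.
Qed.

Inductive reaches : nat -> config -> config -> Prop :=
| reaches_refl c : reaches 0 c c
| reaches_step k c c1 c2 :
    halted P c = false -> (forall b, step P w b c = c1) ->
    reaches k c1 c2 -> reaches (S k) c c2.

Lemma reaches_trans k1 k2 c1 c2 c3 :
  reaches k1 c1 c2 -> reaches k2 c2 c3 -> reaches (k1 + k2) c1 c3.
Proof. induction 1; intros; simpl; [easy | econstructor; eauto]. Qed.

Lemma reaches_one c c' :
  halted P c = false -> (forall b, step P w b c = c') -> reaches 1 c c'.
Proof. intros Hc Hstep; econstructor; eauto; constructor. Qed.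

(* Time and correctness are bounded by one predicate, so that a single
   traversal of the program establishes both. *)
Definition decides_within (A : Prop) (t : nat) (c : config) (v : R) : Prop :=
  mean_steps t c <= v /\
  forall bs, (length bs <= t)%nat -> halted P (exec P w bs c) = true ->
    (accepts (exec P w bs c) <-> A).

Lemma decides_within_weaken A t t' c v v' :
  (t' <= t)%nat -> v <= v' -> decides_within A t c v -> decides_within A t' c v'.
Proof.
  intros Ht Hv [Htime Hcorrect]; split.
  - pose proof (mean_steps_mono t' t c Ht); lra.
  - intros bs Hbs; apply Hcorrect; lia.
Qed.

Lemma decides_within_0 A c v : halted P c = false -> 0 <= v -> decides_within A 0 c v.
Proof.
  intros Hc Hv; split; [exact Hv|].
  intros [|b bs] Hbs; simpl in *; [congruence | lia].
Qed.

Lemma decides_within_fair A t c v :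
  halted P c = false -> (forall b, decides_within A t (step P w b c) (v b)) ->
  decides_within A (S t) c (1 + fair v).
Proof.
  intros Hc Hstep; split.
  - rewrite mean_steps_S by easy; unfold fair.
    destruct (Hstep true) as [Htrue _], (Hstep false) as [Hfalse _]; lra.
  - intros [|b bs] Hbs; simpl in *; [congruence|].
    rewrite Hc; apply (Hstep b); lia.
Qed.

Lemma decides_within_reaches A k t c c' v :
  reaches k c c' -> 0 <= v -> decides_within A t c' v -> decides_within A t c (INR k + v).
Proof.
  intros Hr Hv; revert t; induction Hr as [c | k c c1 c2 Hc Hstep Hr IH]; intros t Hdec.
  - simpl; rewrite Rplus_0_l; exact Hdec.
  - apply (decides_within_weaken A (S t) t c (1 + fair (fun _ => INR k + v)));
      [lia | rewrite S_INR; unfold fair; lra|].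
    apply decides_within_fair; [easy|]; intros b; rewrite Hstep; auto.
Qed.

Lemma decides_within_halted A t c :
  halted P c = true -> (accepts c <-> A) -> decides_within A t c 0.
Proof.
  intros Hc HA; split; [rewrite mean_steps_halted by easy; lra|].
  intros [|b bs] _; simpl; [|rewrite Hc]; auto.
Qed.

End Runs.

(** * A structured language *)

Inductive test := TEq (a b : nat) | TLt (a b : nat).

Inductive cmd :=
| Konst (d : nat) (z : Z)
| Bin (o : binop) (d a b : nat)
| Fetch (d a : nat)
| Store (a b : nat)
| Toss (d : nat)
| Nop
| Seq (c1 c2 : cmd)
| If (q : test) (c1 c2 : cmd)
| While (q : test) (c : cmd).

Infix ";;" := Seq (at level 60, right associativity).

Definition branch (q : test) (l : nat) : instr :=
  match q with TEq a b => BranchEq a b l | TLt a b => BranchLt a b l end.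

Definition goto (l : nat) : instr := BranchEq 0 0 l.

Definition holds (q : test) (R : nat -> Z) : bool :=
  match q with TEq a b => Z.eqb (R a) (R b) | TLt a b => Z.ltb (R a) (R b) end.

Fixpoint size (C : cmd) : nat :=
  match C with
  | Nop => 0
  | Seq a b => size a + size b
  | If _ a b => size a + size b + 2
  | While _ a => size a + 3
  | _ => 1
  end.

(* [p] is the address at which the code will be placed; jumps are absolute. *)
Fixpoint compile (p : nat) (C : cmd) : program :=
  match C with
  | Konst d z => [Const d z]
  | Bin o d a b => [Op o d a b]
  | Fetch d a => [Read d a]
  | Store a b => [Write a b]
  | Toss d => [Flip d]
  | Nop => []
  | Seq a b => compile p a ++ compile (p + size a) b
  | If q a b =>
      branch q (p + size b + 2) :: compile (p + 1) b ++
      goto (p + size a + size b + 2) :: compile (p + size b + 2) a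
  | While q a =>
      branch q (p + 2) :: goto (p + size a + 3) :: compile (p + 2) a ++ [goto p]
  end.

Lemma length_compile p C : length (compile p C) = size C.
Proof.
  revert p; induction C; intros p; simpl; auto;
    repeat (rewrite length_app; simpl); repeat match goal with
    | IH : forall p, length (compile p ?C) = _ |- _ => rewrite IH; clear IH end; lia.
Qed.

Definition contains_at (P : program) (p : nat) (l : program) : Prop :=
  exists X Y, P = X ++ l ++ Y /\ length X = p.

Lemma contains_at_app P p l l' :
  contains_at P p (l ++ l') -> contains_at P p l /\ contains_at P (p + length l) l'.
Proof.
  intros (X & Y & -> & <-); split.
  - exists X, (l' ++ Y); now rewrite <- app_assoc.
  - exists (X ++ l), Y; now rewrite length_app, <- !app_assoc.
Qed.

Lemma contains_at_cons P p i l :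
  contains_at P p (i :: l) -> nth_error P p = Some i /\ contains_at P (p + 1) l.
Proof.
  intros H; destruct (contains_at_app P p [i] l H) as [(X & Y & -> & <-) Hl]; split.
  - rewrite nth_error_app2, Nat.sub_diag by lia; reflexivity.
  - exact Hl.
Qed.

Definition code_at (P : program) (p : nat) (C : cmd) : Prop := contains_at P p (compile p C).

Lemma code_at_compile C : code_at (compile 0 C) 0 C.
Proof. exists [], []; now rewrite app_nil_r. Qed.

Lemma code_at_seq P p C1 C2 :
  code_at P p (C1 ;; C2) -> code_at P p C1 /\ code_at P (p + size C1) C2.
Proof.
  intros H; apply contains_at_app in H; now rewrite length_compile in H.
Qed.

Lemma code_at_if P p q C1 C2 :
  code_at P p (If q C1 C2) ->
  nth_error P p = Some (branch q (p + size C2 + 2)) /\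
  code_at P (p + 1) C2 /\
  nth_error P (p + 1 + size C2) = Some (goto (p + size C1 + size C2 + 2)) /\
  code_at P (p + size C2 + 2) C1.
Proof.
  unfold code_at; cbn [compile]; intros H.
  apply contains_at_cons in H as [Htest H].
  apply contains_at_app in H as [Helse H]; rewrite length_compile in H.
  apply contains_at_cons in H as [Hskip Hthen].
  replace (p + 1 + size C2 + 1)%nat with (p + size C2 + 2)%nat in Hthen by lia; auto.
Qed.

Lemma code_at_while P p q C :
  code_at P p (While q C) ->
  nth_error P p = Some (branch q (p + 2)) /\
  nth_error P (p + 1) = Some (goto (p + size C + 3)) /\
  code_at P (p + 2) C /\
  nth_error P (p + 2 + size C) = Some (goto p).
Proof.
  unfold code_at; cbn [compile]; intros H.
  apply contains_at_cons in H as [Htest H].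
  apply contains_at_cons in H as [Hexit H].
  replace (p + 1 + 1)%nat with (p + 2)%nat in H by lia.
  apply contains_at_app in H as [Hbody H]; rewrite length_compile in H.
  apply contains_at_cons in H as [Hback _]; auto.
Qed.

Lemma step_branch P w p q l R M b :
  nth_error P p = Some (branch q l) ->
  step P w b (Config p R M) = Config (if holds q R then l else p + 1) R M.
Proof.
  intros Hp; unfold step; simpl; rewrite Hp, Nat.add_1_r; destruct q; reflexivity.
Qed.

Lemma reaches_branch P w p q l R M :
  nth_error P p = Some (branch q l) ->
  reaches P w 1 (Config p R M) (Config (if holds q R then l else p + 1) R M).
Proof.
  intros Hp; apply reaches_one; [eapply halted_at, Hp | intros b; now apply step_branch].
Qed.

Lemma reaches_goto P w p l R M :
  nth_error P p = Some (goto l) -> reaches P w 1 (Config p R M) (Config l R M).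
Proof.
  intros Hp; pose proof (reaches_branch P w p (TEq 0 0) l R M Hp) as H.
  cbn [holds] in H; now rewrite Z.eqb_refl in H.
Qed.

Lemma reaches_while_exit P w p q C R M :
  code_at P p (While q C) -> holds q R = false ->
  reaches P w 2 (Config p R M) (Config (p + size (While q C)) R M).
Proof.
  intros (Htest & Hexit & _)%code_at_while Hq.
  apply (reaches_branch _ w _ _ _ R M) in Htest; rewrite Hq in Htest.
  apply (reaches_trans _ _ 1 1 _ _ _ Htest).
  cbn [size]; rewrite Nat.add_assoc; now apply reaches_goto.
Qed.

Lemma reaches_while_enter P w p q C R M :
  code_at P p (While q C) -> holds q R = true ->
  reaches P w 1 (Config p R M) (Config (p + 2) R M).
Proof.
  intros (Htest & _)%code_at_while Hq.
  apply (reaches_branch _ w _ _ _ R M) in Htest; now rewrite Hq in Htest.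
Qed.

Lemma reaches_while_repeat P w p q C R M :
  code_at P p (While q C) ->
  reaches P w 1 (Config (p + 2 + size C) R M) (Config p R M).
Proof. intros (_ & _ & _ & Hback)%code_at_while; now apply reaches_goto. Qed.

(* Total correctness with a cost bound [n], for commands whose run does not
   reach a [Toss]. *)
Definition runs (w : nat) (C : cmd) (R : nat -> Z) (M : Z -> Z) (n : nat)
    (Post : (nat -> Z) -> (Z -> Z) -> Prop) : Prop :=
  exists R' M' k, (k <= n)%nat /\ Post R' M' /\
    forall P p, code_at P p C ->
      reaches P w k (Config p R M) (Config (p + size C) R' M').

Section RunsRules.

Variables (w : nat) (R : nat -> Z) (M : Z -> Z).

Lemma runs_weaken C n n' (Q Q' : _ -> _ -> Prop) :
  (n <= n')%nat -> (forall R' M', Q R' M' -> Q' R' M') ->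
  runs w C R M n Q -> runs w C R M n' Q'.
Proof.
  intros Hn HQ (R' & M' & k & Hk & HP & Hrun).
  exists R', M', k; repeat split; auto; lia.
Qed.

Lemma runs_cost_le C n n' (Q : _ -> _ -> Prop) :
  runs w C R M n Q -> (n <= n')%nat -> runs w C R M n' Q.
Proof. intros Hrun Hn; revert Hrun; now apply runs_weaken. Qed.

Lemma runs_nop (Q : _ -> _ -> Prop) : Q R M -> runs w Nop R M 0 Q.
Proof.
  intros HQ; exists R, M, 0%nat; repeat split; auto.
  intros; simpl; rewrite Nat.add_0_r; constructor.
Qed.

Lemma runs_instr C i R' M' (Q : _ -> _ -> Prop) :
  (forall p, compile p C = [i]) ->
  (forall P p b, nth_error P p = Some i ->
     step P w b (Config p R M) = Config (S p) R' M') ->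
  Q R' M' -> runs w C R M 1 Q.
Proof.
  intros HC Hstep HQ; exists R', M', 1%nat; repeat split; auto.
  intros P p Hp; rewrite <- (length_compile p), HC; cbn [length]; rewrite Nat.add_1_r.
  unfold code_at in Hp; rewrite HC in Hp; apply contains_at_cons in Hp as [Hp _].
  apply reaches_one; [eapply halted_at, Hp | intros b; now apply Hstep].
Qed.

Lemma runs_konst d z v (Q : _ -> _ -> Prop) :
  wrap w z = v -> Q (upd_reg R d v) M -> runs w (Konst d z) R M 1 Q.
Proof.
  intros <-; apply (runs_instr _ (Const d z)); [reflexivity|].
  intros P p b Hp; unfold step; simpl; now rewrite Hp.
Qed.

Lemma runs_bin o d a b x y v (Q : _ -> _ -> Prop) :
  R a = x -> R b = y -> wrap w (eval_binop o x y) = v ->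
  Q (upd_reg R d v) M -> runs w (Bin o d a b) R M 1 Q.
Proof.
  intros <- <- <-; apply (runs_instr _ (Op o d a b)); [reflexivity|].
  intros P p bit Hp; unfold step; simpl; now rewrite Hp.
Qed.

Lemma runs_fetch d a x v (Q : _ -> _ -> Prop) :
  R a = x -> M x = v -> Q (upd_reg R d v) M -> runs w (Fetch d a) R M 1 Q.
Proof.
  intros <- <-; apply (runs_instr _ (Read d a)); [reflexivity|].
  intros P p b Hp; unfold step; simpl; now rewrite Hp.
Qed.

Lemma runs_store a b x v (Q : _ -> _ -> Prop) :
  R a = x -> R b = v -> Q R (upd_mem M x v) -> runs w (Store a b) R M 1 Q.
Proof.
  intros <- <-; apply (runs_instr _ (Write a b)); [reflexivity|].
  intros P p bit Hp; unfold step; simpl; now rewrite Hp.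
Qed.

Lemma runs_seq C1 C2 n1 n2 (Q : _ -> _ -> Prop) :
  runs w C1 R M n1 (fun R1 M1 => runs w C2 R1 M1 n2 Q) ->
  runs w (C1 ;; C2) R M (n1 + n2) Q.
Proof.
  intros (R1 & M1 & k1 & Hk1 & (R2 & M2 & k2 & Hk2 & HQ & Hrun2) & Hrun1).
  exists R2, M2, (k1 + k2)%nat; repeat split; [lia | auto |].
  intros P p [Hp1 Hp2]%code_at_seq; simpl size; rewrite Nat.add_assoc.
  eapply reaches_trans; eauto.
Qed.

Lemma runs_then C1 C2 n1 n2 (Q1 Q : _ -> _ -> Prop) :
  runs w C1 R M n1 Q1 -> (forall R' M', Q1 R' M' -> runs w C2 R' M' n2 Q) ->
  runs w (C1 ;; C2) R M (n1 + n2) Q.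
Proof.
  intros Hrun1 Hrun2; apply runs_seq; revert Hrun1; now apply runs_weaken.
Qed.

Lemma runs_if q C1 C2 n (Q : _ -> _ -> Prop) :
  (if holds q R then runs w C1 R M n Q else runs w C2 R M n Q) ->
  runs w (If q C1 C2) R M (n + 2) Q.
Proof.
  destruct (holds q R) eqn:Hq; intros (R' & M' & k & Hk & HQ & Hrun).
  - exists R', M', (1 + k)%nat; repeat split; [lia | auto |].
    intros P p (Htest & _ & _ & Hthen)%code_at_if.
    apply (reaches_branch _ w _ _ _ R M) in Htest; rewrite Hq in Htest.
    eapply reaches_trans; [exact Htest|].
    cbn [size]; replace (p + (size C1 + size C2 + 2))%nat with (p + size C2 + 2 + size C1)%nat
      by lia; auto.
  - exists R', M', (1 + (k + 1))%nat; repeat split; [lia | auto |].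
    intros P p (Htest & Helse & Hskip & _)%code_at_if.
    apply (reaches_branch _ w _ _ _ R M) in Htest; rewrite Hq in Htest.
    eapply reaches_trans; [exact Htest|].
    eapply reaches_trans; [apply Hrun, Helse|].
    cbn [size]; rewrite !Nat.add_assoc; now apply reaches_goto.
Qed.

End RunsRules.

Lemma runs_while w q C (I : nat -> (nat -> Z) -> (Z -> Z) -> Prop) n j R M
    (Q : _ -> _ -> Prop) :
  I j R M ->
  (forall i R M, I (S i) R M -> holds q R = true /\ runs w C R M n (I i)) ->
  (forall R M, I 0%nat R M -> holds q R = false /\ Q R M) ->
  runs w (While q C) R M (j * (n + 2) + 2) Q.
Proof.
  intros HI Hbody Hexit; revert R M HI; induction j as [|j IH]; intros R M HI.
  - destruct (Hexit R M HI) as [Hq HQ].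
    exists R, M, 2%nat; repeat split; [simpl; lia | auto |].
    intros P p Hp; now apply reaches_while_exit.
  - destruct (Hbody j R M HI) as (Hq & R1 & M1 & k1 & Hk1 & HI1 & Hrun1).
    destruct (IH R1 M1 HI1) as (R2 & M2 & k2 & Hk2 & HQ & Hrun2).
    exists R2, M2, (1 + (k1 + (1 + k2)))%nat; repeat split; [simpl; lia | auto |].
    intros P p Hp; pose proof (code_at_while _ _ _ _ Hp) as (_ & _ & Hbody_at & _).
    eapply reaches_trans; [eapply reaches_while_enter; eauto|].
    eapply reaches_trans; [apply Hrun1, Hbody_at|].
    eapply reaches_trans; [eapply reaches_while_repeat, Hp | apply Hrun2, Hp].
Qed.

Lemma decides_within_runs P w A t p C R M n v (Q : _ -> _ -> Prop) :
  runs w C R M n Q -> code_at P p C -> 0 <= v ->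
  (forall R' M', Q R' M' -> decides_within P w A t (Config (p + size C) R' M') v) ->
  decides_within P w A t (Config p R M) (INR n + v).
Proof.
  intros (R' & M' & k & Hk & HQ & Hrun) Hp Hv Hdec.
  apply (decides_within_weaken P w A t t _ (INR k + v)); [lia | apply le_INR in Hk; lra|].
  eapply decides_within_reaches; [apply Hrun, Hp | exact Hv | auto].
Qed.

Lemma decides_within_toss P w A t p d R M v :
  code_at P p (Toss d) ->
  (forall b : bool, decides_within P w A t
     (Config (p + 1) (upd_reg R d (if b then 1 else 0)%Z) M) (v b)) ->
  decides_within P w A (S t) (Config p R M) (1 + fair v).
Proof.
  intros [Hp _]%contains_at_cons Hdec.
  apply decides_within_fair; [eapply halted_at, Hp|].
  intros b; unfold step; simpl; rewrite Hp, <- Nat.add_1_r; apply Hdec.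
Qed.

(** * Simulating a word RAM on longer words *)

Definition fits (W : nat) (z : Z) : Prop :=
  (- 2 ^ (Z.of_nat W - 1) <= z < 2 ^ (Z.of_nat W - 1))%Z.

Lemma pow2_half (W : nat) :
  (1 <= W)%nat -> (2 ^ Z.of_nat W = 2 * 2 ^ (Z.of_nat W - 1) /\ 0 < 2 ^ (Z.of_nat W - 1))%Z.
Proof.
  intros HW; split; [|apply Z.pow_pos_nonneg; lia].
  rewrite <- Z.pow_succ_r by lia; f_equal; lia.
Qed.

Lemma wrap_fits W z : (1 <= W)%nat -> fits W (wrap W z).
Proof.
  intros HW; destruct (pow2_half W HW) as [Hdouble Hpos]; unfold fits, wrap.
  pose proof (Z.mod_pos_bound (z + 2 ^ (Z.of_nat W - 1)) (2 ^ Z.of_nat W)); lia.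
Qed.

Lemma wrap_id W z : (1 <= W)%nat -> fits W z -> wrap W z = z.
Proof.
  intros HW Hz; destruct (pow2_half W HW) as [Hdouble Hpos]; unfold fits, wrap in *.
  rewrite Z.mod_small; lia.
Qed.

Lemma wrap_congruent W z : exists q, wrap W z = (z - 2 ^ Z.of_nat W * q)%Z.
Proof.
  unfold wrap; exists ((z + 2 ^ (Z.of_nat W - 1)) / 2 ^ Z.of_nat W)%Z.
  rewrite Z.mod_eq; [lia|]; apply Z.pow_nonzero; lia.
Qed.

(* The reduction modulo 2^w performed by the simulating machine is invisible
   after reduction modulo 2^W, so every operation is simulated alike. *)
Lemma wrap_wrap W w z : (1 <= W < w)%nat ->
  wrap w (wrap w (wrap w (wrap w z + 2 ^ (Z.of_nat W - 1)) mod 2 ^ Z.of_nat W)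
          - 2 ^ (Z.of_nat W - 1)) = wrap W z.
Proof.
  intros HW; destruct (pow2_half W ltac:(lia)) as [Hdouble Hpos].
  set (half := (2 ^ (Z.of_nat W - 1))%Z) in *.
  set (range := (2 ^ Z.of_nat W)%Z) in *.
  assert (Hrange : (range <= 2 ^ (Z.of_nat w - 1))%Z)
    by (apply Z.pow_le_mono_r; lia).
  assert (Hmod : (wrap w (wrap w z + half) mod range = (z + half) mod range)%Z).
  { destruct (wrap_congruent w (wrap w z + half)) as [a ->].
    destruct (wrap_congruent w z) as [b ->].
    replace (2 ^ Z.of_nat w)%Z with (range * 2 ^ (Z.of_nat w - Z.of_nat W))%Z
      by (unfold range; rewrite <- Z.pow_add_r by lia; f_equal; lia).
    set (ratio := (2 ^ (Z.of_nat w - Z.of_nat W))%Z).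
    replace (z - range * ratio * b + half - range * ratio * a)%Z
      with (z + half + (- (ratio * b) - ratio * a) * range)%Z by ring.
    apply Z.mod_add; lia. }
  rewrite Hmod.
  pose proof (Z.mod_pos_bound (z + half) range ltac:(lia)).
  rewrite (wrap_id w ((z + half) mod range)) by (try lia; unfold fits; lia).
  rewrite wrap_id by (try lia; unfold fits; lia).
  reflexivity.
Qed.

Lemma upd_reg_same R d v : upd_reg R d v d = v.
Proof. unfold upd_reg; now rewrite Nat.eqb_refl. Qed.

Lemma upd_reg_other R d v i : i <> d -> upd_reg R d v i = R i.
Proof. intros H; unfold upd_reg; destruct (Nat.eqb_spec i d); congruence. Qed.

Lemma upd_mem_same M a v : upd_mem M a v a = v.
Proof. unfold upd_mem; now rewrite Z.eqb_refl. Qed.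

Lemma upd_mem_other M a v b : b <> a -> upd_mem M a v b = M b.
Proof. intros H; unfold upd_mem; destruct (Z.eqb_spec b a); congruence. Qed.

Ltac regs_simpl := repeat (rewrite upd_reg_same || rewrite upd_reg_other by lia).

Definition changes_only (l : list nat) (R R' : nat -> Z) : Prop :=
  forall i, ~ In i l -> R' i = R i.

(* Registers below 20 are globals of the host program and are left alone by the
   simulation.  Registers 20 to 39 are scratch registers, [rPc] being the
   program counter of the simulated machine, the guest, with all its halting
   values identified.  Registers from 40 on are those of the guest. *)
Notation rRange := 8%nat (only parsing).
Notation rHalf := 9%nat (only parsing).
Notation rStamp := 15%nat (only parsing).
Notation rCodeLen := 19%nat (only parsing).
Notation rPc := 20%nat (only parsing).
Notation rCoin := 21%nat (only parsing).
Notation rTmp := 22%nat (only parsing).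
Notation rAux := 23%nat (only parsing).
Notation guest i := (40 + i)%nat (only parsing).

Definition agrees_on_globals (g R : nat -> Z) : Prop := forall i, (i < 20)%nat -> R i = g i.

Lemma globals_upd_reg g R d v :
  (20 <= d)%nat -> agrees_on_globals g R -> agrees_on_globals g (upd_reg R d v).
Proof. intros Hd HR i Hi; regs_simpl; auto. Qed.

Lemma globals_changes_only g R R' l : (forall i, In i l -> (20 <= i)%nat) ->
  changes_only l R R' -> agrees_on_globals g R -> agrees_on_globals g R'.
Proof.
  intros Hl Hch HR i Hi; rewrite Hch; [auto|].
  intros Hin; apply Hl in Hin; lia.
Qed.

Ltac rewrite_unchanged R i :=
  match goal with
  | Hch : changes_only _ _ R |- _ => rewrite (Hch i) by (cbn [In]; lia)
  | Hg : agrees_on_globals _ R |- _ => rewrite (Hg i) by lia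
  | Hsame : forall j, _ -> R j = _ |- _ => rewrite (Hsame i) by (cbn [In]; lia)
  end.

Ltac reg_value :=
  regs_simpl;
  first
    [ match goal with
      | |- ?R ?i = _ => is_var R; first [eassumption | rewrite_unchanged R i; reg_value]
      end
    | reflexivity ].

Ltac reg_unchanged :=
  repeat (regs_simpl; match goal with |- ?R ?i = _ => rewrite_unchanged R i end);
  regs_simpl; reflexivity.

Ltac unchanged :=
  let i := fresh in let Hi := fresh in intros i Hi; cbn [In] in Hi; reg_unchanged.

Ltac const_step arith := try apply runs_seq; eapply runs_konst; [arith | cbv beta].
Ltac op_step arith :=
  try apply runs_seq; eapply runs_bin; [reg_value | reg_value | arith | cbv beta].
Ltac do_fetch := try apply runs_seq; eapply runs_fetch; [reg_value | | cbv beta].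
Ltac do_store := try apply runs_seq; eapply runs_store; [reg_value | reg_value | cbv beta].

(* In [Overlay] mode a write to address [a] goes to [a + 2 * range], and is
   valid as long as [a + range] carries the current time stamp.  Raising the
   stamp thus restores the underlying memory without a rollback. *)
Inductive store_mode := InPlace | Overlay.

Definition reduce (d : nat) : cmd :=
  Bin Add rTmp rTmp rHalf ;; Bin Mod rTmp rTmp rRange ;; Bin Sub d rTmp rHalf.

Definition set_pc (len l : nat) : cmd := Konst rPc (Z.of_nat (Nat.min l len)).

Definition sim_load (mode : store_mode) (d a : nat) : cmd :=
  match mode with
  | InPlace => Fetch (guest d) (guest a)
  | Overlay =>
      Bin Add rTmp (guest a) rRange ;; Fetch rAux rTmp ;;
      If (TEq rAux rStamp)
        (Bin Add rTmp rTmp rRange ;; Fetch (guest d) rTmp)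
        (Fetch (guest d) (guest a))
  end.

Definition sim_store (mode : store_mode) (a b : nat) : cmd :=
  match mode with
  | InPlace => Store (guest a) (guest b)
  | Overlay =>
      Bin Add rTmp (guest a) rRange ;; Store rTmp rStamp ;;
      Bin Add rTmp rTmp rRange ;; Store rTmp (guest b)
  end.

Definition sim_instr (mode : store_mode) (len i : nat) (I : instr) : cmd :=
  match I with
  | Const d z => (Konst rTmp z ;; reduce (guest d)) ;; set_pc len (S i)
  | Op o d a b => (Bin o rTmp (guest a) (guest b) ;; reduce (guest d)) ;; set_pc len (S i)
  | Read d a => sim_load mode d a ;; set_pc len (S i)
  | Write a b => sim_store mode a b ;; set_pc len (S i)
  | Flip d => Bin And (guest d) rCoin rCoin ;; set_pc len (S i)
  | BranchEq a b l => If (TEq (guest a) (guest b)) (set_pc len l) (set_pc len (S i))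
  | BranchLt a b l => If (TLt (guest a) (guest b)) (set_pc len l) (set_pc len (S i))
  end.

Fixpoint dispatch (mode : store_mode) (len i : nat) (J : program) : cmd :=
  match J with
  | [] => Nop
  | ins :: J' =>
      Konst rTmp (Z.of_nat i) ;;
      If (TEq rPc rTmp) (sim_instr mode len i ins) (dispatch mode len (S i) J')
  end.

Definition sim_loop (mode : store_mode) (J : program) : cmd :=
  While (TLt rPc rCodeLen) (Toss rCoin ;; dispatch mode (length J) 0 J).

Definition instr_regs (I : instr) : list nat :=
  match I with
  | Const d _ | Flip d => [d]
  | Op _ d a b => [d; a; b]
  | Read a b | Write a b | BranchEq a b _ | BranchLt a b _ => [a; b]
  end.

Definition uses_regs (nr : nat) (J : program) : Prop :=
  Forall (fun I => Forall (fun i => (i < nr)%nat) (instr_regs I)) J.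

Record overlays (W : nat) (stamp : Z) (base guest_mem M : Z -> Z) : Prop := {
  overlay_value : forall a, fits W a ->
    guest_mem a = if Z.eqb (M (a + 2 ^ Z.of_nat W)%Z) stamp
                  then M (a + 2 * 2 ^ Z.of_nat W)%Z else base a;
  overlay_outside : forall a,
    (a < 2 ^ (Z.of_nat W - 1) \/ 5 * 2 ^ (Z.of_nat W - 1) <= a)%Z -> M a = base a;
  overlay_stamps : forall a, fits W a -> (0 <= M (a + 2 ^ Z.of_nat W) <= stamp)%Z }.

Definition represents (mode : store_mode) (W : nat) (stamp : Z) (base guest_mem M : Z -> Z)
    : Prop :=
  match mode with
  | InPlace => (forall a, fits W a -> M a = guest_mem a) /\
               (forall a, ~ fits W a -> M a = base a)
  | Overlay => overlays W stamp base guest_mem M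
  end.

Definition slowdown (J : program) : nat := (length J * 3 + 11)%nat.

Section Simulation.

Variables (mode : store_mode) (nr W w : nat) (g : nat -> Z) (J : program) (base : Z -> Z).

Record guest_state (rj : nat -> Z) (mj : Z -> Z) (R : nat -> Z) (M : Z -> Z) : Prop := {
  state_globals : agrees_on_globals g R;
  state_regs : forall i, (i < nr)%nat -> R (guest i) = rj i;
  state_regs_fit : forall i, fits W (rj i);
  state_mem_fits : forall a, fits W a -> fits W (mj a);
  state_mem : represents mode W (g rStamp) base mj M }.

Record simulates (cj : config) (R : nat -> Z) (M : Z -> Z) : Prop := {
  sim_state : guest_state (regs cj) (mem cj) R M;
  sim_pc : R rPc = Z.of_nat (Nat.min (pc cj) (length J)) }.

Hypothesis W_ge_2 : (2 <= W)%nat.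
Hypothesis W_lt_w : (W + 4 <= w)%nat.
Hypothesis code_fits : (Z.of_nat (length J) < 2 ^ (Z.of_nat w - 1))%Z.
Hypothesis regs_used : uses_regs nr J.
Hypothesis g_range : g rRange = (2 ^ Z.of_nat W)%Z.
Hypothesis g_half : g rHalf = (2 ^ (Z.of_nat W - 1))%Z.
Hypothesis g_code_len : g rCodeLen = Z.of_nat (length J).
Hypothesis stamp_nonneg : mode = Overlay -> (0 <= g rStamp)%Z.

Lemma guest_range_small : (8 * 2 ^ Z.of_nat W <= 2 ^ (Z.of_nat w - 1))%Z.
Proof.
  change 8%Z with (2 ^ 3)%Z; rewrite <- Z.pow_add_r by lia.
  apply Z.pow_le_mono_r; lia.
Qed.

Lemma wrap_address z : (- 4 * 2 ^ Z.of_nat W <= z < 4 * 2 ^ Z.of_nat W)%Z -> wrap w z = z.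
Proof.
  intros Hz; pose proof guest_range_small; apply wrap_id; [lia | unfold fits; lia].
Qed.

Lemma fits_range z : fits W z -> (- 2 ^ Z.of_nat W <= 2 * z < 2 ^ Z.of_nat W)%Z.
Proof. destruct (pow2_half W ltac:(lia)); unfold fits; lia. Qed.

Lemma guest_state_scratch rj mj R M d v :
  (20 <= d < 40)%nat -> guest_state rj mj R M -> guest_state rj mj (upd_reg R d v) M.
Proof.
  intros Hd [Hg Hregs Hrfit Hmfit Hmem]; constructor; auto.
  - apply globals_upd_reg; [lia | auto].
  - intros i Hi; regs_simpl; auto.
Qed.

Lemma guest_state_set_reg rj mj R R' M d v :
  guest_state rj mj R M -> fits W v -> R' (guest d) = v ->
  changes_only [guest d; rTmp; rAux] R R' ->
  guest_state (upd_reg rj d v) mj R' M.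
Proof.
  intros [Hg Hregs Hrfit Hmfit Hmem] Hv Hd Hch; constructor; auto.
  - eapply globals_changes_only; [|exact Hch | exact Hg]; cbn [In]; lia.
  - intros i Hi; destruct (Nat.eq_dec i d) as [->|Hne]; regs_simpl; [exact Hd|].
    rewrite Hch by (cbn [In]; lia); auto.
  - intros i; unfold upd_reg; destruct (Nat.eqb i d); auto.
Qed.

Lemma runs_set_pc rj mj R M l :
  guest_state rj mj R M ->
  runs w (set_pc (length J) l) R M 1 (simulates (Config l rj mj)).
Proof.
  intros Hst; eapply runs_konst.
  - apply wrap_id; [lia | unfold fits; lia].
  - constructor; cbn [pc regs mem]; [apply guest_state_scratch; auto; lia | now regs_simpl].
Qed.

Lemma runs_then_set_pc C n rj mj R M l :
  runs w C R M n (guest_state rj mj) -> (n <= 7)%nat ->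
  runs w (C ;; set_pc (length J) l) R M 8 (simulates (Config l rj mj)).
Proof.
  intros HC Hn; apply runs_cost_le with (n := (n + 1)%nat); [|lia].
  eapply runs_then; [exact HC|]; intros R' M' Hst; now apply runs_set_pc.
Qed.

Ltac guest_op := op_step ltac:(cbn [eval_binop]; apply wrap_address; lia).

Lemma runs_reduce rj mj R M d z :
  guest_state rj mj R M ->
  runs w (reduce (guest d)) (upd_reg R rTmp (wrap w z)) M 3
    (guest_state (upd_reg rj d (wrap W z)) mj).
Proof.
  intros Hst; pose proof Hst as [Hg _ _ _ _]; unfold reduce; eapply runs_cost_le.
  { op_step reflexivity; op_step reflexivity; op_step reflexivity.
    eapply guest_state_set_reg; [exact Hst | apply wrap_fits; lia | | unchanged].
    regs_simpl; cbn [eval_binop]; apply wrap_wrap; lia. }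
  lia.
Qed.

Lemma runs_sim_load rj mj R M d a :
  guest_state rj mj R M -> (a < nr)%nat ->
  runs w (sim_load mode d a) R M 7 (guest_state (upd_reg rj d (mj (rj a))) mj).
Proof.
  intros Hst Ha; pose proof Hst as [Hg Hregs Hrfit Hmfit Hmem].
  pose proof (fits_range _ (Hrfit a)); pose proof (Hregs a Ha) as Haddr.
  assert (Hload : forall R', R' (guest d) = mj (rj a) ->
    changes_only [guest d; rTmp; rAux] R R' ->
    guest_state (upd_reg rj d (mj (rj a))) mj R' M)
    by (intros R'; apply guest_state_set_reg; auto).
  unfold sim_load; clear stamp_nonneg; destruct mode; cbn [represents] in Hmem.
  - destruct Hmem as [Hin _]; apply runs_cost_le with (n := 1%nat); [|lia].
    do_fetch; [now apply Hin|]; apply Hload; [reg_value | unchanged].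
  - pose proof (overlay_value _ _ _ _ _ Hmem _ (Hrfit a)) as Hval; eapply runs_cost_le.
    { guest_op; do_fetch; [reflexivity|].
      apply (runs_if _ _ _ _ _ _ 2); cbn [holds]; regs_simpl; rewrite (Hg rStamp) by lia.
      destruct (Z.eqb_spec (M (rj a + 2 ^ Z.of_nat W)%Z) (g rStamp)) as [Hvalid|Hstale].
      - apply (runs_seq _ _ _ _ _ 1 1).
        guest_op; do_fetch; [reflexivity|]; apply Hload; [regs_simpl | unchanged].
        rewrite Hval; f_equal; lia.
      - apply runs_cost_le with (n := 1%nat); [|lia].
        do_fetch; [reflexivity|]; apply Hload; [regs_simpl | unchanged].
        rewrite Hval; apply (overlay_outside _ _ _ _ _ Hmem).
        pose proof (Hrfit a); unfold fits in *; lia. }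
    lia.
Qed.

Lemma overlays_store stamp mj M a v :
  (0 <= stamp)%Z -> fits W a -> overlays W stamp base mj M ->
  overlays W stamp base (upd_mem mj a v)
    (upd_mem (upd_mem M (a + 2 ^ Z.of_nat W) stamp) (a + 2 * 2 ^ Z.of_nat W) v).
Proof.
  intros Hstamp Ha [Hval Hout Hst]; destruct (pow2_half W ltac:(lia)) as [Hdouble Hpos].
  constructor; intros b Hb.
  - destruct (Z.eq_dec b a) as [->|Hne].
    + rewrite !upd_mem_same, upd_mem_other, upd_mem_same, Z.eqb_refl by lia; reflexivity.
    + rewrite !upd_mem_other by (unfold fits in *; lia); auto.
  - rewrite !upd_mem_other by (unfold fits in *; lia); auto.
  - rewrite upd_mem_other by (unfold fits in *; lia).
    destruct (Z.eq_dec b a) as [->|Hne];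
      [rewrite upd_mem_same; lia | rewrite upd_mem_other by lia; auto].
Qed.

Lemma runs_sim_store rj mj R M a b :
  guest_state rj mj R M -> (a < nr)%nat -> (b < nr)%nat ->
  runs w (sim_store mode a b) R M 4 (guest_state rj (upd_mem mj (rj a) (rj b))).
Proof.
  intros Hst Ha Hb; pose proof Hst as [Hg Hregs Hrfit Hmfit Hmem].
  pose proof (fits_range _ (Hrfit a)).
  pose proof (Hregs a Ha) as Haddr; pose proof (Hregs b Hb) as Hvalue.
  assert (Hstored : forall R' M', changes_only [rTmp] R R' ->
    represents mode W (g rStamp) base (upd_mem mj (rj a) (rj b)) M' ->
    guest_state rj (upd_mem mj (rj a) (rj b)) R' M').
  { intros R' M' Hch HM'; constructor; auto.
    - eapply globals_changes_only; [|exact Hch | exact Hg]; cbn [In]; lia.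
    - intros i Hi; rewrite Hch by (cbn [In]; lia); auto.
    - intros c Hc; unfold upd_mem; destruct (Z.eqb c (rj a)); auto. }
  unfold sim_store; destruct mode; cbn [represents] in Hmem, Hstored.
  - destruct Hmem as [Hin Hout]; apply runs_cost_le with (n := 1%nat); [|lia].
    do_store; apply Hstored; [unchanged|]; split.
    + intros c Hc; unfold upd_mem; destruct (Z.eqb c (rj a)); auto.
    + intros c Hc; rewrite upd_mem_other by (intros ->; auto); auto.
  - eapply runs_cost_le.
    { guest_op; do_store; guest_op; do_store; apply Hstored; [unchanged|].
      replace (rj a + 2 ^ Z.of_nat W + 2 ^ Z.of_nat W)%Z
        with (rj a + 2 * 2 ^ Z.of_nat W)%Z by lia.
      apply overlays_store; auto. }
    lia.
Qed.

Lemma runs_sim_instr cj R M I (b : bool) :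
  nth_error J (pc cj) = Some I -> simulates cj R M -> R rCoin = (if b then 1 else 0)%Z ->
  runs w (sim_instr mode (length J) (pc cj) I) R M 8 (simulates (step J W b cj)).
Proof.
  intros HI [Hst _] Hcoin; pose proof Hst as [Hg Hregs Hrfit _ _].
  pose proof (proj1 (Forall_forall _ _) regs_used I (nth_error_In _ _ HI)) as Hused.
  unfold step; rewrite HI; clear HI; cbv beta in Hused.
  destruct I as [d z|o d x y|d x|x y|d|x y l|x y l];
    cbn [instr_regs] in Hused; rewrite ?Forall_cons_iff in Hused; cbn [sim_instr].
  - apply runs_then_set_pc with (n := (1 + 3)%nat); [|lia].
    apply runs_seq; eapply runs_konst; [reflexivity | now apply runs_reduce].
  - apply runs_then_set_pc with (n := (1 + 3)%nat); [|lia].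
    apply runs_seq; eapply runs_bin;
      [apply Hregs; tauto | apply Hregs; tauto | reflexivity | now apply runs_reduce].
  - apply runs_then_set_pc with (n := 7%nat); [|lia].
    apply runs_sim_load; [exact Hst | tauto].
  - apply runs_then_set_pc with (n := 4%nat); [|lia].
    apply runs_sim_store; [exact Hst | tauto | tauto].
  - apply runs_then_set_pc with (n := 1%nat); [|lia].
    assert (Hbit : fits W (if b then 1 else 0)%Z).
    { assert (2 ^ 1 <= 2 ^ (Z.of_nat W - 1))%Z by (apply Z.pow_le_mono_r; lia).
      unfold fits; destruct b; lia. }
    eapply runs_bin; [exact Hcoin | exact Hcoin | |].
    { cbn [eval_binop]; rewrite Z.land_diag.
      pose proof (fits_range _ Hbit); apply wrap_address; lia. }
    eapply guest_state_set_reg; [exact Hst | exact Hbit | reg_value | unchanged].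
  - apply runs_cost_le with (n := (1 + 2)%nat); [apply runs_if|lia].
    cbn [holds]; rewrite !Hregs by tauto.
    destruct (Z.eqb (regs cj x) (regs cj y)); now apply runs_set_pc.
  - apply runs_cost_le with (n := (1 + 2)%nat); [apply runs_if|lia].
    cbn [holds]; rewrite !Hregs by tauto.
    destruct (Z.ltb (regs cj x) (regs cj y)); now apply runs_set_pc.
Qed.

Lemma simulates_scratch cj R M d v :
  (20 < d < 40)%nat -> simulates cj R M -> simulates cj (upd_reg R d v) M.
Proof.
  intros Hd [Hst Hpc]; constructor; [apply guest_state_scratch; auto; lia | now regs_simpl].
Qed.

Lemma runs_dispatch cj R M (b : bool) J1 J2 :
  J = J1 ++ J2 -> (length J1 <= pc cj < length J)%nat ->
  simulates cj R M -> R rCoin = (if b then 1 else 0)%Z ->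
  runs w (dispatch mode (length J) (length J1) J2) R M (length J2 * 3 + 8)
    (simulates (step J W b cj)).
Proof.
  revert R M J1; induction J2 as [|ins J2 IH]; intros R M J1 HJ Hpc Hsim Hcoin.
  - rewrite app_nil_r in HJ; rewrite HJ in Hpc; lia.
  - cbn [dispatch]; eapply runs_cost_le.
    { apply runs_seq; eapply runs_konst; [apply wrap_id; [lia | unfold fits; lia]|].
      apply (runs_if _ _ _ _ _ _ (length J2 * 3 + 8)); cbn [holds]; regs_simpl.
      rewrite (sim_pc _ _ _ Hsim).
      destruct (Z.eqb_spec (Z.of_nat (Nat.min (pc cj) (length J))) (Z.of_nat (length J1)))
        as [Hhere|Hlater].
      - eapply runs_cost_le; [|apply Nat.le_add_l].
        replace (length J1) with (pc cj) by lia.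
        apply runs_sim_instr; [|apply simulates_scratch; auto; lia | now regs_simpl].
        rewrite HJ; rewrite nth_error_app2 by lia.
        now replace (pc cj - length J1)%nat with 0%nat by lia.
      - replace (S (length J1)) with (length (J1 ++ [ins])) by (rewrite length_app; simpl; lia).
        apply IH; [now rewrite <- app_assoc | rewrite length_app; simpl; lia | | now regs_simpl].
        apply simulates_scratch; auto; lia. }
    simpl; lia.
Qed.

Lemma simulates_loop_test cj R M :
  simulates cj R M -> holds (TLt rPc rCodeLen) R = negb (halted J cj).
Proof.
  intros [Hst Hpc]; cbn [holds]; rewrite Hpc, (state_globals _ _ _ _ Hst), g_code_len by lia.
  unfold halted; destruct (Nat.leb_spec (length J) (pc cj)); cbn [negb].
  - apply Z.ltb_ge; lia.
  - apply Z.ltb_lt; lia.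
Qed.

Definition sim_cost (t : nat) (cj : config) (G : config -> R) : R :=
  INR (slowdown J) * mean_steps J W t cj + 2 + halting_mean J W t cj G.

Lemma sim_cost_nonneg t cj G : (forall c, 0 <= G c) -> 0 <= sim_cost t cj G.
Proof.
  intros HG; unfold sim_cost.
  pose proof (halting_mean_nonneg J W t cj G HG).
  pose proof (Rmult_le_pos _ _ (pos_INR (slowdown J)) (mean_steps_nonneg J W t cj)); lra.
Qed.

Lemma decides_within_sim_step P A p t cj R M V :
  code_at P p (sim_loop mode J) -> simulates cj R M -> halted J cj = false ->
  (forall b, 0 <= V b) ->
  (forall b R' M', simulates (step J W b cj) R' M' ->
     decides_within P w A t (Config p R' M') (V b)) ->
  decides_within P w A (S t) (Config p R M) (INR (slowdown J) + fair V).
Proof.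
  intros Hp Hsim Hrunning HV Hdec.
  pose proof (proj1 (Nat.leb_gt _ _) Hrunning) as Hpc.
  pose proof (HV true) as HVt; pose proof (HV false) as HVf.
  pose proof (code_at_while _ _ _ _ Hp) as (_ & _ & (Htoss & Hdisp)%code_at_seq & _).
  set (per_coin := fun b => INR (length J * 3 + 8) + (INR 1 + V b)).
  apply (decides_within_weaken _ _ _ (S t) (S t) _ (INR 1 + (1 + fair per_coin))); [lia | |].
  { unfold per_coin, fair, slowdown; rewrite !plus_INR; simpl; lra. }
  assert (Hpos : forall b, 0 <= per_coin b).
  { intros b; unfold per_coin; pose proof (HV b); pose proof (pos_INR (length J * 3 + 8)).
    simpl (INR 1); lra. }
  eapply decides_within_reaches.
  { eapply reaches_while_enter; [exact Hp|].
    now rewrite (simulates_loop_test cj R M Hsim), Hrunning. }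
  { unfold fair; pose proof (Hpos true); pose proof (Hpos false); lra. }
  apply decides_within_toss with (d := rCoin); [exact Htoss|]; intros b.
  eapply decides_within_runs.
  { apply (runs_dispatch cj _ _ b [] J eq_refl); [simpl; lia | | now regs_simpl].
    apply simulates_scratch; [lia | exact Hsim]. }
  { exact Hdisp. }
  { pose proof (HV b); simpl (INR 1); lra. }
  intros R' M' Hsim'; rewrite <- Nat.add_assoc.
  eapply decides_within_reaches; [exact (reaches_while_repeat _ _ _ _ _ _ _ Hp) | auto | auto].
Qed.

Lemma decides_within_sim_exit P A p t (G : config -> R) cj R M :
  code_at P p (sim_loop mode J) -> simulates cj R M -> halted J cj = true -> 0 <= G cj ->
  decides_within P w A t (Config (p + size (sim_loop mode J)) R M) (G cj) ->
  decides_within P w A t (Config p R M) (sim_cost t cj G).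
Proof.
  intros Hp Hsim Hc HG Hexit; unfold sim_cost.
  rewrite mean_steps_halted, halting_mean_halted, Rmult_0_r, Rplus_0_l by exact Hc.
  apply (decides_within_reaches P w A 2 t (Config p R M)) in Hexit; [exact Hexit | | exact HG].
  apply reaches_while_exit; [exact Hp|].
  now rewrite (simulates_loop_test cj R M Hsim), Hc.
Qed.

Lemma decides_within_sim_loop P A p t (G : config -> R) cj R M :
  code_at P p (sim_loop mode J) ->
  simulates cj R M ->
  (forall c, 0 <= G c) ->
  (forall bs R' M', let c := exec J W bs cj in
     halted J c = true -> simulates c R' M' ->
     decides_within P w A t (Config (p + size (sim_loop mode J)) R' M') (G c)) ->
  decides_within P w A t (Config p R M) (sim_cost t cj G).
Proof.
  intros Hp Hsim HG; revert cj R M Hsim.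
  induction t as [|t IH]; intros cj R M Hsim Hcont; destruct (halted J cj) eqn:Hc.
  1, 3: apply decides_within_sim_exit; auto; apply (Hcont []); auto.
  { apply decides_within_0; [|now apply sim_cost_nonneg].
    eapply halted_at, code_at_while, Hp. }
  apply (decides_within_weaken _ _ _ (S t) (S t) _
    (INR (slowdown J) + fair (fun b => sim_cost t (step J W b cj) G))); [lia | |].
  - unfold sim_cost; rewrite mean_steps_S, halting_mean_S by exact Hc; unfold fair; lra.
  - apply (decides_within_sim_step P A p t cj); auto; [intros b; now apply sim_cost_nonneg|].
    intros b R' M' Hsim'; apply IH; [exact Hsim'|].
    intros bs R2 M2 c Hhalt Hsim2.
    apply (decides_within_weaken _ _ _ (S t) t _ (G c)); [lia | lra|].
    pose proof (Hcont (b :: bs) R2 M2) as Hcont'; cbn [exec] in Hcont'; rewrite Hc in Hcont'.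
    now apply Hcont'.
Qed.

End Simulation.

(** * Digits and carries *)

Local Open Scope Z_scope.

Notation count a l := (count_occ Nat.eq_dec l a).

Definition zsum (l : list Z) : Z := fold_right Z.add 0 l.

Lemma zsum_cons z l : zsum (z :: l) = z + zsum l.
Proof. reflexivity. Qed.

Lemma zsum_app l l' : zsum (l ++ l') = zsum l + zsum l'.
Proof. induction l as [|z l IH]; cbn [app]; rewrite ?zsum_cons, ?IH; [reflexivity | lia]. Qed.

Lemma zsum_range l c :
  Forall (fun z => 0 <= z <= c) l -> 0 <= zsum l <= c * Z.of_nat (length l).
Proof.
  induction 1; rewrite ?zsum_cons; cbn [zsum fold_right length]; lia.
Qed.

Lemma zsum_map_of_nat l : zsum (map Z.of_nat l) = Z.of_nat (list_sum l).
Proof.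
  induction l as [|n l IH]; [reflexivity|].
  cbn [map]; rewrite zsum_cons, IH; change (list_sum (n :: l)) with (n + list_sum l)%nat; lia.
Qed.

Lemma map_of_nat_to_nat l : Forall (fun z => 0 <= z) l -> map Z.of_nat (map Z.to_nat l) = l.
Proof. induction 1; cbn [map]; f_equal; [lia | assumption]. Qed.

Lemma map_to_nat_of_nat l : map Z.to_nat (map Z.of_nat l) = l.
Proof. induction l; cbn [map]; f_equal; [lia | assumption]. Qed.

(* The number [x] has [k] digits in base [B], followed by one signed digit. *)
Fixpoint digits (B : Z) (k : nat) (x : Z) : list Z :=
  match k with
  | O => [x]
  | S k' => x mod B :: digits B k' (x / B)
  end.

Fixpoint digit_diffs (B offset : Z) (k : nat) (x y : Z) : list Z :=
  match k with
  | O => [x - y + offset]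
  | S k' => x mod B - y mod B + offset :: digit_diffs B offset k' (x / B) (y / B)
  end.

(* Digitwise sum of [u] and [offset], where the bits of [e] are the carries out
   of the digits and [cin] is the carry into the first one. *)
Fixpoint carried (B offset : Z) (k : nat) (u e cin : Z) : list Z :=
  match k with
  | O => [u + offset + cin]
  | S k' => u mod B + offset + cin - B * (e mod 2) ::
            carried B offset k' (u / B) (e / 2) (e mod 2)
  end.

Lemma length_digit_diffs B c k x y : length (digit_diffs B c k x y) = S k.
Proof. revert x y; induction k; intros; simpl; auto. Qed.

Lemma length_carried B c k u e cin : length (carried B c k u e cin) = S k.
Proof. revert u e cin; induction k; intros; simpl; auto. Qed.

Lemma nth_digit_diffs B c k x y a : (a <= k)%nat ->
  nth a (digit_diffs B c k x y) 0 = nth a (digits B k x) 0 - nth a (digits B k y) 0 + c.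
Proof.
  revert x y a; induction k as [|k IH]; intros x y [|a] Ha; simpl; try lia.
  apply IH; lia.
Qed.

Lemma zsum_digit_diffs B c k x y :
  zsum (digit_diffs B c k x y) =
  zsum (digits B k x) - zsum (digits B k y) + c * Z.of_nat (S k).
Proof.
  revert x y; induction k as [|k IH]; intros x y; cbn [digits digit_diffs];
    rewrite !zsum_cons; [cbn; lia|].
  rewrite IH; lia.
Qed.

Lemma carry_of_digit_sum B u x y cin : 0 < B -> 0 <= cin <= 1 -> x - y = u + cin ->
  exists b, 0 <= b <= 1 /\ x mod B = y mod B + u mod B + cin - B * b /\
    x / B - y / B = u / B + b.
Proof.
  intros HB Hcin E; exists (x / B - y / B - u / B).
  pose proof (Z.div_mod x B ltac:(lia)); pose proof (Z.mod_pos_bound x B HB).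
  pose proof (Z.div_mod y B ltac:(lia)); pose proof (Z.mod_pos_bound y B HB).
  pose proof (Z.div_mod u B ltac:(lia)); pose proof (Z.mod_pos_bound u B HB).
  assert (B * (x / B - y / B - u / B) = cin + y mod B + u mod B - x mod B) by nia.
  split; [|split]; nia.
Qed.

Lemma carried_eq_digit_diffs_iff B c k u x y cin : 0 < B -> 0 <= cin <= 1 ->
  (exists e, 0 <= e < 2 ^ Z.of_nat k /\ carried B c k u e cin = digit_diffs B c k x y) <->
  x - y = u + cin.
Proof.
  intros HB; revert u x y cin; induction k as [|k IH]; intros u x y cin Hcin.
  - simpl; split; [intros (e & He & E); injection E; lia|].
    intros E; exists 0; split; [lia | f_equal; lia].
  - rewrite Nat2Z.inj_succ, Z.pow_succ_r by lia; cbn [carried digit_diffs]; split.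
    + intros (e & He & E); injection E as Ehead Etail.
      pose proof (Z.mod_pos_bound e 2 ltac:(lia)); pose proof (Z.div_mod e 2 ltac:(lia)).
      assert (Equot : x / B - y / B = u / B + e mod 2).
      { apply IH; [lia|]; exists (e / 2); split; [lia | exact Etail]. }
      pose proof (Z.div_mod x B ltac:(lia)); pose proof (Z.div_mod y B ltac:(lia)).
      pose proof (Z.div_mod u B ltac:(lia)); nia.
    + intros E; destruct (carry_of_digit_sum B u x y cin HB Hcin E) as (b & Hb & Ehead & Equot).
      destruct (proj2 (IH (u / B) (x / B) (y / B) b Hb) Equot) as (e & He & Etail).
      exists (2 * e + b).
      assert (Ebit : (2 * e + b) mod 2 = b)
        by (rewrite (Z.add_comm (2 * e)), (Z.mul_comm 2 e), Z.mod_add by lia;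
            apply Z.mod_small; lia).
      assert (Erest : (2 * e + b) / 2 = e)
        by (pose proof (Z.div_mod (2 * e + b) 2 ltac:(lia)); lia).
      rewrite Ebit, Erest, Etail; split; [lia | f_equal; lia].
Qed.

Definition bounded (B : Z) (k : nat) (x : Z) : Prop :=
  - B ^ Z.of_nat (S k) <= x <= B ^ Z.of_nat (S k).

Lemma bounded_div B k x : 0 < B -> bounded B (S k) x -> bounded B k (x / B).
Proof.
  unfold bounded; intros HB; rewrite (Nat2Z.inj_succ (S k)), Z.pow_succ_r by lia.
  set (q := B ^ Z.of_nat (S k)); intros Hx.
  replace (- q) with (- (B * q) / B)
    by (rewrite <- Z.mul_opp_r, Z.mul_comm; apply Z.div_mul; lia).
  replace q with (B * q / B) at 2 by (rewrite Z.mul_comm; apply Z.div_mul; lia).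
  split; apply Z.div_le_mono; lia.
Qed.

Lemma bounded_0 B x : bounded B 0 x -> - B <= x <= B.
Proof. unfold bounded; change (Z.of_nat 1) with 1; rewrite Z.pow_1_r; auto. Qed.

Lemma digit_diffs_range B k x y : 0 < B -> bounded B k x -> bounded B k y ->
  Forall (fun z => 0 <= z <= 5 * B) (digit_diffs B (3 * B) k x y).
Proof.
  intros HB; revert x y; induction k as [|k IH]; intros x y Hx Hy;
    cbn [digit_diffs]; constructor; auto.
  - apply bounded_0 in Hx; apply bounded_0 in Hy; lia.
  - pose proof (Z.mod_pos_bound x B HB); pose proof (Z.mod_pos_bound y B HB); lia.
  - apply IH; now apply bounded_div.
Qed.

Lemma carried_range B h k u e cin : 0 < B -> 1 <= h -> bounded B k u -> 0 <= cin <= 1 ->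
  Forall (fun z => 0 <= z <= 5 * B * h) (carried B (3 * B * h) k u e cin).
Proof.
  intros HB Hh; revert u e cin; induction k as [|k IH]; intros u e cin Hu Hcin;
    cbn [carried]; constructor; auto.
  - apply bounded_0 in Hu; nia.
  - pose proof (Z.mod_pos_bound u B HB); pose proof (Z.mod_pos_bound e 2 ltac:(lia)); nia.
  - apply IH; [now apply bounded_div|]; pose proof (Z.mod_pos_bound e 2 ltac:(lia)); lia.
Qed.

(** * Parikh vectors *)

Lemma count_repeat a b n : count a (repeat b n) = if Nat.eqb a b then n else 0%nat.
Proof.
  destruct (Nat.eqb_spec a b) as [->|Hab]; [now apply count_occ_repeat_eq|].
  apply count_occ_repeat_neq; congruence.
Qed.

Lemma length_parikh r l : length (parikh r l) = r.
Proof. unfold parikh; now rewrite length_map, length_seq. Qed.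

Lemma nth_map_parikh r l a : (a < r)%nat ->
  nth a (map Z.of_nat (parikh r l)) 0 = Z.of_nat (count a l).
Proof.
  intros Ha; change 0 with (Z.of_nat 0); rewrite map_nth; f_equal.
  rewrite (nth_indep _ 0%nat (count 0%nat l)) by now rewrite length_parikh.
  unfold parikh; rewrite (map_nth (fun a => count a l)), seq_nth by lia; reflexivity.
Qed.

Lemma list_sum_parikh_filter r l :
  list_sum (parikh r l) = length (filter (fun a => Nat.ltb a r) l).
Proof.
  induction r as [|r IH].
  - induction l as [|a l IHl]; [reflexivity | exact IHl].
  - unfold parikh in *; rewrite seq_S, map_app, list_sum_app, IH; clear IH; simpl.
    induction l as [|a l IHl]; [reflexivity|]; simpl.
    destruct (Nat.eq_dec a r), (Nat.ltb_spec a r), (Nat.ltb_spec a (S r)); simpl; lia.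
Qed.

Lemma list_sum_parikh r l : Forall (fun a => (a < r)%nat) l ->
  list_sum (parikh r l) = length l.
Proof.
  intros Hl; rewrite list_sum_parikh_filter, forallb_filter_id; [reflexivity|].
  apply forallb_forall; intros a Ha; apply Nat.ltb_lt.
  now apply (proj1 (Forall_forall _ l) Hl).
Qed.

Lemma firstn_length_app {A : Type} (l l' : list A) : firstn (length l) (l ++ l') = l.
Proof. now rewrite firstn_app, Nat.sub_diag, firstn_all, app_nil_r. Qed.

Fixpoint spell (a : nat) (l : list Z) : list nat :=
  match l with
  | [] => []
  | z :: l' => repeat a (Z.to_nat z) ++ spell (S a) l'
  end.

Lemma spell_range a l : Forall (fun c => (a <= c < a + length l)%nat) (spell a l).
Proof.
  revert a; induction l as [|z l IH]; intros a; simpl; [constructor|].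
  apply Forall_app; split.
  - apply Forall_forall; intros c Hc; apply repeat_spec in Hc; lia.
  - eapply Forall_impl; [|apply IH]; cbv beta; intros; lia.
Qed.

Lemma count_outside (P : nat -> Prop) c l : Forall P l -> ~ P c -> count c l = 0%nat.
Proof.
  intros Hl Hc; apply count_occ_not_In; intros Hin.
  now apply Hc, (proj1 (Forall_forall _ l) Hl).
Qed.

Lemma count_spell a l c : (a <= c)%nat -> count c (spell a l) = Z.to_nat (nth (c - a) l 0).
Proof.
  revert a; induction l as [|z l IH]; intros a Hc; simpl.
  - destruct (c - a)%nat; reflexivity.
  - rewrite count_occ_app, count_repeat.
    destruct (Nat.eqb_spec c a) as [->|Hne].
    + rewrite (count_outside _ a _ (spell_range (S a) l)), Nat.sub_diag by lia; lia.
    + rewrite IH by lia; replace (c - a)%nat with (S (c - S a)) by lia; reflexivity.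
Qed.

Lemma length_spell a l : Forall (fun z => 0 <= z) l -> Z.of_nat (length (spell a l)) = zsum l.
Proof.
  intros Hl; revert a; induction Hl as [|z l Hz Hl IH]; intros a; [reflexivity|].
  cbn [spell]; rewrite length_app, repeat_length, Nat2Z.inj_add, IH, zsum_cons; lia.
Qed.

(** * The text and the queries of the reduction *)

Notation filler k := (k + 1)%nat (only parsing).
Notation separator k := (k + 2)%nat (only parsing).

Definition body_length (B : Z) (k : nat) : Z := 6 * (Z.of_nat k + 1) * B.

Lemma body_length_pos B k : 0 < B -> 0 < body_length B k.
Proof. unfold body_length; nia. Qed.

Definition block (B : Z) (k : nat) (x y : Z) : list nat :=
  let d := digit_diffs B (3 * B) k y x in
  spell 0 d ++ repeat (filler k) (Z.to_nat (body_length B k - zsum d)) ++ [separator k].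

Definition sum_text (B : Z) (k : nat) (xs : list Z) (j : nat) : list nat :=
  flat_map (fun i => block B k (nth i xs 0) (nth (S i) xs 0)) (seq 0 j).

Lemma sum_text_S B k xs j :
  sum_text B k xs (S j) = sum_text B k xs j ++ block B k (nth j xs 0) (nth (S j) xs 0).
Proof.
  unfold sum_text; rewrite seq_S, flat_map_app; simpl; now rewrite app_nil_r.
Qed.

Lemma sum_text_app B k xs j i : exists V, sum_text B k xs (j + i) = sum_text B k xs j ++ V.
Proof. unfold sum_text; rewrite seq_app, flat_map_app; eauto. Qed.

(* The Parikh vector of [h] consecutive blocks whose letters 0, ..., k occur [d]
   times, without the last separator. *)
Definition padded (L h : Z) (d : list Z) : list Z := d ++ [L * h - zsum d; h - 1].

Definition sum_query (B : Z) (k : nat) (xs : list Z) (h : nat) (e : Z) : list Z :=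
  padded (body_length B k) (Z.of_nat h)
    (carried B (3 * B * Z.of_nat h) k (nth (h - 1) xs 0) e 0).

Lemma zsum_padded L h d : zsum (padded L h d) = L * h + (h - 1).
Proof. unfold padded; rewrite zsum_app; cbn [zsum fold_right]; lia. Qed.

Lemma length_padded L h d : length (padded L h d) = (length d + 2)%nat.
Proof. apply length_app. Qed.

Lemma nth_padded L h d a : (a < length d)%nat -> nth a (padded L h d) 0 = nth a d 0.
Proof. apply app_nth1. Qed.

Lemma nth_padded_filler L h d a : a = length d -> nth a (padded L h d) 0 = L * h - zsum d.
Proof. intros ->; unfold padded; rewrite app_nth2, Nat.sub_diag; auto. Qed.

Lemma nth_padded_separator L h d a : a = S (length d) -> nth a (padded L h d) 0 = h - 1.
Proof.
  intros ->; unfold padded; rewrite app_nth2 by lia.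
  now replace (S (length d) - length d)%nat with 1%nat by lia.
Qed.

Lemma padded_inj L h d d' : length d = length d' -> padded L h d = padded L h d' -> d = d'.
Proof.
  intros Hlen E; apply (f_equal (firstn (length d))) in E; unfold padded in E.
  now rewrite firstn_length_app, Hlen, firstn_length_app in E.
Qed.

Section Text.

Variables (B : Z) (k : nat) (xs : list Z).
Hypothesis B_pos : 0 < B.
Hypothesis xs_bounded : forall i, bounded B k (nth i xs 0).

Let x i := nth i xs 0.
Let T := sum_text B k xs.
Let L := Z.to_nat (body_length B k).
Let period := S L.

Lemma of_nat_body_length : Z.of_nat L = body_length B k.
Proof. pose proof (body_length_pos B k B_pos); unfold L; lia. Qed.

Lemma consecutive_diffs_nonneg i :
  Forall (fun z => 0 <= z) (digit_diffs B (3 * B) k (x (S i)) (x i)).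
Proof.
  eapply Forall_impl; [|apply digit_diffs_range; auto; apply xs_bounded].
  cbv beta; intros; lia.
Qed.

Lemma consecutive_diffs_sum i :
  0 <= zsum (digit_diffs B (3 * B) k (x (S i)) (x i)) <= body_length B k.
Proof.
  pose proof (zsum_range _ _ (digit_diffs_range B k (x (S i)) (x i) B_pos
    (xs_bounded _) (xs_bounded _))) as Hsum.
  rewrite length_digit_diffs in Hsum; unfold body_length; nia.
Qed.

Lemma block_eq_body_separator i :
  exists body, block B k (x i) (x (S i)) = body ++ [separator k] /\
    length body = L /\ Forall (fun a => (a < separator k)%nat) body.
Proof.
  unfold block; rewrite app_assoc; eexists; split; [reflexivity|]; split.
  - rewrite length_app, repeat_length.
    pose proof (length_spell 0 _ (consecutive_diffs_nonneg i)).
    pose proof (consecutive_diffs_sum i); unfold L; lia.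
  - apply Forall_app; split.
    + eapply Forall_impl; [|apply spell_range]; simpl; intros a Ha.
      rewrite length_digit_diffs in Ha; lia.
    + apply Forall_forall; intros c Hc; apply repeat_spec in Hc; lia.
Qed.

Lemma length_sum_text j : length (T j) = (j * period)%nat.
Proof.
  induction j as [|j IH]; [reflexivity|].
  unfold T in *; rewrite sum_text_S, length_app, IH.
  destruct (block_eq_body_separator j) as (body & E & Hlen & _); unfold x in E.
  rewrite E, length_app, Hlen; unfold period; simpl; lia.
Qed.

Lemma sum_text_letters j : Forall (fun a => (a < k + 3)%nat) (T j).
Proof.
  induction j as [|j IH]; [constructor|].
  unfold T in *; rewrite sum_text_S; apply Forall_app; split; [exact IH|].
  destruct (block_eq_body_separator j) as (body & E & _ & Hbody); unfold x in E; rewrite E.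
  apply Forall_app; split; [|repeat constructor; lia].
  eapply Forall_impl; [|exact Hbody]; cbv beta; intros; lia.
Qed.

Lemma count_digit_sum_text a j : (a <= k)%nat ->
  Z.of_nat (count a (T j)) =
  nth a (digits B k (x j)) 0 - nth a (digits B k (x 0)) 0 + 3 * B * Z.of_nat j.
Proof.
  intros Ha; induction j as [|j IH]; [simpl; lia|].
  unfold T in *; rewrite sum_text_S, count_occ_app, Nat2Z.inj_add, IH.
  unfold block; rewrite !count_occ_app, count_spell, count_repeat, Nat.sub_0_r by lia.
  destruct (Nat.eqb_spec a (filler k)); [lia|].
  simpl count_occ; destruct (Nat.eq_dec (separator k) a); [lia|].
  assert (Hdiff : 0 <= nth a (digit_diffs B (3 * B) k (x (S j)) (x j)) 0).
  { apply (proj1 (Forall_forall _ _) (consecutive_diffs_nonneg j)), nth_In.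
    rewrite length_digit_diffs; lia. }
  rewrite nth_digit_diffs in Hdiff by lia.
  rewrite nth_digit_diffs by lia; fold (x j) (x (S j)); lia.
Qed.

Lemma count_filler_sum_text j :
  Z.of_nat (count (filler k) (T j)) =
  body_length B k * Z.of_nat j -
  (zsum (digits B k (x j)) - zsum (digits B k (x 0)) + 3 * B * Z.of_nat j * Z.of_nat (S k)).
Proof.
  induction j as [|j IH]; [simpl; lia|].
  unfold T in *; rewrite sum_text_S, count_occ_app, Nat2Z.inj_add, IH.
  unfold block; rewrite !count_occ_app, count_spell, count_repeat, Nat.eqb_refl by lia.
  rewrite nth_overflow by (rewrite length_digit_diffs; lia).
  simpl count_occ; destruct (Nat.eq_dec (separator k) (filler k)); [lia|].
  pose proof (consecutive_diffs_sum j) as Hsum; fold (x j) (x (S j)).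
  rewrite Nat.add_0_r, Nat.add_0_l, Z2Nat.id, zsum_digit_diffs by lia; lia.
Qed.

Lemma count_separator_sum_text j : count (separator k) (T j) = j.
Proof.
  induction j as [|j IH]; [reflexivity|].
  unfold T in *; rewrite sum_text_S, count_occ_app, IH.
  destruct (block_eq_body_separator j) as (body & E & _ & Hbody); unfold x in E.
  rewrite E, count_occ_app, (count_outside _ _ _ Hbody) by lia.
  simpl; destruct (Nat.eq_dec (separator k) (separator k)); lia.
Qed.

Lemma count_separator_prefix j p : (p <= j * period)%nat ->
  count (separator k) (firstn p (T j)) = (p / period)%nat.
Proof.
  induction j as [|j IH]; intros Hp; [now replace p with 0%nat by lia|].
  assert (ET : T (S j) = T j ++ block B k (x j) (x (S j))) by apply sum_text_S.
  rewrite ET, firstn_app, count_occ_app, length_sum_text.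
  destruct (Nat.le_gt_cases p (j * period)) as [Hle|Hgt].
  { replace (p - j * period)%nat with 0%nat by lia.
    rewrite firstn_O, IH by lia; apply Nat.add_0_r. }
  rewrite firstn_all2, count_separator_sum_text by (rewrite length_sum_text; lia).
  destruct (block_eq_body_separator j) as (body & E & Hlen & Hbody); rewrite E.
  assert (Hbody0 : forall q, count (separator k) (firstn q body) = 0%nat).
  { intros q; apply (count_outside (fun a => (a < separator k)%nat)); [|lia].
    rewrite <- (firstn_skipn q body) in Hbody; now apply Forall_app in Hbody. }
  destruct (Nat.eq_dec p (S j * period)) as [->|Hne].
  - rewrite firstn_all2 by (rewrite length_app, Hlen; unfold period in *; cbn [length]; nia).
    rewrite count_occ_app, <- (firstn_all body), Hbody0.
    rewrite Nat.div_mul by (unfold period; lia).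
    simpl; destruct (Nat.eq_dec (separator k) (separator k)); lia.
  - rewrite firstn_app, Hlen, count_occ_app, Hbody0.
    replace (p - j * period - L)%nat with 0%nat by (unfold period in *; nia).
    rewrite firstn_O; simpl count_occ; rewrite !Nat.add_0_r.
    apply Nat.div_unique with (p - j * period)%nat; unfold period in *; nia.
Qed.

Lemma firstn_sum_text nb j : (j <= nb)%nat -> firstn (j * period) (T nb) = T j.
Proof.
  intros Hj; replace nb with (j + (nb - j))%nat by lia.
  destruct (sum_text_app B k xs j (nb - j)) as [V HV]; unfold T; rewrite HV.
  fold T; rewrite <- length_sum_text; apply firstn_length_app.
Qed.

(* One letter before the end of a block the number of separators has not yet
   increased, so the letter dropped is a separator. *)
Lemma count_before_separator nb j a : (1 <= j <= nb)%nat -> a <> separator k ->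
  count a (firstn (j * period - 1) (T nb)) = count a (T j).
Proof.
  intros Hj Ha.
  assert (Hlen : (j * period - 1 < length (T nb))%nat)
    by (rewrite length_sum_text; unfold period in *; nia).
  destruct (nth_error (T nb) (j * period - 1)) as [c|] eqn:Ec;
    [|apply nth_error_None in Ec; lia].
  assert (Elast : T j = firstn (j * period - 1) (T nb) ++ [c]).
  { rewrite <- (firstn_sum_text nb j) by lia.
    replace (j * period)%nat with (S (j * period - 1)) at 1 by (unfold period in *; nia).
    rewrite <- (firstn_skipn_middle _ _ Ec) at 1.
    rewrite firstn_app, firstn_all2, length_firstn, Nat.min_l by (rewrite ?length_firstn; lia).
    now replace (S (j * period - 1) - (j * period - 1))%nat with 1%nat by lia. }
  assert (Hsep : count (separator k) (firstn (j * period - 1) (T nb)) = (j - 1)%nat).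
  { rewrite count_separator_prefix by (unfold period in *; nia).
    symmetry; apply Nat.div_unique with L; unfold period; nia. }
  pose proof (count_separator_sum_text j) as Hsep'.
  rewrite Elast, count_occ_app, Hsep in Hsep'; rewrite Elast, count_occ_app.
  simpl in Hsep' |- *.
  destruct (Nat.eq_dec c (separator k)) as [->|]; [|lia].
  destruct (Nat.eq_dec (separator k) a); lia.
Qed.

Section Window.

Variables (nb h : nat) (U S' V : list nat).
Hypothesis h_pos : (1 <= h)%nat.
Hypothesis text_split : T nb = U ++ S' ++ V.
Hypothesis length_window : length S' = (h * period - 1)%nat.

Lemma window_ends_in_text j : length U = (j * period)%nat -> (j + h <= nb)%nat.
Proof.
  intros HU; pose proof (f_equal (@length nat) text_split) as Hlen.
  rewrite !length_app, length_sum_text, HU, length_window in Hlen.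
  pose proof (body_length_pos B k B_pos); unfold period, L in *; nia.
Qed.

Lemma count_window j a : length U = (j * period)%nat -> a <> separator k ->
  Z.of_nat (count a S') = Z.of_nat (count a (T (j + h))) - Z.of_nat (count a (T j)).
Proof.
  intros HU Ha; pose proof (window_ends_in_text j HU).
  rewrite <- (count_before_separator nb (j + h) a) by lia.
  rewrite <- (firstn_sum_text nb j), text_split by lia.
  replace ((j + h) * period - 1)%nat with (length U + length S')%nat
    by (rewrite HU, length_window; unfold period; nia).
  rewrite <- HU, firstn_length_app, app_assoc, <- length_app, firstn_length_app.
  rewrite count_occ_app; lia.
Qed.

Lemma count_separator_window :
  count (separator k) S' = ((length U + length S') / period - length U / period)%nat.
Proof.
  pose proof (f_equal (@length nat) text_split) as Hlen.
  rewrite !length_app, length_sum_text in Hlen.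
  rewrite <- (count_separator_prefix nb (length U)) by lia.
  rewrite <- (count_separator_prefix nb (length U + length S')), text_split by lia.
  rewrite firstn_length_app, app_assoc, <- length_app, firstn_length_app.
  rewrite count_occ_app; lia.
Qed.

Lemma window_aligned : count (separator k) S' = (h - 1)%nat ->
  exists j, length U = (j * period)%nat.
Proof.
  intros Hsep; rewrite count_separator_window, length_window in Hsep.
  set (p := length U) in *; exists (p / period)%nat.
  assert (Hperiod : period <> 0%nat) by (unfold period; lia).
  pose proof (Nat.div_mod p period Hperiod); pose proof (Nat.mod_upper_bound p period Hperiod).
  destruct (Nat.eq_dec (p mod period) 0) as [|Hmod]; [lia | exfalso].
  assert (Equot : ((p + (h * period - 1)) / period = p / period + h)%nat)
    by (symmetry; apply Nat.div_unique with (p mod period - 1)%nat; nia).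
  rewrite Equot in Hsep; lia.
Qed.

Lemma parikh_window j : length U = (j * period)%nat ->
  map Z.of_nat (parikh (k + 3) S') =
  padded (body_length B k) (Z.of_nat h)
    (digit_diffs B (3 * B * Z.of_nat h) k (x (j + h)) (x j)).
Proof.
  intros HU; set (d := digit_diffs _ _ _ _ _).
  assert (Hd : length d = S k) by apply length_digit_diffs.
  apply (nth_ext _ _ 0 0); rewrite length_map, length_parikh; [rewrite length_padded; lia|].
  intros a Ha; rewrite nth_map_parikh by exact Ha.
  destruct (Nat.eq_dec a (separator k)) as [->|Hsep].
  { rewrite count_separator_window, HU, length_window, nth_padded_separator by lia.
    rewrite Nat.div_mul by (unfold period; lia).
    replace ((j * period + (h * period - 1)) / period)%nat with (j + h - 1)%nat; [lia|].
    apply Nat.div_unique with L; unfold period in *; nia. }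
  rewrite (count_window j) by assumption.
  destruct (Nat.eq_dec a (filler k)) as [->|Hfill].
  - rewrite !count_filler_sum_text, nth_padded_filler by lia.
    unfold d; rewrite zsum_digit_diffs; lia.
  - rewrite !count_digit_sum_text, nth_padded by lia.
    unfold d; rewrite nth_digit_diffs by lia; lia.
Qed.

End Window.

Lemma window_of_padded_parikh nb h U S' V d : (1 <= h)%nat -> length d = S k ->
  T nb = U ++ S' ++ V ->
  map Z.of_nat (parikh (k + 3) S') = padded (body_length B k) (Z.of_nat h) d ->
  exists j, (j + h <= nb)%nat /\ d = digit_diffs B (3 * B * Z.of_nat h) k (x (j + h)) (x j).
Proof.
  intros Hh Hd E EP.
  assert (Hletters : Forall (fun a => (a < k + 3)%nat) S').
  { pose proof (sum_text_letters nb) as HT; rewrite E in HT.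
    apply Forall_app in HT as [_ HT]; now apply Forall_app in HT. }
  assert (Hlen : length S' = (h * period - 1)%nat).
  { apply (f_equal zsum) in EP.
    rewrite zsum_map_of_nat, list_sum_parikh, zsum_padded, <- of_nat_body_length in EP
      by exact Hletters.
    unfold period; nia. }
  assert (Hsep : count (separator k) S' = (h - 1)%nat).
  { apply (f_equal (fun l => nth (separator k) l 0)) in EP.
    rewrite nth_map_parikh, nth_padded_separator in EP by lia; lia. }
  destruct (window_aligned nb h U S' V Hh E Hlen Hsep) as [j HU].
  exists j; split; [exact (window_ends_in_text nb h U S' V Hh E Hlen j HU)|].
  rewrite (parikh_window nb h U S' V Hh E Hlen j HU) in EP; symmetry.
  revert EP; apply padded_inj; now rewrite length_digit_diffs.
Qed.

Lemma jumbled_match_padded nb h d : (1 <= h)%nat -> length d = S k ->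
  Forall (fun z => 0 <= z) (padded (body_length B k) (Z.of_nat h) d) ->
  jumbled_match (k + 3) (T nb) (map Z.to_nat (padded (body_length B k) (Z.of_nat h) d)) <->
  exists j, (j + h <= nb)%nat /\ d = digit_diffs B (3 * B * Z.of_nat h) k (x (j + h)) (x j).
Proof.
  intros Hh Hd Hpos; split.
  - intros (S' & (U & V & E) & EP); apply (window_of_padded_parikh nb h U S' V); auto.
    now rewrite EP, map_of_nat_to_nat.
  - intros (j & Hj & ->).
    set (U := firstn (j * period) (T nb)).
    set (S' := firstn (h * period - 1) (skipn (j * period) (T nb))).
    set (V := skipn (h * period - 1) (skipn (j * period) (T nb))).
    assert (ET : T nb = U ++ S' ++ V) by (unfold U, S', V; now rewrite !firstn_skipn).
    assert (HU : length U = (j * period)%nat)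
      by (unfold U; rewrite length_firstn, length_sum_text; nia).
    assert (HS : length S' = (h * period - 1)%nat)
      by (unfold S'; rewrite length_firstn, length_skipn, length_sum_text; nia).
    exists S'; split; [exists U, V; exact ET|].
    now rewrite <- (parikh_window nb h U S' V Hh ET HS j HU), map_to_nat_of_nat.
Qed.

Lemma carried_sum_range h u e : (1 <= h)%nat -> bounded B k u ->
  let d := carried B (3 * B * Z.of_nat h) k u e 0 in
  0 <= zsum d <= body_length B k * Z.of_nat h.
Proof.
  intros Hh Hu d.
  pose proof (carried_range B (Z.of_nat h) k u e 0 B_pos ltac:(lia) Hu ltac:(lia)) as Hr.
  apply zsum_range in Hr; rewrite length_carried in Hr; fold d in Hr.
  split; [lia|]; etransitivity; [apply Hr|].
  unfold body_length; rewrite Nat2Z.inj_succ; nia.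
Qed.

Lemma sum_query_range h e : (1 <= h)%nat ->
  Forall (fun z => 0 <= z <= body_length B k * Z.of_nat h) (sum_query B k xs h e).
Proof.
  intros Hh; unfold sum_query, padded.
  pose proof (carried_sum_range h (x (h - 1)) e Hh (xs_bounded _)) as Hsum; cbv zeta in Hsum.
  pose proof (carried_range B (Z.of_nat h) k (x (h - 1)) e 0 B_pos ltac:(lia)
    (xs_bounded _) ltac:(lia)) as Hr.
  fold (x (h - 1)); pose proof (body_length_pos B k B_pos).
  apply Forall_app; split; [|repeat constructor; nia].
  eapply Forall_impl; [|exact Hr]; cbv beta; intros z Hz.
  split; [lia|]; etransitivity; [apply Hz|]; unfold body_length; nia.
Qed.

Lemma length_sum_query h e : length (sum_query B k xs h e) = (k + 3)%nat.
Proof. unfold sum_query; rewrite length_padded, length_carried; lia. Qed.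

Lemma sum_query_match nb h : (1 <= h)%nat ->
  (exists e, 0 <= e < 2 ^ Z.of_nat k /\
     jumbled_match (k + 3) (T nb) (map Z.to_nat (sum_query B k xs h e))) <->
  (exists j, (j + h <= nb)%nat /\ x (j + h) - x j = x (h - 1)).
Proof.
  intros Hh.
  assert (Hmatch : forall e,
    jumbled_match (k + 3) (T nb) (map Z.to_nat (sum_query B k xs h e)) <->
    exists j, (j + h <= nb)%nat /\
      carried B (3 * B * Z.of_nat h) k (x (h - 1)) e 0 =
      digit_diffs B (3 * B * Z.of_nat h) k (x (j + h)) (x j)).
  { intros e; apply jumbled_match_padded; [exact Hh | apply length_carried|].
    eapply Forall_impl; [|apply (sum_query_range h e Hh)]; cbv beta; intros; lia. }
  assert (Hcarry : forall j, x (j + h) - x j = x (h - 1) <->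
    exists e, 0 <= e < 2 ^ Z.of_nat k /\
      carried B (3 * B * Z.of_nat h) k (x (h - 1)) e 0 =
      digit_diffs B (3 * B * Z.of_nat h) k (x (j + h)) (x j)).
  { intros j; rewrite carried_eq_digit_diffs_iff by lia; lia. }
  split.
  - intros (e & He & Hm); apply Hmatch in Hm as (j & Hj & E).
    exists j; split; [exact Hj | apply Hcarry; eauto].
  - intros (j & Hj & E); apply Hcarry in E as (e & He & E).
    exists e; split; [exact He | apply Hmatch; eauto].
Qed.

End Text.

(** * The program *)

(* [rOffset] holds 3B and [rBody] the length of a block without its separator.
   [rRange] and [rHalf] hold 2^W and 2^(W-1), where [W] is the word size of the
   index.  The memory of the index occupies the addresses from -2^(W-1) to
   2^(W-1) - 1 and is followed by its overlay; the input is moved to the address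
   3 * 2^W held by [rInput], where neither can reach it. *)
Notation rN := 0%nat (only parsing).
Notation rOne := 1%nat (only parsing).
Notation rBase := 2%nat (only parsing).
Notation rOffset := 3%nat (only parsing).
Notation rBody := 4%nat (only parsing).
Notation rBlock := 5%nat (only parsing).
Notation rBlocks := 6%nat (only parsing).
Notation rTextLen := 7%nat (only parsing).
Notation rQueries := 10%nat (only parsing).
Notation rCarries := 11%nat (only parsing).
Notation rInput := 12%nat (only parsing).
Notation rQuery := 13%nat (only parsing).
Notation rAnswer := 14%nat (only parsing).
Notation rTwo := 16%nat (only parsing).
Notation rZero := 17%nat (only parsing).

Notation rIndex := 24%nat (only parsing).
Notation rPos := 25%nat (only parsing).
Notation rX := 26%nat (only parsing).
Notation rY := 27%nat (only parsing).
Notation rFill := 28%nat (only parsing).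
Notation rCount := 29%nat (only parsing).
Notation rCarry := 30%nat (only parsing).
Notation rBit := 31%nat (only parsing).
Notation rShift := 32%nat (only parsing).
Notation rBits := 33%nat (only parsing).
Notation rWidth := 34%nat (only parsing).
Notation rTotalOffset := 35%nat (only parsing).

Fixpoint power (d b m : nat) : cmd :=
  match m with
  | O => Konst d 1
  | S m' => power d b m' ;; Bin Mul d d b
  end.

Definition find_base (k : nat) : cmd :=
  Konst rBase 1 ;; Konst rTmp 1 ;;
  While (TLt rTmp rN) (Bin Add rBase rBase rOne ;; power rTmp rBase (S k)).

Definition compute_text_length (k : nat) : cmd :=
  Konst rAux 3 ;; Bin Mul rOffset rAux rBase ;;
  Konst rAux (6 * (Z.of_nat k + 1)) ;; Bin Mul rBody rAux rBase ;;
  Bin Add rBlock rBody rOne ;;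
  Konst rBlocks 0 ;; If (TLt rZero rN) (Bin Sub rBlocks rN rOne) Nop ;;
  Bin Mul rTextLen rBlocks rBlock.

Definition compute_range (k word_const : nat) : cmd :=
  Konst rAux (Z.of_nat (k + 4)) ;; Bin Add rAux rTextLen rAux ;; Konst rTmp 1 ;;
  While (TLt rTmp rAux) (Bin Add rTmp rTmp rTmp) ;;
  power rRange rTmp word_const.

Definition initialize (k word_const code_len : nat) : cmd :=
  Konst rOne 1 ;; Konst rTwo 2 ;; Konst rZero 0 ;;
  find_base k ;; compute_text_length k ;; compute_range k word_const ;;
  Bin Div rHalf rRange rTwo ;; Konst rAux 3 ;; Bin Mul rInput rRange rAux ;;
  Konst rCarries (2 ^ Z.of_nat k) ;; Bin Mul rQueries rBlocks rCarries ;;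
  Konst rCodeLen (Z.of_nat code_len).

Definition move_input : cmd :=
  Konst rIndex 0 ;;
  While (TLt rIndex rN)
    (Fetch rTmp rIndex ;; Bin Add rAux rInput rIndex ;; Store rAux rTmp ;;
     Store rIndex rZero ;; Bin Add rIndex rIndex rOne).

Definition emit (a : nat) : cmd :=
  Konst rTmp (Z.of_nat a) ;;
  While (TLt rZero rCount)
    (Store rPos rTmp ;; Bin Add rPos rPos rOne ;; Bin Sub rCount rCount rOne).

Fixpoint emit_digits (a k : nat) : cmd :=
  match k with
  | O =>
      Bin Sub rCount rY rX ;; Bin Add rCount rCount rOffset ;;
      Bin Sub rFill rFill rCount ;; emit a
  | S k' =>
      Bin Mod rCount rY rBase ;; Bin Mod rAux rX rBase ;; Bin Sub rCount rCount rAux ;;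
      Bin Add rCount rCount rOffset ;; Bin Sub rFill rFill rCount ;;
      Bin Div rX rX rBase ;; Bin Div rY rY rBase ;; emit a ;;
      emit_digits (S a) k'
  end.

Definition emit_block (k : nat) : cmd :=
  Bin Add rTmp rInput rIndex ;; Fetch rX rTmp ;;
  Bin Add rTmp rTmp rOne ;; Fetch rY rTmp ;; Bin Add rFill rBody rZero ;;
  emit_digits 0 k ;;
  Bin Add rCount rFill rZero ;; emit (filler k) ;;
  Konst rCount 1 ;; emit (separator k).

Definition emit_text (k : nat) : cmd :=
  Konst rPos 0 ;; Konst rIndex 0 ;;
  While (TLt rIndex rBlocks) (emit_block k ;; Bin Add rIndex rIndex rOne).

Fixpoint clear_guest (nr : nat) : cmd :=
  match nr with
  | O => Nop
  | S nr' => Konst (guest nr') 0 ;; clear_guest nr'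
  end.

Definition start_preprocessing (nr : nat) : cmd :=
  clear_guest nr ;; Bin Add (guest 0) rTextLen rZero ;; Konst rPc 0.

Definition start_queries (code_len : nat) : cmd :=
  Konst rQuery 0 ;; Konst rAnswer 0 ;; Konst rCodeLen (Z.of_nat code_len).

Definition decode_query : cmd :=
  Bin Add rStamp rQuery rOne ;;
  Bin Div rWidth rQuery rCarries ;; Bin Add rWidth rWidth rOne ;;
  Bin Mod rBits rQuery rCarries ;;
  Bin Add rTmp rInput rWidth ;; Bin Sub rTmp rTmp rOne ;; Fetch rX rTmp ;;
  Bin Mul rTotalOffset rOffset rWidth ;; Bin Mul rFill rBody rWidth.

Fixpoint query_digits (a k : nat) : cmd :=
  match k with
  | O =>
      Bin Add rCount rX rTotalOffset ;; Bin Add rCount rCount rCarry ;;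
      Bin Sub rFill rFill rCount ;; Bin Add (guest a) rCount rZero
  | S k' =>
      Bin Mod rBit rBits rTwo ;; Bin Div rBits rBits rTwo ;;
      Bin Mod rCount rX rBase ;; Bin Div rX rX rBase ;;
      Bin Add rCount rCount rTotalOffset ;; Bin Add rCount rCount rCarry ;;
      Bin Mul rShift rBase rBit ;; Bin Sub rCount rCount rShift ;;
      Bin Sub rFill rFill rCount ;; Bin Add (guest a) rCount rZero ;;
      Bin Add rCarry rBit rZero ;; query_digits (S a) k'
  end.

Definition start_query (k nr : nat) : cmd :=
  decode_query ;; clear_guest nr ;; Konst rCarry 0 ;; query_digits 0 k ;;
  Bin Add (guest (filler k)) rFill rZero ;; Bin Sub (guest (separator k)) rWidth rOne ;;
  Konst rPc 0.

Definition record_answer : cmd :=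
  If (TEq (guest 0) rZero) Nop (Konst rAnswer 1) ;; Bin Add rQuery rQuery rOne.

Definition query_loop (k nr : nat) (qry : program) : cmd :=
  While (TLt rQuery rQueries)
    (start_query k nr ;; sim_loop Overlay qry ;; record_answer).

Definition setup (k word_const nr code_len : nat) : cmd :=
  initialize k word_const code_len ;; move_input ;; emit_text k ;; start_preprocessing nr.

Definition conv3sum_cmd (k word_const nr : nat) (pre qry : program) : cmd :=
  setup k word_const nr (length pre) ;; sim_loop InPlace pre ;;
  start_queries (length qry) ;; query_loop k nr qry ;;
  Bin Add 0 rAnswer rZero.

(** * Correctness and cost of the program *)

Lemma input_mem_neg l a : a < 0 -> input_mem l a = 0.
Proof. intros Ha; unfold input_mem; destruct (Z.leb_spec 0 a); [lia | reflexivity]. Qed.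

Lemma input_mem_beyond l a : Z.of_nat (length l) <= a -> input_mem l a = 0.
Proof.
  intros Ha; unfold input_mem; destruct (Z.leb_spec 0 a); [|reflexivity].
  apply nth_overflow; lia.
Qed.

Lemma input_mem_nth l i : input_mem l (Z.of_nat i) = nth i l 0.
Proof.
  unfold input_mem; destruct (Z.leb_spec 0 (Z.of_nat i)); [|lia].
  now rewrite Nat2Z.id.
Qed.

Lemma input_mem_nil a : input_mem [] a = 0.
Proof.
  destruct (Z.lt_ge_cases a 0); [now apply input_mem_neg | now apply input_mem_beyond].
Qed.

Lemma input_mem_app_single l z a :
  input_mem (l ++ [z]) a = if Z.eqb a (Z.of_nat (length l)) then z else input_mem l a.
Proof.
  destruct (Z.eqb_spec a (Z.of_nat (length l))) as [->|Hne].
  - rewrite input_mem_nth, app_nth2, Nat.sub_diag by lia; reflexivity.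
  - unfold input_mem; destruct (Z.leb_spec 0 a); [|reflexivity].
    destruct (Nat.lt_ge_cases (Z.to_nat a) (length l)).
    + now apply app_nth1.
    + rewrite !nth_overflow; rewrite ?length_app; simpl; lia.
Qed.

Lemma Forall_input_mem (P : Z -> Prop) l a : P 0 -> Forall P l -> P (input_mem l a).
Proof.
  intros H0 Hl; unfold input_mem; destruct (Z.leb 0 a); [|exact H0].
  destruct (nth_in_or_default (Z.to_nat a) l 0) as [Hin | ->]; [|exact H0].
  now apply (proj1 (Forall_forall _ _) Hl).
Qed.

Definition least_digit_base (k n : nat) (B : Z) : Prop :=
  0 < B /\ Z.of_nat n <= B ^ Z.of_nat (S k) /\
  forall b, 1 <= b < B -> b ^ Z.of_nat (S k) < Z.of_nat n.

Lemma nth_bounded k xs B i : least_digit_base k (length xs) B ->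
  Forall (fun z => - Z.of_nat (length xs) <= z <= Z.of_nat (length xs)) xs ->
  bounded B k (nth i xs 0).
Proof.
  intros (B_pos & HB & _) Hxs; unfold bounded.
  destruct (nth_in_or_default i xs 0) as [Hin | ->].
  - apply (proj1 (Forall_forall _ _) Hxs) in Hin; lia.
  - assert (0 < B ^ Z.of_nat (S k)) by (apply Z.pow_pos_nonneg; lia); lia.
Qed.

Definition sum_text_length (B : Z) (k n : nat) : nat :=
  ((n - 1) * S (Z.to_nat (body_length B k)))%nat.

(* The factor 16 left below 2^(w-1) makes room for the overlay and for sums of
   a few quantities. *)
Definition host_cap (w : nat) : Z := 2 ^ (Z.of_nat w - 5).

Record fits_host (k w n : nat) (B : Z) (J : index_algorithm) : Prop := {
  base_power_fits : B ^ Z.of_nat (S k) <= host_cap w;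
  block_fits : body_length B k + 1 <= host_cap w;
  index_words_fit :
    2 ^ Z.of_nat (index_word_size (k + 3) J (sum_text_length B k n)) <= host_cap w;
  queries_fit : Z.of_nat (n - 1) * 2 ^ Z.of_nat k <= host_cap w;
  carries_fit : 2 ^ Z.of_nat k <= host_cap w;
  preprocessing_fits : Z.of_nat (length (pre_code J)) <= host_cap w;
  query_fits : Z.of_nat (length (query_code J)) <= host_cap w }.

Section Reduction.

Variables (k w : nat) (xs : list Z) (B : Z) (J : index_algorithm) (nr : nat).

Let n := length xs.
Let blocks := (n - 1)%nat.
Let L := body_length B k.
Let s := sum_text_length B k n.
Let log_text := Nat.log2 (s + (k + 3)).
Let W := index_word_size (k + 3) J s.
Let range := 2 ^ Z.of_nat W.
Let half := 2 ^ (Z.of_nat W - 1).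
Let cap := host_cap w.
Let T := sum_text B k xs blocks.
Let pre := pre_code J.
Let qry := query_code J.

Hypothesis J_solves : solves_jumbled_indexing (k + 3) J.
Hypothesis B_base : least_digit_base k n B.
Hypothesis xs_range : Forall (fun z => - Z.of_nat n <= z <= Z.of_nat n) xs.
Hypothesis host_fits : fits_host k w n B J.

Lemma B_pos : 0 < B.
Proof. apply B_base. Qed.

Lemma word_const_ge_2 : (2 <= index_word_const J)%nat.
Proof. apply J_solves. Qed.

Lemma xs_bounded i : bounded B k (nth i xs 0).
Proof. now apply nth_bounded. Qed.

Lemma index_word_eq : W = (index_word_const J * (log_text + 1))%nat.
Proof. reflexivity. Qed.

Lemma index_word_ge_4 : (4 <= W)%nat.
Proof.
  rewrite index_word_eq; pose proof word_const_ge_2.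
  assert (1 <= log_text)%nat by (unfold log_text; apply (Nat.log2_le_mono 2); lia); nia.
Qed.

Record size_bounds : Prop := {
  base_pos : 0 < B;
  body_pos : 0 < L;
  base_le_body : 6 * B <= L;
  factor_le_body : 6 * (Z.of_nat k + 1) <= L;
  text_length_eq : Z.of_nat s = Z.of_nat blocks * (L + 1);
  text_length_lt : Z.of_nat s + Z.of_nat k + 3 < half;
  input_length_lt : Z.of_nat n < half;
  range_eq : range = 2 * half;
  range_ge : 16 <= range;
  carries_pos : 0 < 2 ^ Z.of_nat k;
  block_le : L + 1 <= cap;
  range_le : range <= cap;
  queries_le : Z.of_nat blocks * 2 ^ Z.of_nat k <= cap;
  carries_le : 2 ^ Z.of_nat k <= cap;
  preprocessing_le : Z.of_nat (length pre) <= cap;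
  query_le : Z.of_nat (length qry) <= cap }.

Lemma sizes : size_bounds.
Proof.
  pose proof B_pos; pose proof word_const_ge_2; pose proof index_word_ge_4 as HW.
  assert (HL : 0 < L) by now apply body_length_pos.
  assert (Es : Z.of_nat s = Z.of_nat blocks * (L + 1))
    by (unfold s, sum_text_length; rewrite Nat2Z.inj_mul, Nat2Z.inj_succ, Z2Nat.id; lia).
  destruct (pow2_half W ltac:(lia)) as [Hdouble Hpos].
  fold range half in Hdouble; fold half in Hpos.
  assert (Hs : Z.of_nat s + Z.of_nat k + 3 < half).
  { pose proof (Nat.log2_spec (s + (k + 3)) ltac:(lia)) as [_ Hlog]; fold log_text in Hlog.
    apply Nat2Z.inj_lt in Hlog; rewrite Nat2Z.inj_pow in Hlog.
    assert (2 ^ Z.of_nat (S log_text) <= half)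
      by (apply Z.pow_le_mono_r; [lia|]; rewrite index_word_eq; nia).
    lia. }
  assert (Hrange : 2 ^ 4 <= range) by (apply Z.pow_le_mono_r; lia).
  constructor; try assumption; try apply host_fits; try (unfold L, body_length; nia).
Qed.

Lemma host_bits : (W + 5 <= w)%nat.
Proof.
  pose proof (index_words_fit _ _ _ _ _ host_fits) as Hwords; unfold host_cap in Hwords.
  destruct (Nat.le_gt_cases (W + 5) w) as [|Hlt]; [assumption | exfalso].
  revert Hwords; apply Z.lt_nge, Z.pow_lt_mono_r_iff; fold n s W; lia.
Qed.

Lemma host_cap_eq : 16 * cap = 2 ^ (Z.of_nat w - 1).
Proof.
  pose proof host_bits; unfold cap, host_cap.
  change 16 with (2 ^ 4); rewrite <- Z.pow_add_r by lia; f_equal; lia.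
Qed.

Lemma host_wrap z : - 16 * cap <= z < 16 * cap -> wrap w z = z.
Proof.
  pose proof host_bits; pose proof host_cap_eq.
  intros Hz; apply wrap_id; [lia | unfold fits; lia].
Qed.

Lemma base_power_le (m : nat) : (m <= k)%nat -> B ^ Z.of_nat (S m) <= cap.
Proof.
  intros Hm; pose proof B_pos; etransitivity; [|apply (base_power_fits _ _ _ _ _ host_fits)].
  apply Z.pow_le_mono_r; lia.
Qed.

Ltac host_arith := cbn [eval_binop]; apply host_wrap; first [lia | nia].
Ltac do_const := const_step host_arith.
Ltac do_op := op_step host_arith.

Lemma runs_power d b m R M :
  d <> b -> 1 <= R b -> R b ^ Z.of_nat m <= cap ->
  runs w (power d b m) R M (m + 1)
    (fun R' M' => M' = M /\ R' d = R b ^ Z.of_nat m /\ changes_only [d] R R').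
Proof.
  intros Hd Hb; induction m as [|m IH]; intros Hm; cbn [power].
  - apply runs_cost_le with (n := 1%nat); [|lia].
    do_const; repeat apply conj; [reflexivity | now regs_simpl | unchanged].
  - rewrite Nat2Z.inj_succ, Z.pow_succ_r in * by lia.
    assert (0 < R b ^ Z.of_nat m) by (apply Z.pow_pos_nonneg; lia).
    eapply runs_cost_le.
    { eapply runs_then; [apply IH; nia|].
      intros R' M' (-> & Hval & Hch).
      eapply runs_bin; [exact Hval | apply Hch; simpl; intuition | host_arith|].
      repeat apply conj; [reflexivity | regs_simpl; lia | unchanged]. }
    lia.
Qed.

Lemma runs_find_base R M :
  R rN = Z.of_nat n -> R rOne = 1 ->
  runs w (find_base k) R M ((k + 6) * Z.to_nat B)
    (fun R' M' => M' = M /\ R' rBase = B /\ changes_only [rBase; rTmp] R R').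
Proof.
  intros HN Hone; pose proof sizes as []; unfold find_base; eapply runs_cost_le.
  { do_const; do_const.
    apply (runs_while w (TLt rTmp rN) _ (fun j R' M' => M' = M /\ exists b,
      1 <= b /\ b + Z.of_nat j = B /\ R' rBase = b /\ R' rTmp = b ^ Z.of_nat (S k) /\
      changes_only [rBase; rTmp] R R') (k + 3) (Z.to_nat (B - 1))).
    - split; [reflexivity|]; exists 1.
      repeat apply conj; regs_simpl; try lia; [|unchanged]; symmetry; apply Z.pow_1_l; lia.
    - intros j R1 M1 (-> & b & Hb & Hj & Hbase & Hpow & Hch).
      assert (HbU : (b + 1) ^ Z.of_nat (S k) <= cap).
      { etransitivity; [|apply (base_power_le k); lia]; apply Z.pow_le_mono_l; lia. }
      split.
      { cbn [holds]; rewrite Hpow, Hch, HN by (cbn [In]; lia).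
        apply Z.ltb_lt, B_base; lia. }
      eapply runs_cost_le.
      { do_op.
        eapply runs_weaken; [reflexivity | | apply (runs_power rTmp rBase (S k)); regs_simpl; lia].
        cbv beta; intros R2 M2 (-> & Hpow2 & Hch2); split; [reflexivity|].
        exists (b + 1); repeat apply conj; [lia | lia | reg_value | | unchanged].
        rewrite Hpow2; now regs_simpl. }
      lia.
    - intros R1 M1 (-> & b & Hb & Hj & Hbase & Hpow & Hch).
      assert (Eb : b = B) by lia; rewrite Eb in *; split; [|now repeat apply conj].
      cbn [holds]; rewrite Hpow, Hch, HN by (cbn [In]; lia).
      apply Z.ltb_ge, B_base. }
  nia.
Qed.

Lemma runs_compute_text_length R M :
  R rN = Z.of_nat n -> R rOne = 1 -> R rZero = 0 -> R rBase = B ->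
  runs w (compute_text_length k) R M 12
    (fun R' M' => M' = M /\ R' rOffset = 3 * B /\ R' rBody = L /\ R' rBlocks = Z.of_nat blocks /\
       R' rTextLen = Z.of_nat s /\
       changes_only [rAux; rOffset; rBody; rBlock; rBlocks; rTextLen] R R').
Proof.
  intros HN Hone Hzero Hbase; pose proof sizes as []; unfold compute_text_length.
  assert (HL : 6 * (Z.of_nat k + 1) * B = L) by reflexivity.
  eapply runs_cost_le.
  { do_const; do_op; do_const; do_op; do_op; do_const.
    eapply (runs_then _ _ _ _ _ _ _ (fun R' M' => M' = M /\ R' rOffset = 3 * B /\ R' rBody = L /\
      R' rBlock = L + 1 /\ R' rBlocks = Z.of_nat blocks /\
      changes_only [rAux; rOffset; rBody; rBlock; rBlocks] R R')).
    { apply (runs_if _ _ _ _ _ _ 1); cbn [holds]; regs_simpl; rewrite HN, Hzero.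
      destruct (Z.ltb_spec 0 (Z.of_nat n)).
      - do_op; repeat apply conj; regs_simpl; try (reflexivity || lia); unchanged.
      - apply runs_cost_le with (n := 0%nat); [|lia].
        apply runs_nop; repeat apply conj; regs_simpl; try (reflexivity || lia); unchanged. }
    intros R1 M1 (-> & Hoffset & Hbody & Hblock & Hblocks & Hch).
    do_op; repeat apply conj; try reg_value; [regs_simpl; lia | unchanged]. }
  lia.
Qed.

Lemma runs_compute_range R M :
  R rTextLen = Z.of_nat s ->
  runs w (compute_range k (index_word_const J)) R M (3 * log_text + index_word_const J + 9)
    (fun R' M' => M' = M /\ R' rRange = range /\ changes_only [rAux; rTmp; rRange] R R').
Proof.
  intros Hlen; pose proof sizes as []; unfold compute_range.
  pose proof (Nat.log2_spec (s + (k + 3)) ltac:(lia)) as [Hlow Hhigh]; fold log_text in Hlow, Hhigh.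
  apply Nat2Z.inj_le in Hlow; apply Nat2Z.inj_lt in Hhigh; rewrite Nat2Z.inj_pow in Hlow, Hhigh.
  change (Z.of_nat 2) with 2 in Hlow, Hhigh.
  assert (Erange : (2 ^ Z.of_nat (S log_text)) ^ Z.of_nat (index_word_const J) = range).
  { rewrite <- Z.pow_mul_r by lia; unfold range; rewrite index_word_eq; f_equal; lia. }
  eapply runs_cost_le.
  { do_const; do_op; do_const.
    eapply runs_then.
    { apply (runs_while w (TLt rTmp rAux) _ (fun j R' M' => M' = M /\ exists i,
        (i + j = S log_text)%nat /\ R' rTmp = 2 ^ Z.of_nat i /\
        R' rAux = Z.of_nat s + Z.of_nat (k + 4) /\ changes_only [rAux; rTmp] R R') 1 (S log_text)
        _ _ (fun R' M' => M' = M /\ R' rTmp = 2 ^ Z.of_nat (S log_text) /\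
                          changes_only [rAux; rTmp] R R')).
      - split; [reflexivity|]; exists 0%nat; repeat apply conj; try (lia || reg_value); unchanged.
      - intros j R1 M1 (-> & i & Hi & Hpow & Haux & Hch).
        assert (2 ^ Z.of_nat i <= 2 ^ Z.of_nat log_text) by (apply Z.pow_le_mono_r; lia).
        assert (0 < 2 ^ Z.of_nat i) by (apply Z.pow_pos_nonneg; lia).
        split; [cbn [holds]; rewrite Hpow, Haux; apply Z.ltb_lt; lia|].
        do_op; split; [reflexivity|]; exists (S i).
        rewrite Nat2Z.inj_succ, Z.pow_succ_r by lia.
        repeat apply conj; [lia | regs_simpl; lia | reg_value | unchanged].
      - intros R1 M1 (-> & i & Hi & Hpow & Haux & Hch).
        assert (i = S log_text) by lia; subst i.
        split; [cbn [holds]; rewrite Hpow, Haux; apply Z.ltb_ge; lia | now repeat apply conj]. }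
    intros R1 M1 (-> & Hpow & Hch).
    eapply runs_weaken; [reflexivity | | apply (runs_power rRange rTmp); [lia | |]].
    - cbv beta; intros R2 M2 (-> & Hrange & Hch2); rewrite Hpow, Erange in Hrange.
      repeat apply conj; [reflexivity | exact Hrange | unchanged].
    - rewrite Hpow; assert (0 < 2 ^ Z.of_nat (S log_text)) by (apply Z.pow_pos_nonneg; lia); lia.
    - rewrite Hpow, Erange; assumption. }
  lia.
Qed.

Record env (R : nat -> Z) : Prop := {
  env_n : R rN = Z.of_nat n;
  env_one : R rOne = 1;
  env_base : R rBase = B;
  env_offset : R rOffset = 3 * B;
  env_body : R rBody = L;
  env_blocks : R rBlocks = Z.of_nat blocks;
  env_text_length : R rTextLen = Z.of_nat s;
  env_range : R rRange = range;
  env_half : R rHalf = half;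
  env_queries : R rQueries = Z.of_nat blocks * 2 ^ Z.of_nat k;
  env_carries : R rCarries = 2 ^ Z.of_nat k;
  env_input : R rInput = 3 * range;
  env_two : R rTwo = 2;
  env_zero : R rZero = 0 }.

Lemma env_ext R R' :
  (forall i, (i <= rInput \/ rTwo <= i <= rZero)%nat -> R' i = R i) -> env R -> env R'.
Proof. intros Hsame []; constructor; rewrite Hsame by lia; assumption. Qed.

Lemma env_agrees_on_globals R R' : agrees_on_globals R R' -> env R -> env R'.
Proof. intros Hg; apply env_ext; intros i Hi; apply Hg; lia. Qed.

Lemma runs_initialize code_len R M :
  R rN = Z.of_nat n -> Z.of_nat code_len <= cap ->
  runs w (initialize k (index_word_const J) code_len) R M
    ((k + 6) * Z.to_nat B + 3 * log_text + index_word_const J + 60)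
    (fun R' M' => M' = M /\ env R' /\ R' rCodeLen = Z.of_nat code_len).
Proof.
  intros HN Hlen; pose proof sizes as []; unfold initialize.
  assert (Ehalf : range / 2 = half) by (rewrite (range_eq sizes), Z.mul_comm; apply Z.div_mul; lia).
  eapply runs_cost_le.
  { do_const; do_const; do_const.
    eapply runs_then; [apply runs_find_base; reg_value|].
    intros R1 M1 (-> & Hbase & Hch1).
    eapply runs_then; [apply runs_compute_text_length; reg_value|].
    intros R2 M2 (-> & Hoffset & Hbody & Hblocks & Hlength & Hch2).
    eapply runs_then; [apply runs_compute_range; reg_value|].
    intros R3 M3 (-> & Hrange & Hch3).
    do_op; do_const; do_op; do_const; do_op; do_const.
    split; [reflexivity|]; split; [constructor; try reg_value; regs_simpl; lia | reg_value]. }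
  lia.
Qed.

Definition holds_text (l : list nat) (M : Z -> Z) : Prop :=
  forall a, M a = input_mem (map Z.of_nat l) a + input_mem xs (a - 3 * range).

Definition partially_moved (i : Z) (M : Z -> Z) : Prop :=
  forall a, M a = (if Z.leb i a then input_mem xs a else 0) +
                  (if Z.ltb a (3 * range + i) then input_mem xs (a - 3 * range) else 0).

Lemma partially_moved_0 M : (forall a, M a = input_mem xs a) -> partially_moved 0 M.
Proof.
  pose proof sizes as []; intros HM a; rewrite HM.
  destruct (Z.leb_spec 0 a), (Z.ltb_spec a (3 * range + 0));
    rewrite ?(input_mem_neg xs a), ?(input_mem_neg xs (a - 3 * range)) by lia; lia.
Qed.

Lemma partially_moved_all M : partially_moved (Z.of_nat n) M -> holds_text [] M.
Proof.
  intros HM a; rewrite HM; cbn [map]; rewrite input_mem_nil.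
  destruct (Z.leb_spec (Z.of_nat n) a), (Z.ltb_spec a (3 * range + Z.of_nat n));
    rewrite ?(input_mem_beyond xs a), ?(input_mem_beyond xs (a - 3 * range)) by (fold n; lia); lia.
Qed.

Lemma partially_moved_source i M : 0 <= i < Z.of_nat n -> partially_moved i M ->
  M i = input_mem xs i.
Proof.
  pose proof sizes as []; intros Hi HM; rewrite HM, Z.leb_refl.
  destruct (Z.ltb i (3 * range + i)); rewrite ?(input_mem_neg xs (i - 3 * range)) by lia; lia.
Qed.

Lemma partially_moved_step i M : 0 <= i < Z.of_nat n -> partially_moved i M ->
  partially_moved (i + 1) (upd_mem (upd_mem M (3 * range + i) (input_mem xs i)) i 0).
Proof.
  pose proof sizes as []; intros Hi HM a; unfold upd_mem; rewrite HM.
  destruct (Z.eqb_spec a i) as [->|Hsource].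
  { destruct (Z.leb_spec (i + 1) i), (Z.ltb_spec i (3 * range + (i + 1))); try lia.
    rewrite input_mem_neg; lia. }
  destruct (Z.eqb_spec a (3 * range + i)) as [->|Htarget].
  - replace (3 * range + i - 3 * range) with i by lia.
    destruct (Z.leb_spec (i + 1) (3 * range + i)),
      (Z.ltb_spec (3 * range + i) (3 * range + (i + 1))); try lia.
    rewrite (input_mem_beyond xs (3 * range + i)) by (fold n; lia); lia.
  - destruct (Z.leb_spec i a), (Z.leb_spec (i + 1) a), (Z.ltb_spec a (3 * range + i)),
      (Z.ltb_spec a (3 * range + (i + 1))); lia.
Qed.

Lemma runs_move_input R M :
  env R -> (forall a, M a = input_mem xs a) ->
  runs w move_input R M (n * 7 + 3)
    (fun R' M' => agrees_on_globals R R' /\ holds_text [] M').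
Proof.
  intros [] HM; pose proof sizes as []; unfold move_input; eapply runs_cost_le.
  { do_const.
    eapply (runs_while w (TLt rIndex rN) _ (fun j R' M' => exists i,
      (i + j = n)%nat /\ R' rIndex = Z.of_nat i /\
      changes_only [rTmp; rAux; rIndex] R R' /\ partially_moved (Z.of_nat i) M') _ n).
    - exists 0%nat; repeat apply conj; [lia | reg_value | unchanged | now apply partially_moved_0].
    - intros j R1 M1 (i & Hi & Hidx & Hch & HM1); split.
      { cbn [holds]; rewrite Hidx, Hch by (cbn [In]; lia); apply Z.ltb_lt; lia. }
      do_fetch; [apply partially_moved_source; [lia | exact HM1]|].
      do_op; do_store; do_store; do_op.
      exists (S i); repeat apply conj; [lia | regs_simpl; lia | unchanged |].
      rewrite Nat2Z.inj_succ, <- Z.add_1_r; apply partially_moved_step; [lia | exact HM1].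
    - intros R1 M1 (i & Hi & Hidx & Hch & HM1); split.
      { cbn [holds]; rewrite Hidx, Hch by (cbn [In]; lia); apply Z.ltb_ge; lia. }
      split; [intros b Hb; apply Hch; cbn [In]; lia|].
      apply partially_moved_all; now replace n with i by lia. }
  lia.
Qed.

Lemma holds_text_app_single l a M :
  Z.of_nat (length l) < half -> holds_text l M ->
  holds_text (l ++ [a]) (upd_mem M (Z.of_nat (length l)) (Z.of_nat a)).
Proof.
  pose proof sizes as []; intros Hlen HM b.
  rewrite map_app; cbn [map]; rewrite input_mem_app_single, length_map.
  unfold upd_mem; destruct (Z.eqb_spec b (Z.of_nat (length l))) as [->|]; [|apply HM].
  rewrite input_mem_neg; lia.
Qed.

Lemma holds_text_input l M i :
  holds_text l M -> Z.of_nat (length l) <= half -> M (3 * range + Z.of_nat i) = nth i xs 0.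
Proof.
  pose proof sizes as []; intros HM Hlen; rewrite HM, input_mem_beyond by (rewrite length_map; lia).
  replace (3 * range + Z.of_nat i - 3 * range) with (Z.of_nat i) by lia.
  now rewrite input_mem_nth.
Qed.

Lemma runs_emit a c l R M :
  env R -> Z.of_nat a <= cap -> 0 <= c ->
  R rCount = c -> R rPos = Z.of_nat (length l) ->
  Z.of_nat (length l) + c <= half -> holds_text l M ->
  runs w (emit a) R M (Z.to_nat c * 5 + 3)
    (fun R' M' => holds_text (l ++ repeat a (Z.to_nat c)) M' /\
       R' rPos = Z.of_nat (length l) + c /\ changes_only [rTmp; rPos; rCount] R R').
Proof.
  intros [] Ha Hc Hcount Hpos Hlen HM; pose proof sizes as []; unfold emit.
  eapply runs_cost_le.
  { do_const.
    eapply (runs_while w (TLt rZero rCount) _ (fun j R' M' => exists i,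
      (i + j = Z.to_nat c)%nat /\ R' rTmp = Z.of_nat a /\ R' rCount = Z.of_nat j /\
      R' rPos = Z.of_nat (length (l ++ repeat a i)) /\
      changes_only [rTmp; rPos; rCount] R R' /\ holds_text (l ++ repeat a i) M')
      _ (Z.to_nat c)).
    - exists 0%nat; cbn [repeat]; rewrite app_nil_r.
      repeat apply conj; [lia | reg_value | regs_simpl; lia | reg_value | unchanged | exact HM].
    - intros j R1 M1 (i & Hi & Htmp & Hcnt & Hpos1 & Hch & HM1); split.
      { cbn [holds]; rewrite Hcnt, Hch by (cbn [In]; lia); apply Z.ltb_lt; lia. }
      assert (length (l ++ repeat a i) = length l + i)%nat
        by now rewrite length_app, repeat_length.
      do_store; do_op; do_op; exists (S i).
      rewrite <- Nat.add_1_r, repeat_app, app_assoc, (length_app (l ++ _)); cbn [repeat length].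
      repeat apply conj; [lia | reg_value | regs_simpl; lia | regs_simpl; lia | unchanged |].
      apply holds_text_app_single; [lia | exact HM1].
    - intros R1 M1 (i & Hi & Htmp & Hcnt & Hpos1 & Hch & HM1); split.
      { cbn [holds]; rewrite Hcnt, Hch by (cbn [In]; lia); apply Z.ltb_ge; lia. }
      rewrite length_app, repeat_length in Hpos1.
      replace (Z.to_nat c) with i by lia; repeat apply conj; [exact HM1 | lia | exact Hch]. }
  lia.
Qed.

Ltac preserves_env := eapply env_ext; [|eassumption]; unchanged.

Lemma runs_emit_digits a m x y f l R M :
  env R -> Z.of_nat (a + m) <= cap -> (m <= k)%nat -> bounded B m x -> bounded B m y ->
  R rX = x -> R rY = y -> R rFill = f -> R rPos = Z.of_nat (length l) ->
  let d := digit_diffs B (3 * B) m y x in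
  zsum d <= f <= cap -> Z.of_nat (length l) + zsum d <= half -> holds_text l M ->
  runs w (emit_digits a m) R M (Z.to_nat (zsum d) * 5 + 11 * (m + 1))
    (fun R' M' => holds_text (l ++ spell a d) M' /\
       R' rPos = Z.of_nat (length l) + zsum d /\ R' rFill = f - zsum d /\
       changes_only [rTmp; rAux; rPos; rX; rY; rFill; rCount] R R').
Proof.
  pose proof sizes as []; intros Henv Ha Hm.
  revert a x y f l R M Henv Ha; induction m as [|m IH];
    intros a x y f l R M Henv Ha Hx Hy HX HY HF Hpos d Hf Hlen HM;
    pose proof Henv as []; cbn [emit_digits].
  - apply bounded_0 in Hx; apply bounded_0 in Hy.
    subst d; cbn [digit_diffs zsum fold_right spell] in *; rewrite Z.add_0_r, app_nil_r in *.
    eapply runs_cost_le.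
    { do_op; do_op; do_op.
      eapply runs_weaken; [reflexivity | |
        apply (runs_emit a (y - x + 3 * B) l); [preserves_env | lia | lia | reg_value | reg_value
          | lia | exact HM]].
      cbv beta; intros R1 M1 (HM1 & Hpos1 & Hch).
      repeat apply conj; [exact HM1 | exact Hpos1 | reg_value | unchanged]. }
    lia.
  - pose proof (Z.mod_pos_bound x B ltac:(lia)); pose proof (Z.mod_pos_bound y B ltac:(lia)).
    pose proof (bounded_div B m x ltac:(lia) Hx) as Hx'.
    pose proof (bounded_div B m y ltac:(lia) Hy) as Hy'.
    pose proof (zsum_range _ _ (digit_diffs_range B m (y / B) (x / B) ltac:(lia) Hy' Hx')).
    pose proof (base_power_le m ltac:(lia)); unfold bounded in Hx', Hy'.
    subst d; cbn [digit_diffs spell] in *; rewrite zsum_cons in *.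
    set (d := digit_diffs B (3 * B) m (y / B) (x / B)) in *.
    eapply runs_cost_le.
    { do_op; do_op; do_op; do_op; do_op; do_op; do_op.
      eapply runs_then.
      { apply (runs_emit a (y mod B - x mod B + 3 * B) l);
          [preserves_env | lia | lia | reg_value | reg_value | lia | exact HM]. }
      intros R1 M1 (HM1 & Hpos1 & Hch1).
      eapply runs_weaken; [reflexivity | |
        apply (IH ltac:(lia) (S a) (x / B) (y / B) (f - (y mod B - x mod B + 3 * B))
          (l ++ repeat a (Z.to_nat (y mod B - x mod B + 3 * B))));
        [preserves_env | lia | exact Hx' | exact Hy' | reg_value | reg_value | reg_value
        | rewrite Hpos1, length_app, repeat_length; lia | fold d; lia
        | fold d; rewrite length_app, repeat_length; lia | exact HM1]].
      cbv beta; fold d; intros R2 M2 (HM2 & Hpos2 & Hfill2 & Hch2).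
      rewrite <- app_assoc in HM2; rewrite length_app, repeat_length in Hpos2.
      repeat apply conj; [exact HM2 | lia | lia | unchanged]. }
    fold d; lia.
Qed.

Lemma runs_emit_block i R M :
  env R -> R rIndex = Z.of_nat i -> (i < blocks)%nat ->
  R rPos = Z.of_nat (length (sum_text B k xs i)) -> holds_text (sum_text B k xs i) M ->
  runs w (emit_block k) R M (Z.to_nat L * 5 + 11 * k + 30)
    (fun R' M' => holds_text (sum_text B k xs (S i)) M' /\
       R' rPos = Z.of_nat (length (sum_text B k xs (S i))) /\
       changes_only [rTmp; rAux; rPos; rX; rY; rFill; rCount] R R').
Proof.
  intros Henv Hidx Hi Hpos HM; pose proof Henv as []; pose proof sizes as [].
  assert (Hlen : Z.of_nat (length (sum_text B k xs i)) + L + 1 <= Z.of_nat s).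
  { rewrite (length_sum_text B k xs B_pos xs_bounded); fold L.
    rewrite (text_length_eq sizes), Nat2Z.inj_mul, Nat2Z.inj_succ, Z2Nat.id by lia; nia. }
  pose proof (consecutive_diffs_sum B k xs B_pos xs_bounded i) as Hsum; fold L in Hsum.
  pose proof (length_spell 0 _ (consecutive_diffs_nonneg B k xs B_pos xs_bounded i)) as Hspell.
  rewrite sum_text_S; unfold block, emit_block; fold L.
  set (t := sum_text B k xs i) in *; set (x := nth i xs 0) in *; set (y := nth (S i) xs 0) in *.
  set (d := digit_diffs B (3 * B) k y x) in *.
  eapply runs_cost_le.
  { do_op; do_fetch; [apply (holds_text_input t); [exact HM | lia]|].
    do_op; do_fetch.
    { replace (3 * range + Z.of_nat i + 1) with (3 * range + Z.of_nat (S i)) by lia.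
      apply (holds_text_input t); [exact HM | lia]. }
    fold x y; do_op.
    eapply runs_then.
    { apply (runs_emit_digits 0 k x y L t); fold d; try apply xs_bounded; try lia;
        [preserves_env | reg_value | reg_value | regs_simpl; lia | reg_value | exact HM]. }
    fold d; intros R1 M1 (HM1 & Hpos1 & Hfill1 & Hch1).
    do_op; eapply runs_then.
    { apply (runs_emit (filler k) (L - zsum d) (t ++ spell 0 d));
        [preserves_env | lia | lia | regs_simpl; lia | regs_simpl; rewrite length_app; lia
        | rewrite length_app; lia | exact HM1]. }
    intros R2 M2 (HM2 & Hpos2 & Hch2).
    do_const; eapply runs_weaken; [reflexivity | |
      apply (runs_emit (separator k) 1
        ((t ++ spell 0 d) ++ repeat (filler k) (Z.to_nat (L - zsum d))));
      [preserves_env | lia | lia | reg_value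
      | regs_simpl; rewrite Hpos2, (length_app _ (repeat _ _)), repeat_length; lia
      | rewrite !length_app, repeat_length; lia | exact HM2]].
    cbv beta; intros R3 M3 (HM3 & Hpos3 & Hch3).
    change (repeat (separator k) (Z.to_nat 1)) with [separator k] in HM3.
    rewrite <- !app_assoc in HM3.
    repeat apply conj; [exact HM3 | | unchanged].
    rewrite Hpos3, !length_app, !repeat_length; cbn [length]; lia. }
  fold d; lia.
Qed.

Lemma runs_emit_text R M :
  env R -> holds_text [] M ->
  runs w (emit_text k) R M (blocks * (Z.to_nat L * 5 + 11 * k + 40) + 4)
    (fun R' M' => agrees_on_globals R R' /\ holds_text T M').
Proof.
  intros Henv HM; pose proof Henv as []; pose proof sizes as []; unfold emit_text.
  eapply runs_cost_le.
  { do_const; do_const.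
    eapply (runs_while w (TLt rIndex rBlocks) _ (fun j R' M' => exists i,
      (i + j = blocks)%nat /\ R' rIndex = Z.of_nat i /\
      R' rPos = Z.of_nat (length (sum_text B k xs i)) /\
      changes_only [rTmp; rAux; rIndex; rPos; rX; rY; rFill; rCount] R R' /\
      holds_text (sum_text B k xs i) M') _ blocks).
    - exists 0%nat; repeat apply conj; [lia | reg_value | reg_value | unchanged | exact HM].
    - intros j R1 M1 (i & Hi & Hidx & Hpos & Hch & HM1); split.
      { cbn [holds]; rewrite Hidx, Hch by (cbn [In]; lia); apply Z.ltb_lt; lia. }
      eapply runs_then; [apply (runs_emit_block i); [preserves_env | exact Hidx | lia | exact Hpos
        | exact HM1]|].
      intros R2 M2 (HM2 & Hpos2 & Hch2); do_op; exists (S i).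
      repeat apply conj; [lia | regs_simpl; lia | reg_value | unchanged | exact HM2].
    - intros R1 M1 (i & Hi & Hidx & Hpos & Hch & HM1); split.
      { cbn [holds]; rewrite Hidx, Hch by (cbn [In]; lia); apply Z.ltb_ge; lia. }
      split; [intros b Hb; apply Hch; cbn [In]; lia|].
      unfold T; now replace blocks with i by lia. }
  lia.
Qed.

Lemma runs_clear_guest m R M :
  runs w (clear_guest m) R M m
    (fun R' M' => M' = M /\ (forall i, (i < m)%nat -> R' (guest i) = 0) /\
       forall i, (i < 40 \/ guest m <= i)%nat -> R' i = R i).
Proof.
  pose proof sizes as [].
  revert R; induction m as [|m IH]; intros R; cbn [clear_guest].
  - apply runs_nop; repeat apply conj; [reflexivity | lia | reflexivity].
  - eapply runs_cost_le.
    { do_const; eapply runs_weaken; [reflexivity | | apply IH].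
      cbv beta; intros R' M' (-> & Hzero & Hother); repeat apply conj; [reflexivity | |].
      - intros i Hi; destruct (Nat.eq_dec i m) as [->|]; [|apply Hzero; lia].
        rewrite Hother by lia; now regs_simpl.
      - intros i Hi; rewrite Hother by lia; now regs_simpl. }
    lia.
Qed.

Lemma runs_start_preprocessing R M :
  (1 <= nr)%nat -> env R ->
  runs w (start_preprocessing nr) R M (nr + 2)
    (fun R' M' => M' = M /\ agrees_on_globals R R' /\ R' rPc = 0 /\
       forall i, (i < nr)%nat -> R' (guest i) = upd_reg (fun _ => 0) 0 (Z.of_nat s) i).
Proof.
  intros Hnr []; pose proof sizes as []; unfold start_preprocessing.
  eapply runs_cost_le.
  { eapply runs_then; [apply runs_clear_guest|].
    intros R1 M1 (-> & Hzero & Hother).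
    assert (Hg : agrees_on_globals R R1) by (intros i Hi; apply Hother; lia).
    do_op; do_const; repeat apply conj; [reflexivity | unchanged | reg_value |].
    intros [|i] Hi; [regs_simpl; lia|]; regs_simpl; apply Hzero; lia. }
  lia.
Qed.

Lemma runs_query_digits a m u e h cin f R M :
  env R -> (m <= k)%nat -> bounded B m u -> 0 <= cin <= 1 -> 0 <= e <= cap ->
  1 <= h -> 3 * B * h <= cap ->
  R rBits = e -> R rX = u -> R rTotalOffset = 3 * B * h -> R rFill = f -> R rCarry = cin ->
  let d := carried B (3 * B * h) m u e cin in
  zsum d <= f <= cap ->
  runs w (query_digits a m) R M (11 * (m + 1))
    (fun R' M' => M' = M /\ R' rFill = f - zsum d /\
       (forall i, (i <= m)%nat -> R' (guest (a + i)) = nth i d 0) /\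
       (forall i, ~ In i [rBits; rX; rFill; rCount; rCarry; rBit; rShift] /\
          (i < guest a \/ guest (a + m) < i)%nat -> R' i = R i)).
Proof.
  pose proof sizes as []; intros Henv Hm Hu Hc He Hh HBh; revert a u e cin f R M Henv Hu Hc He.
  induction m as [|m IH];
    intros a u e cin f R M Henv Hu Hc He HBits HX Hoffset HF Hcarry d Hf; pose proof Henv as [];
    pose proof (carried_range B h _ u e cin ltac:(lia) Hh Hu Hc) as Hr; cbn [query_digits].
  - apply bounded_0 in Hu; subst d; cbn [carried zsum fold_right] in *.
    rewrite Z.add_0_r in *; apply Forall_cons_iff in Hr as [Hr _].
    eapply runs_cost_le.
    { do_op; do_op; do_op; do_op; repeat apply conj; [reflexivity | reg_value | |].
      - intros i Hi; replace i with 0%nat by lia; rewrite Nat.add_0_r.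
        regs_simpl; cbn [nth]; lia.
      - intros i [Hi Hi']; cbn [In] in Hi; now regs_simpl. }
    lia.
  - pose proof (Z.mod_pos_bound u B ltac:(lia)); pose proof (Z.mod_pos_bound e 2 ltac:(lia)).
    pose proof (Z.div_mod e 2 ltac:(lia)); pose proof (base_power_le m ltac:(lia)).
    pose proof (bounded_div B m u ltac:(lia) Hu) as Hu'.
    pose proof (zsum_range _ _ (carried_range B h m (u / B) (e / 2) (e mod 2) ltac:(lia) Hh Hu'
      ltac:(lia))).
    unfold bounded in Hu'; subst d; cbn [carried] in *.
    set (d := carried B (3 * B * h) m (u / B) (e / 2) (e mod 2)) in *.
    set (c := u mod B + 3 * B * h + cin - B * (e mod 2)) in *.
    rewrite zsum_cons in *; apply Forall_cons_iff in Hr as [Hr _].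
    assert (0 <= B * (e mod 2) <= B)
      by (assert (Hbit : e mod 2 = 0 \/ e mod 2 = 1) by lia; destruct Hbit as [-> | ->]; lia).
    eapply runs_cost_le.
    { do_op; do_op; do_op; do_op; do_op; do_op; do_op; do_op; do_op; do_op; do_op.
      eapply runs_weaken; [reflexivity | |
        apply (IH ltac:(lia) (S a) (u / B) (e / 2) (e mod 2) (f - c));
        [preserves_env | exact Hu' | lia | lia | reg_value | reg_value | reg_value | reg_value
        | regs_simpl; lia | fold d; lia]].
      cbv beta; fold d; intros R2 M2 (-> & Hfill & Hdigits & Hother).
      repeat apply conj; [reflexivity | lia | |].
      + intros [|i] Hi.
        * rewrite Nat.add_0_r, Hother by (cbn [In]; lia); regs_simpl; cbn [nth]; lia.
        * replace (a + S i)%nat with (S a + i)%nat by lia; cbn [nth]; apply Hdigits; lia.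
      + intros i [Hi Hi']; rewrite Hother by (split; [exact Hi | lia]); cbn [In] in Hi.
        now regs_simpl. }
    lia.
Qed.

Let queries := (blocks * 2 ^ k)%nat.

Definition query_width (idx : nat) : nat := (idx / 2 ^ k + 1)%nat.

Definition query_carries (idx : nat) : Z := Z.of_nat idx mod 2 ^ Z.of_nat k.

Definition query_counts (idx : nat) : list Z :=
  sum_query B k xs (query_width idx) (query_carries idx).

Definition nth_query (idx : nat) : list nat := map Z.to_nat (query_counts idx).

Lemma of_nat_query_number : Z.of_nat queries = Z.of_nat blocks * 2 ^ Z.of_nat k.
Proof. unfold queries; rewrite Nat2Z.inj_mul, Nat2Z.inj_pow; reflexivity. Qed.

Lemma query_width_range idx : (idx < queries)%nat -> (1 <= query_width idx <= blocks)%nat.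
Proof.
  unfold query_width; intros Hi; assert (idx / 2 ^ k < blocks)%nat; [|lia].
  apply Nat.Div0.div_lt_upper_bound; unfold queries in Hi; lia.
Qed.

Lemma of_nat_query_width idx :
  Z.of_nat (query_width idx) = Z.of_nat idx / 2 ^ Z.of_nat k + 1.
Proof.
  unfold query_width; rewrite Nat2Z.inj_add, Nat2Z.inj_div, Nat2Z.inj_pow; reflexivity.
Qed.

Lemma query_carries_range idx : 0 <= query_carries idx < 2 ^ Z.of_nat k.
Proof. pose proof sizes as []; now apply Z.mod_pos_bound. Qed.

Lemma query_body_le idx : (idx < queries)%nat -> L * Z.of_nat (query_width idx) <= Z.of_nat s.
Proof. intros Hi; pose proof (query_width_range idx Hi); pose proof sizes as []; nia. Qed.

Lemma query_counts_range idx : (idx < queries)%nat ->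
  Forall (fun z => 0 <= z < half) (query_counts idx).
Proof.
  intros Hi; pose proof (query_body_le idx Hi); pose proof sizes as [].
  eapply Forall_impl; [|apply (sum_query_range B k xs B_pos xs_bounded)].
  - cbv beta; fold L; intros; lia.
  - now apply query_width_range.
Qed.

Lemma nth_query_counts_range idx i : (idx < queries)%nat -> 0 <= nth i (query_counts idx) 0 < half.
Proof.
  intros Hi; pose proof sizes as [].
  destruct (nth_in_or_default i (query_counts idx) 0) as [Hin | ->]; [|lia].
  now apply (proj1 (Forall_forall _ _) (query_counts_range idx Hi)).
Qed.

Lemma of_nat_nth_nth_query idx i : (idx < queries)%nat ->
  Z.of_nat (nth i (nth_query idx) 0%nat) = nth i (query_counts idx) 0.
Proof.
  intros Hi; unfold nth_query; change 0%nat with (Z.to_nat 0); rewrite map_nth.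
  apply Z2Nat.id, nth_query_counts_range, Hi.
Qed.

Lemma nth_query_vector idx : (idx < queries)%nat -> query_vector (k + 3) J s (nth_query idx).
Proof.
  intros Hi; split.
  - unfold nth_query; rewrite length_map; apply length_sum_query.
  - apply Forall_map; fold W half.
    eapply Forall_impl; [|apply (query_counts_range idx Hi)]; cbv beta; intros; lia.
Qed.

Lemma sum_text_is_text : text (k + 3) s T.
Proof.
  split.
  - apply (length_sum_text B k xs B_pos xs_bounded).
  - apply (sum_text_letters B k xs B_pos xs_bounded).
Qed.

Definition matched (idx : nat) : Prop :=
  exists i, (i < idx)%nat /\ jumbled_match (k + 3) T (nth_query i).

Lemma query_of_width_carries h e : (1 <= h <= blocks)%nat -> 0 <= e < 2 ^ Z.of_nat k ->
  exists idx, (idx < queries)%nat /\ query_width idx = h /\ query_carries idx = e.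
Proof.
  intros Hh He; exists ((h - 1) * 2 ^ k + Z.to_nat e)%nat.
  assert (Hen : (Z.to_nat e < 2 ^ k)%nat)
    by (apply Nat2Z.inj_lt; rewrite Nat2Z.inj_pow, Z2Nat.id by lia; apply He).
  repeat apply conj.
  - pose proof (Nat.mul_le_mono_r (h - 1 + 1) blocks (2 ^ k) ltac:(lia)); unfold queries; lia.
  - unfold query_width; rewrite Nat.div_add_l, Nat.div_small by lia; lia.
  - unfold query_carries.
    rewrite Nat2Z.inj_add, Nat2Z.inj_mul, Nat2Z.inj_pow, Z2Nat.id, Z.add_comm, Z.mod_add by lia.
    apply Z.mod_small; lia.
Qed.

Lemma conv3sum_iff_matched : conv3sum xs <-> matched queries.
Proof.
  pose proof (sum_query_match B k xs B_pos xs_bounded blocks) as Hmatch; cbv zeta in Hmatch.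
  split.
  - intros (i & j & Hj & Hji & Hi & E); fold n in Hi.
    destruct (proj2 (Hmatch (i - j)%nat ltac:(lia))) as (e & He & Hm).
    { exists (j - 1)%nat; split; [unfold blocks; lia|].
      replace (j - 1 + (i - j))%nat with (i - 1)%nat by lia; exact E. }
    destruct (query_of_width_carries (i - j) e ltac:(unfold blocks; lia) He)
      as (idx & Hidx & Hw & Hc).
    exists idx; split; [exact Hidx|].
    unfold nth_query, query_counts; now rewrite Hw, Hc.
  - intros (idx & Hidx & Hm); pose proof (query_width_range idx Hidx) as Hh.
    destruct (proj1 (Hmatch (query_width idx) ltac:(lia))) as (j & Hj & E).
    { exists (query_carries idx); split; [apply query_carries_range | exact Hm]. }
    set (h := query_width idx) in *.
    exists (j + h + 1)%nat, (j + 1)%nat; unfold blocks in *; fold n.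
    repeat apply conj; try lia.
    replace (j + h + 1 - 1)%nat with (j + h)%nat by lia.
    replace (j + 1 - 1)%nat with j by lia.
    replace (j + h + 1 - (j + 1) - 1)%nat with (h - 1)%nat by lia; exact E.
Qed.

Lemma runs_decode_query idx R M :
  (idx < queries)%nat -> env R -> (forall i, M (3 * range + Z.of_nat i) = nth i xs 0) ->
  R rQuery = Z.of_nat idx ->
  runs w decode_query R M 9
    (fun R' M' => M' = M /\ R' rStamp = Z.of_nat idx + 1 /\
       R' rWidth = Z.of_nat (query_width idx) /\ R' rBits = query_carries idx /\
       R' rX = nth (query_width idx - 1) xs 0 /\
       R' rTotalOffset = 3 * B * Z.of_nat (query_width idx) /\
       R' rFill = L * Z.of_nat (query_width idx) /\
       changes_only [rStamp; rWidth; rBits; rTmp; rX; rTotalOffset; rFill] R R').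
Proof.
  intros Hidx [] HM Hquery; pose proof sizes as [].
  assert (Z.of_nat idx < Z.of_nat blocks * 2 ^ Z.of_nat k) by (rewrite <- of_nat_query_number; lia).
  pose proof (query_width_range idx Hidx); pose proof (query_body_le idx Hidx).
  pose proof (of_nat_query_width idx) as Hwidth.
  pose proof (query_carries_range idx); unfold query_carries in *.
  assert (3 * B * Z.of_nat (query_width idx) <= L * Z.of_nat (query_width idx))
    by (apply Z.mul_le_mono_nonneg_r; lia).
  unfold decode_query; eapply runs_cost_le.
  { do_op; do_op; do_op; do_op; do_op; do_op; do_fetch.
    { rewrite <- Hwidth.
      replace (3 * range + Z.of_nat (query_width idx) - 1)
        with (3 * range + Z.of_nat (query_width idx - 1)) by lia; apply HM. }
    rewrite <- Hwidth; do_op; do_op; repeat apply conj; try reg_value; unchanged. }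
  lia.
Qed.

Lemma runs_start_query idx R M :
  (k + 3 <= nr)%nat -> (idx < queries)%nat -> env R ->
  (forall i, M (3 * range + Z.of_nat i) = nth i xs 0) -> R rQuery = Z.of_nat idx ->
  runs w (start_query k nr) R M (nr + 11 * k + 30)
    (fun R' M' => M' = M /\ agrees_on_globals (upd_reg R rStamp (Z.of_nat idx + 1)) R' /\
       R' rPc = 0 /\ forall i, (i < nr)%nat -> R' (guest i) = nth i (query_counts idx) 0).
Proof.
  intros Hnr Hidx Henv HM Hquery; pose proof Henv as []; pose proof sizes as [].
  pose proof (query_width_range idx Hidx) as Hh; pose proof (query_body_le idx Hidx).
  pose proof (query_carries_range idx); set (h := query_width idx) in *.
  pose proof (carried_sum_range B k B_pos h (nth (h - 1) xs 0) (query_carries idx) ltac:(lia)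
    (xs_bounded _)) as Hsum; cbv zeta in Hsum.
  assert (Hoffset_le : 3 * B * Z.of_nat h <= L * Z.of_nat h)
    by (apply Z.mul_le_mono_nonneg_r; lia).
  unfold query_counts, sum_query; fold h L in Hsum |- *.
  set (d := carried B (3 * B * Z.of_nat h) k (nth (h - 1) xs 0) (query_carries idx) 0) in *.
  assert (Hd : length d = S k) by apply length_carried.
  unfold start_query; eapply runs_cost_le.
  { eapply runs_then; [apply (runs_decode_query idx); assumption|].
    intros R1 M1 (-> & Hstamp & Hwidth & Hbits & HX & Hoffset & Hfill & Hch1).
    eapply runs_then; [apply runs_clear_guest|].
    intros R2 M2 (-> & Hzero & Hother2); do_const.
    eapply runs_then.
    { apply (runs_query_digits 0 k (nth (h - 1) xs 0) (query_carries idx) (Z.of_nat h) 0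
        (L * Z.of_nat h)); try lia; try apply xs_bounded; try (fold d; lia);
        [preserves_env | reg_value..]. }
    fold d; intros R3 M3 (-> & Hfill3 & Hdigits & Hother3).
    do_op; do_op; do_const; repeat apply conj; [reflexivity | | reg_value |].
    - intros i Hi; destruct (Nat.eq_dec i rStamp) as [->|]; regs_simpl; [reg_value | reg_unchanged].
    - intros i Hi; destruct (Nat.le_gt_cases i k).
      { rewrite nth_padded by lia; regs_simpl; apply (Hdigits i); lia. }
      destruct (Nat.eq_dec i (filler k)) as [->|].
      { rewrite nth_padded_filler by lia; regs_simpl; lia. }
      destruct (Nat.eq_dec i (separator k)) as [->|].
      { rewrite nth_padded_separator by lia; now regs_simpl. }
      rewrite nth_overflow by (rewrite length_padded; lia).
      regs_simpl; rewrite Hother3 by (cbn [In]; lia); regs_simpl; apply Hzero; lia. }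
  lia.
Qed.

Hypothesis pre_regs : uses_regs nr pre.
Hypothesis qry_regs : uses_regs nr qry.
Hypothesis enough_regs : (k + 3 <= nr)%nat.

Lemma fits_index_word a : fits W a <-> - half <= a < half.
Proof. reflexivity. Qed.

Lemma decides_within_index_sim mode g code base P A p t G cj R M :
  env g -> g rCodeLen = Z.of_nat (length code) -> (mode = Overlay -> 0 <= g rStamp) ->
  uses_regs nr code -> Z.of_nat (length code) <= cap ->
  code_at P p (sim_loop mode code) -> simulates mode nr W g code base cj R M ->
  (forall c, 0 <= G c)%R ->
  (forall bs R' M', let c := exec code W bs cj in
     halted code c = true -> simulates mode nr W g code base c R' M' ->
     decides_within P w A t (Config (p + size (sim_loop mode code)) R' M') (G c)) ->
  decides_within P w A t (Config p R M) (sim_cost W code t cj G).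
Proof.
  intros [] Hlen Hstamp Hregs Hfits; pose proof host_bits; pose proof index_word_ge_4.
  pose proof sizes as []; pose proof host_cap_eq.
  apply decides_within_sim_loop; auto; lia.
Qed.

Lemma simulates_preprocessing_start g R M :
  agrees_on_globals g R -> R rPc = 0 ->
  (forall i, (i < nr)%nat -> R (guest i) = upd_reg (fun _ => 0) 0 (Z.of_nat s) i) ->
  holds_text T M -> simulates InPlace nr W g pre M (pre_config T) R M.
Proof.
  intros Hg Hpc Hregs HM; pose proof sizes as []; destruct sum_text_is_text as [Hlen Hletters].
  constructor; [constructor|]; unfold pre_config, input_config, start; cbn [pc regs mem].
  - exact Hg.
  - intros i Hi; rewrite Hregs, length_map, Hlen by exact Hi; reflexivity.
  - intros i; apply fits_index_word; unfold upd_reg; rewrite length_map, Hlen.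
    destruct (Nat.eqb i 0); lia.
  - intros a _; apply fits_index_word, (Forall_input_mem (fun z => - half <= z < half)); [lia|].
    apply Forall_map; eapply Forall_impl; [|exact Hletters]; cbv beta; intros; lia.
  - split; [|reflexivity].
    intros a Ha; rewrite fits_index_word in Ha.
    rewrite HM, (input_mem_neg xs) by lia; apply Z.add_0_r.
  - rewrite Hpc; reflexivity.
Qed.

Local Open Scope R_scope.

Definition query_overhead : nat := (nr + 11 * k + 40)%nat.

Definition query_steps (t : nat) (c : config) (idx : nat) : R :=
  mean_steps qry W t (query_config c (nth_query idx)).

Lemma query_steps_nonneg t c idx : 0 <= query_steps t c idx.
Proof. apply mean_steps_nonneg. Qed.

Fixpoint queries_steps (t : nat) (c : config) (j idx : nat) : R :=
  match j with
  | O => 0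
  | S j' => query_steps t c idx + queries_steps t c j' (S idx)
  end.

Lemma queries_steps_nonneg t c j idx : 0 <= queries_steps t c j idx.
Proof.
  revert idx; induction j as [|j IH]; intros idx; simpl; [lra|].
  pose proof (query_steps_nonneg t c idx); specialize (IH (S idx)); lra.
Qed.

Local Open Scope Z_scope.

Section QueryLoop.

Variables (bs : list bool) (base : Z -> Z).

Let c := exec pre W bs (pre_config T).

Hypothesis index_built : halted pre c = true.
Hypothesis index_fits : forall a, fits W a -> fits W (mem c a).
Hypothesis base_index : forall a, fits W a -> base a = mem c a.
Hypothesis base_input : forall i, base (3 * range + Z.of_nat i) = nth i xs 0.

Record query_inv (idx : nat) (R : nat -> Z) (M : Z -> Z) : Prop := {
  inv_env : env R;
  inv_query : R rQuery = Z.of_nat idx;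
  inv_answer : (R rAnswer = 1 /\ matched idx) \/ (R rAnswer = 0 /\ ~ matched idx);
  inv_code_len : R rCodeLen = Z.of_nat (length qry);
  inv_outside : forall a, a < half \/ 5 * half <= a -> M a = base a;
  inv_stamps : forall a, fits W a -> 0 <= M (a + range) <= Z.of_nat idx }.

Lemma simulates_query_start idx R R1 M :
  (idx < queries)%nat -> query_inv idx R M ->
  agrees_on_globals (upd_reg R rStamp (Z.of_nat idx + 1)) R1 -> R1 rPc = 0 ->
  (forall i, (i < nr)%nat -> R1 (guest i) = nth i (query_counts idx) 0) ->
  simulates Overlay nr W (upd_reg R rStamp (Z.of_nat idx + 1)) qry base
    (query_config c (nth_query idx)) R1 M.
Proof.
  intros Hidx [_ _ _ _ Hout Hstamps] Hg Hpc Hregs.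
  constructor; [constructor|]; unfold query_config, start; cbn [pc regs mem].
  - exact Hg.
  - intros i Hi; now rewrite of_nat_nth_nth_query, Hregs.
  - intros i; rewrite of_nat_nth_nth_query by exact Hidx.
    pose proof (nth_query_counts_range idx i Hidx); apply fits_index_word; lia.
  - exact index_fits.
  - constructor; fold range half; regs_simpl.
    + intros a Ha; pose proof (Hstamps a Ha).
      destruct (Z.eqb_spec (M (a + range)) (Z.of_nat idx + 1)); [lia|].
      symmetry; now apply base_index.
    + exact Hout.
    + intros a Ha; pose proof (Hstamps a Ha); lia.
  - rewrite Hpc; reflexivity.
Qed.

Lemma matched_S idx :
  matched (S idx) <-> matched idx \/ jumbled_match (k + 3) T (nth_query idx).
Proof.
  split.
  - intros (i & Hi & Hm); destruct (Nat.eq_dec i idx) as [->|]; [auto|].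
    left; exists i; split; [lia | exact Hm].
  - intros [(i & Hi & Hm) | Hm]; [exists i | exists idx]; split; auto; lia.
Qed.

Lemma query_answer_correct idx bs' : (idx < queries)%nat ->
  let c' := exec qry W bs' (query_config c (nth_query idx)) in
  halted qry c' = true ->
  regs c' 0%nat <> 0 <-> jumbled_match (k + 3) T (nth_query idx).
Proof.
  intros Hidx c' Hc'.
  exact (proj2 J_solves s T (nth_query idx) bs bs' sum_text_is_text (nth_query_vector idx Hidx)
    index_built Hc').
Qed.

Lemma runs_record_answer idx bs' R R2 M M2 :
  (idx < queries)%nat -> query_inv idx R M ->
  let c' := exec qry W bs' (query_config c (nth_query idx)) in
  halted qry c' = true ->
  simulates Overlay nr W (upd_reg R rStamp (Z.of_nat idx + 1)) qry base c' R2 M2 ->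
  runs w record_answer R2 M2 5 (query_inv (S idx)).
Proof.
  intros Hidx [Henv Hquery Hanswer Hlen Hout Hstamps] c' Hc' [[Hg Hregs _ _ Hmem] _].
  pose proof Henv as []; pose proof sizes as []; pose proof of_nat_query_number.
  pose proof (query_answer_correct idx bs' Hidx Hc') as Hcorrect; fold c' in Hcorrect.
  cbn [represents] in Hmem; destruct Hmem as [_ Hout2 Hstamps2].
  rewrite upd_reg_same in Hstamps2; fold range half in Hout2, Hstamps2.
  assert (Hguest : R2 (guest 0) = regs c' 0%nat) by (apply Hregs; lia).
  unfold record_answer; eapply runs_cost_le.
  { eapply (runs_then _ _ _ _ _ _ _ (fun R' M' => M' = M2 /\
      R' rAnswer = (if Z.eqb (regs c' 0%nat) 0 then R rAnswer else 1) /\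
      changes_only [rAnswer] R2 R')).
    { apply (runs_if _ _ _ _ _ _ 1); cbn [holds].
      assert (Hzero : R2 rZero = 0) by reg_value; rewrite Hguest, Hzero.
      destruct (Z.eqb (regs c' 0%nat) 0).
      - apply runs_cost_le with (n := 0%nat); [|lia].
        apply runs_nop; repeat apply conj; [reflexivity | reg_value | unchanged].
      - do_const; repeat apply conj; [reflexivity | reg_value | unchanged]. }
    intros R3 M3 (-> & Hanswer3 & Hch); do_op; constructor.
    - eapply env_ext; [|exact Henv]; intros i Hi; reg_unchanged.
    - regs_simpl; lia.
    - regs_simpl; rewrite Hanswer3, matched_S.
      destruct (Z.eqb_spec (regs c' 0%nat) 0) as [Hreject|Haccept]; tauto.
    - reg_value.
    - exact Hout2.
    - intros a Ha; specialize (Hstamps2 a Ha); lia. }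
  lia.
Qed.

Local Open Scope R_scope.

Lemma query_loop_test idx R M :
  query_inv idx R M -> holds (TLt rQuery rQueries) R = Nat.ltb idx queries.
Proof.
  intros [Henv Hquery _ _ _ _]; cbn [holds].
  rewrite Hquery, (env_queries R Henv), <- of_nat_query_number.
  destruct (Nat.ltb_spec idx queries); [apply Z.ltb_lt | apply Z.ltb_ge]; lia.
Qed.

Lemma decides_within_query P A p t v idx R M :
  code_at P p (query_loop k nr qry) -> (idx < queries)%nat -> query_inv idx R M -> 0 <= v ->
  (forall R' M', query_inv (S idx) R' M' -> decides_within P w A t (Config p R' M') v) ->
  decides_within P w A t (Config p R M)
    (INR query_overhead + INR (slowdown qry) * query_steps t c idx + v).
Proof.
  intros Hp Hidx Hinv Hv Hcont; pose proof Hinv as [Henv Hquery _ Hlen Hout _].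
  pose proof sizes as [].
  pose proof (code_at_while _ _ _ _ Hp)
    as (_ & _ & (Hstart & (Hsim & Hrecord)%code_at_seq)%code_at_seq & Hback).
  set (rest := INR 5 + (INR 1 + v)).
  assert (Hrest : 0 <= rest) by (unfold rest; simpl; lra).
  pose proof (sim_cost_nonneg W qry t (query_config c (nth_query idx)) (fun _ => rest)
    (fun _ => Hrest)) as Hbound.
  apply (decides_within_weaken _ _ _ t t _ (INR 1 + (INR (nr + 11 * k + 30) +
    sim_cost W qry t (query_config c (nth_query idx)) (fun _ => rest)))); [lia | |].
  { pose proof (halting_mean_const_le qry W t (query_config c (nth_query idx)) rest Hrest).
    unfold sim_cost, query_steps, query_overhead, rest in *.
    rewrite !plus_INR in *; simpl in *; lra. }
  eapply decides_within_reaches; [eapply reaches_while_enter; [exact Hp|] | |].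
  { rewrite (query_loop_test idx R M Hinv); now apply Nat.ltb_lt. }
  { pose proof (pos_INR (nr + 11 * k + 30)); lra. }
  eapply decides_within_runs; [apply (runs_start_query idx); auto | exact Hstart | exact Hbound|].
  { intros i; rewrite Hout by lia; apply base_input. }
  intros R1 M1 (-> & Hg & Hpc & Hregs).
  apply (decides_within_index_sim Overlay (upd_reg R rStamp (Z.of_nat idx + 1)%Z) qry base);
    [| | | | | exact Hsim | | intros _; exact Hrest |].
  - apply (env_ext R); [|exact Henv]; intros i Hi; now regs_simpl.
  - now regs_simpl.
  - intros _; regs_simpl; lia.
  - exact qry_regs.
  - assumption.
  - apply (simulates_query_start idx R R1 M); assumption.
  - intros bs' R2 M2 c' Hc' Hsim2.
    eapply decides_within_runs;
      [apply (runs_record_answer idx bs' R R2 M); eassumption | exact Hrecord | simpl; lra |].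
    intros R3 M3 Hinv3.
    eapply decides_within_reaches; [|exact Hv | apply Hcont, Hinv3].
    pose proof (reaches_while_repeat P w p _ _ R3 M3 Hp) as Hrepeat.
    cbn [size] in Hrepeat; now rewrite !Nat.add_assoc in Hrepeat.
Qed.

Lemma decides_within_query_loop P A p t v j idx R M :
  code_at P p (query_loop k nr qry) -> (idx + j = queries)%nat -> query_inv idx R M -> 0 <= v ->
  (forall R' M', query_inv queries R' M' ->
     decides_within P w A t (Config (p + size (query_loop k nr qry)) R' M') v) ->
  decides_within P w A t (Config p R M)
    (INR (j * query_overhead) + INR (slowdown qry) * queries_steps t c j idx + (2 + v)).
Proof.
  intros Hp Hj Hinv Hv Hexit; revert idx R M Hj Hinv.
  induction j as [|j IH]; intros idx R M Hj Hinv; cbn [queries_steps].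
  - replace (INR (0 * query_overhead) + INR (slowdown qry) * 0 + (2 + v)) with (INR 2 + v)
      by (simpl; lra).
    replace idx with queries in Hinv by lia.
    eapply decides_within_reaches; [|exact Hv | apply Hexit, Hinv].
    apply reaches_while_exit; [exact Hp|].
    rewrite (query_loop_test queries R M Hinv); apply Nat.ltb_irrefl.
  - pose proof (Rmult_le_pos _ _ (pos_INR (slowdown qry)) (queries_steps_nonneg t c j (S idx))).
    pose proof (pos_INR (j * query_overhead)).
    apply (decides_within_weaken P w A t t _ (INR query_overhead +
      INR (slowdown qry) * query_steps t c idx + (INR (j * query_overhead) +
      INR (slowdown qry) * queries_steps t c j (S idx) + (2 + v)))); [lia | |].
    { change (S j * query_overhead)%nat with (query_overhead + j * query_overhead)%nat.
      rewrite plus_INR; lra. }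
    apply (decides_within_query P A p t _ idx R M); [exact Hp | lia | exact Hinv | lra |].
    intros R' M' Hinv'; apply IH; [lia | exact Hinv'].
Qed.

End QueryLoop.

Local Open Scope R_scope.

Let P := compile 0 (conv3sum_cmd k (index_word_const J) nr pre qry).

Definition setup_cost : nat :=
  ((k + 6) * Z.to_nat B + 3 * log_text + index_word_const J + 60 +
   ((n * 7 + 3) + ((blocks * (Z.to_nat L * 5 + 11 * k + 40) + 4) + (nr + 2))))%nat.

Lemma runs_setup R M :
  R rN = Z.of_nat n -> (forall a, M a = input_mem xs a) ->
  runs w (setup k (index_word_const J) nr (length pre)) R M setup_cost
    (fun R' M' => env R' /\ R' rCodeLen = Z.of_nat (length pre) /\ R' rPc = 0%Z /\
       (forall i, (i < nr)%nat -> R' (guest i) = upd_reg (fun _ => 0%Z) 0 (Z.of_nat s) i) /\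
       holds_text T M').
Proof.
  intros HN HM; pose proof sizes as []; unfold setup, setup_cost.
  eapply runs_then; [apply (runs_initialize (length pre)); assumption|].
  intros R1 M1 (-> & Henv1 & Hlen1).
  eapply runs_then; [apply runs_move_input; assumption|].
  intros R2 M2 (Hg2 & HM2); pose proof (env_agrees_on_globals _ _ Hg2 Henv1) as Henv2.
  eapply runs_then; [apply runs_emit_text; assumption|].
  intros R3 M3 (Hg3 & HM3); pose proof (env_agrees_on_globals _ _ Hg3 Henv2) as Henv3.
  eapply runs_weaken; [reflexivity | | apply runs_start_preprocessing; [lia | exact Henv3]].
  cbv beta; intros R4 M4 (-> & Hg4 & Hpc & Hregs).
  repeat apply conj; [now apply (env_agrees_on_globals R3) | reg_value | exact Hpc | exact Hregs
    | exact HM3].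
Qed.

Lemma runs_start_queries g base cj R M :
  env g -> holds_text T base -> simulates InPlace nr W g pre base cj R M ->
  runs w (start_queries (length qry)) R M 3 (query_inv M 0).
Proof.
  intros Henv Hbase [[Hg _ _ _ [Hin Hout]] _]; pose proof sizes as [].
  unfold start_queries; eapply runs_cost_le.
  { do_const; do_const; do_const; constructor.
    - apply (env_ext g); [|exact Henv]; intros i Hi; reg_unchanged.
    - now regs_simpl.
    - right; split; [now regs_simpl | intros (i & Hi & _); lia].
    - now regs_simpl.
    - reflexivity.
    - intros a Ha; rewrite fits_index_word in Ha; rewrite Hout by (rewrite fits_index_word; lia).
      destruct sum_text_is_text as [Hlen _].
      rewrite Hbase, input_mem_beyond, input_mem_neg by (rewrite ?length_map; lia); lia. }
  lia.
Qed.

Lemma decides_within_answer A p t base R M :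
  code_at P p (Bin Add 0 rAnswer rZero) -> length P = (p + 1)%nat ->
  query_inv base queries R M -> (A <-> matched queries) ->
  decides_within P w A t (Config p R M) (INR 1 + 0).
Proof.
  intros Hp HP [[] _ Hanswer _ _ _] HA; pose proof sizes as [].
  apply (decides_within_runs P w A t p (Bin Add 0 rAnswer rZero) R M 1 0
    (fun R' M' => R' 0%nat = R rAnswer)); [| exact Hp | lra |].
  { eapply runs_bin; [reg_value | reg_value | | now regs_simpl].
    cbn [eval_binop]; rewrite Z.add_0_r; apply host_wrap; lia. }
  intros R' M' HR'; apply decides_within_halted.
  - apply Nat.leb_le; cbn [pc size]; lia.
  - unfold accepts; cbn [regs]; rewrite HR', HA.
    split; [intros Hyes | intros Hm]; destruct Hanswer as [[E Hm'] | [E Hm']];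
      [exact Hm' | contradiction | lia | contradiction].
Qed.

Definition querying_cost (t : nat) (c : config) : R :=
  INR (queries * query_overhead) + INR (slowdown qry) * queries_steps t c queries 0 +
  (2 + (INR 1 + 0)).

Lemma querying_cost_nonneg t c : 0 <= querying_cost t c.
Proof.
  unfold querying_cost; pose proof (pos_INR (queries * query_overhead)).
  pose proof (Rmult_le_pos _ _ (pos_INR (slowdown qry)) (queries_steps_nonneg t c queries 0)).
  simpl (INR 1); lra.
Qed.

Lemma decides_within_conv3sum t :
  decides_within P w (conv3sum xs) t (input_config xs)
    (INR setup_cost + sim_cost W pre t (pre_config T) (fun c => INR 3 + querying_cost t c)).
Proof.
  pose proof sizes as [].
  assert (HP : length P = size (conv3sum_cmd k (index_word_const J) nr pre qry))
    by apply length_compile.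
  pose proof (code_at_compile (conv3sum_cmd k (index_word_const J) nr pre qry)) as Hcode.
  fold P in Hcode.
  apply code_at_seq in Hcode as [Hsetup (Hsim & (Hstart & (Hloop & Hanswer)%code_at_seq)
    %code_at_seq)%code_at_seq].
  assert (Hcost : forall c, 0 <= INR 3 + querying_cost t c)
    by (intros c; pose proof (querying_cost_nonneg t c); simpl (INR 3); lra).
  eapply decides_within_runs;
    [apply runs_setup | exact Hsetup | now apply sim_cost_nonneg |]; [reflexivity | reflexivity|].
  intros R1 M1 (Henv & Hlen & Hpc & Hregs & HM1).
  apply (decides_within_index_sim InPlace R1 pre M1); try assumption; [discriminate | |].
  { apply (simulates_preprocessing_start R1 R1 M1); auto; intros i _; reflexivity. }
  intros bs R2 M2 c Hc Hsim2; pose proof Hsim2 as [[_ _ _ Hfit [Hin Hout]] _].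
  eapply decides_within_runs; [eapply runs_start_queries; eassumption | exact Hstart
    | apply querying_cost_nonneg |].
  intros R3 M3 Hinv.
  apply (decides_within_query_loop bs M2); try assumption.
  - intros i; rewrite Hout by (rewrite fits_index_word; lia).
    apply (holds_text_input T); [exact HM1|]; destruct sum_text_is_text as [-> _]; lia.
  - reflexivity.
  - simpl; lra.
  - intros R4 M4 Hinv4; apply (decides_within_answer _ _ _ M2); auto using conv3sum_iff_matched.
    rewrite HP; unfold conv3sum_cmd; cbn [size]; lia.
Qed.

Section Time.

Variables (pt qt : R).
Hypothesis preprocessing_le_pt : Rbar_le (preprocessing_time (k + 3) J s) (Finite pt).
Hypothesis query_le_qt : Rbar_le (query_time (k + 3) J s) (Finite qt).

Lemma mean_preprocessing_le t : mean_steps pre W t (pre_config T) <= pt.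
Proof.
  change (Rbar_le (Finite (mean_steps pre W t (pre_config T))) (Finite pt)).
  eapply Rbar_le_trans; [|exact preprocessing_le_pt].
  eapply Rbar_le_trans; [|exact (worst_case_ge _ _ T sum_text_is_text)].
  apply (Sup_seq_ge (fun t => mean_steps pre W t (pre_config T))).
Qed.

Lemma mean_query_le t idx : (idx < queries)%nat ->
  halting_mean pre W t (pre_config T) (fun c => query_steps t c idx) <= qt.
Proof.
  intros Hidx.
  change (Rbar_le
    (Finite (halting_mean pre W t (pre_config T) (fun c => query_steps t c idx))) (Finite qt)).
  eapply Rbar_le_trans; [|exact query_le_qt].
  eapply Rbar_le_trans; [|exact (worst_case_ge _ _ (T, nth_query idx)
    (conj sum_text_is_text (nth_query_vector idx Hidx)))].
  apply (Sup_seq_ge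
    (fun t => halting_mean pre W t (pre_config T) (fun c => query_steps t c idx))).
Qed.

Lemma mean_queries_le t j idx : (idx + j <= queries)%nat ->
  halting_mean pre W t (pre_config T) (fun c => queries_steps t c j idx) <= INR j * qt.
Proof.
  revert idx; induction j as [|j IH]; intros idx Hj; cbn [queries_steps].
  - simpl (INR 0); rewrite Rmult_0_l; apply halting_mean_const_le; lra.
  - rewrite halting_mean_plus, S_INR.
    pose proof (mean_query_le t idx ltac:(lia)); specialize (IH (S idx) ltac:(lia)); lra.
Qed.

Lemma mean_conv3sum_le t :
  mean_steps P w t (input_config xs) <=
    INR setup_cost + 8 + INR (queries * query_overhead) +
    INR (slowdown pre) * pt + INR (slowdown qry) * (INR queries * qt).
Proof.
  eapply Rle_trans; [exact (proj1 (decides_within_conv3sum t))|]; unfold sim_cost.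
  set (overhead := INR 3 + (INR (queries * query_overhead) + 3)).
  assert (Hoverhead : overhead = 6 + INR (queries * query_overhead))
    by (unfold overhead; simpl (INR 3); lra).
  assert (Hmean : halting_mean pre W t (pre_config T) (fun c => INR 3 + querying_cost t c) =
    halting_mean pre W t (pre_config T) (fun _ => overhead) +
    INR (slowdown qry) *
    halting_mean pre W t (pre_config T) (fun c => queries_steps t c queries 0)).
  { rewrite <- halting_mean_scal, <- halting_mean_plus; apply coin_mean_ext; intros bs; cbv zeta.
    unfold querying_cost, overhead; simpl (INR 1); destruct (halted pre _); lra. }
  rewrite Hmean.
  pose proof (halting_mean_const_le pre W t (pre_config T) overhead) as Hconst.
  pose proof (pos_INR (queries * query_overhead)); specialize (Hconst ltac:(lra)).
  pose proof (Rmult_le_compat_l _ _ _ (pos_INR (slowdown pre)) (mean_preprocessing_le t)).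
  pose proof (Rmult_le_compat_l _ _ _ (pos_INR (slowdown qry))
    (mean_queries_le t queries 0 ltac:(lia))).
  lra.
Qed.

End Time.

End Reduction.

(** * The reduction as an algorithm *)

Definition reg_bound (r : nat) (J : index_algorithm) : nat :=
  (S (list_max (flat_map instr_regs (pre_code J ++ query_code J))) + r)%nat.

Lemma reg_bound_uses_regs r J code :
  incl code (pre_code J ++ query_code J) -> uses_regs (reg_bound r J) code.
Proof.
  intros Hincl; apply Forall_forall; intros ins Hins; apply Forall_forall; intros i Hi.
  assert (Hle : (i <= list_max (flat_map instr_regs (pre_code J ++ query_code J)))%nat).
  { apply (proj1 (Forall_forall _ _) (proj1 (list_max_le _ _) (Nat.le_refl _))).
    apply in_flat_map; eauto. }
  unfold reg_bound; lia.
Qed.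

Lemma pre_code_uses_regs r J : uses_regs (reg_bound r J) (pre_code J).
Proof. apply reg_bound_uses_regs, incl_appl, incl_refl. Qed.

Lemma query_code_uses_regs r J : uses_regs (reg_bound r J) (query_code J).
Proof. apply reg_bound_uses_regs, incl_appr, incl_refl. Qed.

Definition conv_algorithm (k : nat) (J : index_algorithm) : algorithm :=
  Algorithm
    (compile 0 (conv3sum_cmd k (index_word_const J) (reg_bound (k + 3) J)
                  (pre_code J) (query_code J)))
    (index_word_const J * (k + 8) + 2 * k + 20 + length (pre_code J) + length (query_code J)).

Lemma least_digit_base_exists (k n : nat) : exists B : Z, least_digit_base k n B.
Proof.
  destruct (dec_inh_nat_subset_has_unique_least_element
    (fun b => 0 < Z.of_nat b /\ Z.of_nat n <= Z.of_nat b ^ Z.of_nat (S k)))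
    as (b & ((Hpos & Hb) & Hmin) & _).
  - intros b; apply classic.
  - exists (S n); split; [lia|].
    assert (Z.of_nat (S n) ^ 1 <= Z.of_nat (S n) ^ Z.of_nat (S k))
      by (apply Z.pow_le_mono_r; lia).
    rewrite Z.pow_1_r in *; lia.
  - exists (Z.of_nat b); split; [exact Hpos|]; split; [exact Hb|].
    intros b' Hb'; apply Z.lt_nge; intros Hge.
    specialize (Hmin (Z.to_nat b')); rewrite Z2Nat.id in Hmin by lia.
    specialize (Hmin ltac:(split; [lia | exact Hge])); lia.
Qed.

Lemma least_digit_base_le (k n : nat) (B : Z) : least_digit_base k n B -> B <= Z.of_nat n + 1.
Proof.
  intros (HB & _ & Hmin); destruct (Z.le_gt_cases B 1); [lia|].
  specialize (Hmin (B - 1) ltac:(lia)).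
  assert ((B - 1) ^ 1 <= (B - 1) ^ Z.of_nat (S k)) by (apply Z.pow_le_mono_r; lia).
  rewrite Z.pow_1_r in *; lia.
Qed.

Lemma lt_pow2 (m : nat) : Z.of_nat m < 2 ^ Z.of_nat m.
Proof. apply Z.pow_gt_lin_r; lia. Qed.

Lemma lt_pow2_log2 (n : nat) : Z.of_nat n < 2 ^ Z.of_nat (Nat.log2 n + 1).
Proof.
  destruct (Nat.eq_dec n 0) as [->|Hn]; [reflexivity|].
  pose proof (Nat.log2_spec n ltac:(lia)) as [_ Hlog].
  apply Nat2Z.inj_lt in Hlog; rewrite Nat2Z.inj_pow in Hlog.
  now rewrite Nat.add_1_r.
Qed.

Section Capacity.

Variables (k n : nat) (B : Z) (J : index_algorithm).
Let l := (Nat.log2 n + 1)%nat.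
Let w := word_size (word_const (conv_algorithm k J)) n.
Let s := sum_text_length B k n.
Hypothesis word_const_ge_2 : (2 <= index_word_const J)%nat.
Hypothesis B_base : least_digit_base k n B.

Lemma base_le_pow2 : B <= 2 ^ Z.of_nat l.
Proof.
  pose proof (least_digit_base_le k n B B_base); pose proof (lt_pow2_log2 n); unfold l; lia.
Qed.

Lemma body_length_lt_pow2 : body_length B k + 1 <= 2 ^ Z.of_nat (k + 3 + l).
Proof.
  pose proof base_le_pow2 as HB; pose proof (lt_pow2 k) as Hk; pose proof B_base as [B_pos _].
  rewrite !Nat2Z.inj_add, !Z.pow_add_r by lia; change (2 ^ Z.of_nat 3) with 8.
  set (x := 2 ^ Z.of_nat k) in *; set (y := 2 ^ Z.of_nat l) in *; unfold body_length.
  assert ((Z.of_nat k + 1) * B <= x * y) by (apply Z.mul_le_mono_nonneg; lia).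
  assert (1 * 1 <= x * y) by (apply Z.mul_le_mono_nonneg; lia).
  lia.
Qed.

Lemma text_size_le_pow2 : Z.of_nat s + Z.of_nat k + 4 <= 2 ^ Z.of_nat (2 * l + k + 4).
Proof.
  pose proof body_length_lt_pow2 as HL; pose proof (lt_pow2_log2 n) as Hn.
  pose proof (lt_pow2 (k + 3)) as Hk; pose proof (body_length_pos B k (proj1 B_base)).
  assert (Hs : Z.of_nat s <= 2 ^ Z.of_nat (2 * l + k + 3)).
  { unfold s, sum_text_length; rewrite Nat2Z.inj_mul, Nat2Z.inj_succ, Z2Nat.id by lia.
    replace (2 * l + k + 3)%nat with (l + (k + 3 + l))%nat by lia.
    rewrite (Nat2Z.inj_add l), Z.pow_add_r by lia; fold l in Hn.
    apply Z.mul_le_mono_nonneg; lia. }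
  assert (2 ^ Z.of_nat (k + 3) <= 2 ^ Z.of_nat (2 * l + k + 3)) by (apply Z.pow_le_mono_r; lia).
  replace (2 * l + k + 4)%nat with (S (2 * l + k + 3)) by lia.
  rewrite (Nat2Z.inj_succ (2 * l + k + 3)), Z.pow_succ_r by lia; lia.
Qed.

Lemma index_word_size_le :
  (index_word_size (k + 3) J s <= index_word_const J * (k + 8) * l)%nat.
Proof.
  unfold index_word_size, word_size; rewrite <- Nat.mul_assoc; apply Nat.mul_le_mono_l.
  assert (Nat.log2 (s + (k + 3)) < 2 * l + k + 4)%nat.
  { pose proof text_size_le_pow2; apply Nat.log2_lt_pow2; [lia|].
    apply Nat2Z.inj_lt; rewrite Nat2Z.inj_pow; change (Z.of_nat 2) with 2; lia. }
  assert (1 <= l)%nat by (unfold l; lia); nia.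
Qed.

Lemma pow2_le_host_cap (x : Z) (e : nat) :
  x <= 2 ^ Z.of_nat e -> (e + 5 <= w)%nat -> x <= host_cap w.
Proof. intros Hx He; etransitivity; [exact Hx|]; apply Z.pow_le_mono_r; lia. Qed.

Lemma conv_algorithm_fits_host : fits_host k w n B J.
Proof.
  pose proof index_word_size_le as HW; pose proof base_le_pow2 as HB.
  pose proof B_base as [B_pos _].
  pose proof (lt_pow2_log2 n) as Hn; fold l in Hn.
  set (p := length (pre_code J)); set (q := length (query_code J)).
  assert (Hl : (1 <= l)%nat) by (unfold l; lia).
  assert (Ew : w = ((index_word_const J * (k + 8) + 2 * k + 20 + p + q) * l)%nat) by reflexivity.
  assert (Hw : (2 * l * (k + 8) + (2 * k + 20 + p + q) * l <= w)%nat) by nia.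
  assert (HWw : (index_word_const J * (k + 8) * l + 20 * l <= w)%nat) by nia.
  assert (Hterms : (k <= k * l /\ p <= p * l /\ q <= q * l)%nat) by nia.
  constructor; fold s.
  - apply (pow2_le_host_cap _ (l * S k)); [|lia].
    rewrite Nat2Z.inj_mul, Z.pow_mul_r by lia; apply Z.pow_le_mono_l; lia.
  - apply (pow2_le_host_cap _ (k + 3 + l)); [exact body_length_lt_pow2 | lia].
  - apply (pow2_le_host_cap _ (index_word_size (k + 3) J s)); lia.
  - apply (pow2_le_host_cap _ (l + k)); [|lia].
    rewrite Nat2Z.inj_add, Z.pow_add_r by lia; apply Z.mul_le_mono_nonneg_r; lia.
  - apply (pow2_le_host_cap _ k); lia.
  - apply (pow2_le_host_cap _ p); [pose proof (lt_pow2 p); lia | lia].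
  - apply (pow2_le_host_cap _ q); [pose proof (lt_pow2 q); lia | lia].
Qed.

End Capacity.

Local Open Scope R_scope.

Section Algorithm.

Variables (k n : nat) (J : index_algorithm) (xs : list Z) (B : Z).
Hypothesis J_solves : solves_jumbled_indexing (k + 3) J.
Hypothesis xs_input : conv3sum_input n xs.
Hypothesis B_base : least_digit_base k n B.

Let A := conv_algorithm k J.
Let w := word_size (word_const A) n.
Let nr := reg_bound (k + 3) J.

Lemma reg_bound_ge : (k + 3 <= nr)%nat.
Proof. unfold nr, reg_bound; lia. Qed.

Lemma conv_algorithm_decides_within t :
  exists v, decides_within (code A) w (conv3sum xs) t (input_config xs) v.
Proof.
  destruct xs_input as [Hlen Hrange]; eexists; unfold w, A.
  apply (decides_within_conv3sum k _ xs B J nr); rewrite ?Hlen; auto using reg_bound_ge.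
  - apply conv_algorithm_fits_host; [apply J_solves | exact B_base].
  - apply pre_code_uses_regs.
  - apply query_code_uses_regs.
Qed.

Lemma conv_algorithm_mean_steps t pt qt :
  Rbar_le (preprocessing_time (k + 3) J (sum_text_length B k n)) (Finite pt) ->
  Rbar_le (query_time (k + 3) J (sum_text_length B k n)) (Finite qt) ->
  mean_steps (code A) w t (input_config xs) <=
    INR (setup_cost k xs B J nr) + 8 + INR ((n - 1) * 2 ^ k * query_overhead k nr) +
    INR (slowdown (pre_code J)) * pt +
    INR (slowdown (query_code J)) * (INR ((n - 1) * 2 ^ k) * qt).
Proof.
  destruct xs_input as [Hlen Hrange]; intros Hpt Hqt; unfold w, A; rewrite <- Hlen.
  apply (mean_conv3sum_le k _ xs B J nr); rewrite ?Hlen; auto using reg_bound_ge.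
  - apply conv_algorithm_fits_host; [apply J_solves | exact B_base].
  - apply pre_code_uses_regs.
  - apply query_code_uses_regs.
Qed.

End Algorithm.

Lemma conv_algorithm_solves (k : nat) (J : index_algorithm) :
  solves_jumbled_indexing (k + 3) J -> solves_conv3sum (conv_algorithm k J).
Proof.
  intros HJ; split; [simpl; lia|].
  intros n xs bs Hxs c Hc; destruct (least_digit_base_exists k n) as [B HB].
  destruct (conv_algorithm_decides_within k n J xs B HJ Hxs HB (length bs)) as (v & _ & Hcorrect).
  now apply Hcorrect.
Qed.

(** * Asymptotics *)

Lemma eventually_le_of_not_is_Omega (f : nat -> Rbar) (g : nat -> R) :
  ~ is_Omega f g -> exists s0, forall s, (s0 <= s)%nat -> Rbar_le (f s) (Finite (g s)).
Proof.
  intros HOmega; apply NNPP; intros Hnever; apply HOmega.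
  exists 1; split; [lra|]; intros s0.
  apply NNPP; intros Hs; apply Hnever; exists s0; intros s Hs0.
  destruct (Rbar_le_lt_dec (f s) (Finite (g s))) as [Hle|Hlt]; [exact Hle|].
  exfalso; apply Hs; exists s; split; [exact Hs0|].
  rewrite Rmult_1_l; now apply Rbar_lt_le.
Qed.

Lemma eventually_le_Rpower_of_not_is_Omega (f : nat -> Rbar) (a b : R) : a <= b ->
  ~ is_Omega f (fun s => Rpower (INR s) a) ->
  exists s0, forall s, (s0 <= s)%nat -> Rbar_le (f s) (Finite (Rpower (INR s) b)).
Proof.
  intros Hab HOmega; destruct (eventually_le_of_not_is_Omega f _ HOmega) as [s0 Hs0].
  exists (S s0); intros s Hs; eapply Rbar_le_trans; [apply Hs0; lia|].
  apply Rle_Rpower; [apply (le_INR 1); lia | exact Hab].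
Qed.

Lemma Rpower_ge_1 (x e : R) : 1 <= x -> 0 <= e -> 1 <= Rpower x e.
Proof. intros Hx He; rewrite <- (Rpower_O x) by lra; apply Rle_Rpower; lra. Qed.

Lemma Rpower_nonneg (x e : R) : 0 <= Rpower x e.
Proof. apply Rlt_le, exp_pos. Qed.

Lemma le_Rpower (x e : R) : 1 <= x -> 1 <= e -> x <= Rpower x e.
Proof. intros Hx He; rewrite <- (Rpower_1 x) at 1 by lra; now apply Rle_Rpower. Qed.

Lemma Rpower_le_scaled (x y C b f : R) :
  0 < x -> 0 < C -> x <= C * Rpower y b -> 0 <= f ->
  Rpower x f <= Rpower C f * Rpower y (b * f).
Proof.
  intros Hx HC Hle Hf; pose proof (exp_pos (b * ln y)).
  rewrite <- Rpower_mult, Rpower_mult_distr by (try assumption; apply exp_pos).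
  apply Rle_Rpower_l; lra.
Qed.

Lemma least_digit_base_le_Rpower (k n : nat) (B : Z) : (1 <= n)%nat -> least_digit_base k n B ->
  IZR B <= 2 * Rpower (INR n) (/ INR (S k)).
Proof.
  intros Hn (HB & _ & Hmin).
  assert (Hn1 : 1 <= INR n) by (apply (le_INR 1); exact Hn).
  assert (Hk : 0 < / INR (S k)) by (apply Rinv_0_lt_compat, lt_0_INR; lia).
  pose proof (Rpower_ge_1 _ _ Hn1 (Rlt_le _ _ Hk)).
  destruct (Z.le_gt_cases B 1) as [Hsmall|Hlarge]; [apply IZR_le in Hsmall; lra|].
  specialize (Hmin (B - 1)%Z ltac:(lia)); apply IZR_lt in Hmin.
  rewrite <- INR_IZR_INZ, <- pow_IZR in Hmin.
  assert (Hb : 1 <= IZR (B - 1)) by (apply IZR_le; lia).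
  assert (IZR (B - 1) <= Rpower (INR n) (/ INR (S k))).
  { replace (IZR (B - 1)) with (Rpower (IZR (B - 1) ^ S k) (/ INR (S k))).
    - apply Rle_Rpower_l; [lra|]; split; [apply pow_lt|]; lra.
    - rewrite <- Rpower_pow, Rpower_mult, Rinv_r, Rpower_1 by (try lra; apply not_0_INR; lia).
      reflexivity. }
  rewrite minus_IZR in *; lra.
Qed.

Lemma sum_text_length_le_Rpower (k n : nat) (B : Z) : (1 <= n)%nat -> least_digit_base k n B ->
  INR (sum_text_length B k n) <= 14 * INR (S k) * Rpower (INR n) (1 + / INR (S k)).
Proof.
  intros Hn HB; pose proof (least_digit_base_le_Rpower k n B Hn HB) as Hb; destruct HB as [B_pos _].
  assert (Hn1 : 1 <= INR n) by (apply (le_INR 1); exact Hn).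
  pose proof (body_length_pos B k B_pos).
  rewrite Rpower_plus, Rpower_1 by lra.
  assert (Hs : (Z.of_nat (sum_text_length B k n) <= Z.of_nat n * (7 * Z.of_nat (S k) * B))%Z).
  { unfold sum_text_length; rewrite Nat2Z.inj_mul, Nat2Z.inj_succ, Z2Nat.id by lia.
    apply Z.mul_le_mono_nonneg; try lia; unfold body_length; nia. }
  apply IZR_le in Hs; rewrite !mult_IZR, <- !INR_IZR_INZ in Hs.
  assert (Hk : 0 <= INR n * (7 * INR (S k))) by (pose proof (pos_INR (S k)); nra).
  pose proof (Rmult_le_compat_l _ _ _ Hk Hb); lra.
Qed.

Lemma sum_text_length_ge (k n : nat) (B : Z) : (n - 1 <= sum_text_length B k n)%nat.
Proof. unfold sum_text_length; nia. Qed.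

Lemma setup_cost_le (k nr : nat) (xs : list Z) (B : Z) (J : index_algorithm) :
  least_digit_base k (length xs) B ->
  (setup_cost k xs B J nr <=
   (15 * k + index_word_const J + nr + 160) *
   (sum_text_length B k (length xs) + length xs + 1))%nat.
Proof.
  intros HB; pose proof (least_digit_base_le _ _ _ HB) as HBn; destruct HB as [B_pos _].
  unfold setup_cost, sum_text_length.
  set (n := length xs) in *; set (L := Z.to_nat (body_length B k)).
  set (s := ((n - 1) * S L)%nat); set (c := index_word_const J).
  pose proof (Nat.log2_le_lin (s + (k + 3)) ltac:(lia)).
  set (lg := Nat.log2 (s + (k + 3))) in *.
  assert (Hblocks : ((n - 1) * L <= s)%nat) by (unfold s; nia).
  assert (Htext : ((n - 1) * (L * 5 + 11 * k + 40) <= 5 * s + (11 * k + 40) * n)%nat) by nia.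
  assert (Hbase : ((k + 6) * Z.to_nat B <= (k + 6) * (n + 1))%nat)
    by (apply Nat.mul_le_mono_l; lia).
  assert (Hconst : (c + nr <= (c + nr) * (s + n + 1))%nat) by nia.
  assert (Hk : (0 <= k * s)%nat) by lia.
  lia.
Qed.

Section Exponents.

Variables (k : nat) (e : R).
Hypothesis k_pos : (1 <= k)%nat.
Hypothesis e_small : 0 < e <= 1 / 10.

Let text_exponent := 1 + / INR (S k).
Let preprocessing_exponent := 2 - 2 / INR (k + 2) - e.
Let query_exponent := 1 - 1 / INR (k + 2) - e.

Lemma INR_S_ge_2 : 2 <= INR (S k) /\ INR (k + 2) = INR (S k) + 1.
Proof. split; [apply (le_INR 2); lia | rewrite plus_INR, (S_INR k); simpl; lra]. Qed.

Lemma text_exponent_range : 1 <= text_exponent <= 3 / 2.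
Proof.
  destruct INR_S_ge_2 as [Hm _]; unfold text_exponent.
  assert (0 < / INR (S k) <= / 2)
    by (split; [apply Rinv_0_lt_compat; lra | apply Rinv_le_contravar; lra]).
  lra.
Qed.

Lemma exponents_nonneg : 0 <= preprocessing_exponent /\ 0 <= query_exponent.
Proof.
  destruct INR_S_ge_2 as [Hm Em]; unfold preprocessing_exponent, query_exponent, Rdiv.
  rewrite Em.
  assert (0 < / (INR (S k) + 1) <= / 3)
    by (split; [apply Rinv_0_lt_compat; lra | apply Rinv_le_contravar; lra]).
  lra.
Qed.

Lemma preprocessing_exponent_le : text_exponent * preprocessing_exponent <= 2 - e.
Proof.
  pose proof text_exponent_range; destruct INR_S_ge_2 as [Hm Em].
  replace (text_exponent * preprocessing_exponent) with (2 - text_exponent * e); [nra|].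
  unfold text_exponent, preprocessing_exponent; rewrite Em; field; lra.
Qed.

Lemma query_exponent_le : 1 + text_exponent * query_exponent <= 2 - e.
Proof.
  pose proof text_exponent_range; destruct INR_S_ge_2 as [Hm Em].
  replace (text_exponent * query_exponent) with (1 - text_exponent * e); [nra|].
  unfold text_exponent, query_exponent; rewrite Em; field; lra.
Qed.

Let text_const := 14 * INR (S k).

Lemma text_const_pos : 0 < text_const.
Proof. destruct INR_S_ge_2; unfold text_const; lra. Qed.

Section FixedSize.

Variable n : nat.
Hypothesis n_ge_2 : (2 <= n)%nat.

Lemma INR_n_ge_1 : 1 <= INR n.
Proof. apply (le_INR 1); lia. Qed.

Lemma query_number_le : INR ((n - 1) * 2 ^ k) <= INR (2 ^ k) * INR n.
Proof.
  rewrite mult_INR, Rmult_comm; apply Rmult_le_compat_l; [apply pos_INR | apply le_INR; lia].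
Qed.

Lemma overhead_le_Rpower (overhead : nat) :
  INR ((n - 1) * 2 ^ k * overhead) <= INR (2 ^ k) * INR overhead * Rpower (INR n) (2 - e).
Proof.
  rewrite mult_INR; eapply Rle_trans;
    [apply Rmult_le_compat_r; [apply pos_INR | exact query_number_le]|].
  rewrite Rmult_assoc, (Rmult_comm (INR n)), <- Rmult_assoc.
  apply Rmult_le_compat_l; [apply Rmult_le_pos; apply pos_INR|].
  apply le_Rpower; [exact INR_n_ge_1 | lra].
Qed.

Variable B : Z.
Hypothesis B_base : least_digit_base k n B.

Let s := sum_text_length B k n.

Lemma Rpower_text_length_le (f : R) : 0 <= f ->
  Rpower (INR s) f <= Rpower text_const f * Rpower (INR n) (text_exponent * f).
Proof.
  apply Rpower_le_scaled; [|exact text_const_pos|].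
  - apply (lt_INR 0); pose proof (sum_text_length_ge k n B); unfold s; lia.
  - apply sum_text_length_le_Rpower; [lia | exact B_base].
Qed.

Lemma preprocessing_le_Rpower :
  Rpower (INR s) preprocessing_exponent <=
  Rpower text_const preprocessing_exponent * Rpower (INR n) (2 - e).
Proof.
  eapply Rle_trans; [apply Rpower_text_length_le, exponents_nonneg|].
  apply Rmult_le_compat_l; [apply Rpower_nonneg|].
  apply Rle_Rpower; [exact INR_n_ge_1 | exact preprocessing_exponent_le].
Qed.

Lemma query_le_Rpower :
  INR n * Rpower (INR s) query_exponent <=
  Rpower text_const query_exponent * Rpower (INR n) (2 - e).
Proof.
  pose proof INR_n_ge_1 as Hn.
  eapply Rle_trans; [apply Rmult_le_compat_l;
    [lra | apply Rpower_text_length_le, exponents_nonneg]|].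
  rewrite <- (Rpower_1 (INR n)) at 1 by lra.
  rewrite <- Rmult_assoc, (Rmult_comm (Rpower (INR n) 1)), Rmult_assoc, <- Rpower_plus.
  apply Rmult_le_compat_l; [apply Rpower_nonneg|].
  apply Rle_Rpower; [exact Hn | exact query_exponent_le].
Qed.

Lemma setup_cost_le_Rpower (J : index_algorithm) (nr : nat) (xs : list Z) : length xs = n ->
  INR (setup_cost k xs B J nr) <=
  INR (15 * k + index_word_const J + nr + 160) * (text_const + 2) * Rpower (INR n) (2 - e).
Proof.
  intros Hlen; pose proof INR_n_ge_1 as Hn; pose proof text_exponent_range.
  pose proof (setup_cost_le k nr xs B J) as Hcost; rewrite Hlen in Hcost.
  specialize (Hcost B_base); apply le_INR in Hcost; rewrite mult_INR in Hcost.
  eapply Rle_trans; [exact Hcost|]; rewrite Rmult_assoc; apply Rmult_le_compat_l; [apply pos_INR|].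
  rewrite !plus_INR; simpl (INR 1).
  pose proof (sum_text_length_le_Rpower k n B ltac:(lia) B_base) as Hs.
  pose proof (le_Rpower (INR n) (2 - e) Hn ltac:(lra)).
  assert (Rpower (INR n) text_exponent <= Rpower (INR n) (2 - e)) by (apply Rle_Rpower; lra).
  pose proof text_const_pos; unfold text_exponent, text_const in *; nra.
Qed.

Lemma all_queries_le_Rpower :
  INR ((n - 1) * 2 ^ k) * Rpower (INR s) query_exponent <=
  INR (2 ^ k) * Rpower text_const query_exponent * Rpower (INR n) (2 - e).
Proof.
  eapply Rle_trans; [apply Rmult_le_compat_r; [apply Rpower_nonneg | exact query_number_le]|].
  rewrite !Rmult_assoc; apply Rmult_le_compat_l; [apply pos_INR | exact query_le_Rpower].
Qed.

End FixedSize.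

Lemma conv_algorithm_time (J : index_algorithm) (s0 : nat) :
  solves_jumbled_indexing (k + 3) J ->
  (forall s, (s0 <= s)%nat -> Rbar_le (preprocessing_time (k + 3) J s)
     (Finite (Rpower (INR s) preprocessing_exponent))) ->
  (forall s, (s0 <= s)%nat -> Rbar_le (query_time (k + 3) J s)
     (Finite (Rpower (INR s) query_exponent))) ->
  exists C : R, forall n, (s0 + 2 <= n)%nat ->
    Rbar_le (conv3sum_time (conv_algorithm k J) n) (Finite (C * Rpower (INR n) (2 - e))).
Proof.
  intros HJ Hpre Hqry; set (nr := reg_bound (k + 3) J).
  set (pre := INR (slowdown (pre_code J))); set (qry := INR (slowdown (query_code J))).
  exists (INR (15 * k + index_word_const J + nr + 160) * (text_const + 2) + 8 +
    INR (2 ^ k) * INR (query_overhead k nr) + pre * Rpower text_const preprocessing_exponent +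
    qry * (INR (2 ^ k) * Rpower text_const query_exponent)).
  intros n Hn; apply worst_case_le; intros xs Hxs; apply Sup_seq_le_bound; intros t.
  destruct (least_digit_base_exists k n) as [B HB].
  pose proof (sum_text_length_ge k n B); assert (n_ge_2 : (2 <= n)%nat) by lia.
  eapply Rle_trans; [apply (conv_algorithm_mean_steps k n J xs B HJ Hxs HB);
    [apply Hpre; lia | apply Hqry; lia]|].
  fold nr pre qry.
  pose proof (setup_cost_le_Rpower n n_ge_2 B HB J nr xs (proj1 Hxs)).
  pose proof (overhead_le_Rpower n n_ge_2 (query_overhead k nr)).
  pose proof (Rmult_le_compat_l pre _ _ (pos_INR _) (preprocessing_le_Rpower n n_ge_2 B HB)).
  pose proof (Rmult_le_compat_l qry _ _ (pos_INR _) (all_queries_le_Rpower n n_ge_2 B HB)).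
  assert (Hn1 : 1 <= INR n) by (apply (le_INR 1); lia).
  pose proof (Rpower_ge_1 (INR n) (2 - e) Hn1 ltac:(lra)).
  lra.
Qed.

End Exponents.

Lemma strong_3SUM_hardness_lower_bound (A : algorithm) (e C : R) (n0 : nat) :
  strong_3SUM_hardness -> solves_conv3sum A -> 0 < e ->
  ~ (forall n, (n0 <= n)%nat ->
       Rbar_le (conv3sum_time A n) (Finite (C * Rpower (INR n) (2 - e)))).
Proof.
  intros Hhard HA He Hfast; destruct (Hhard A HA) as (h & Hh & Hlow).
  apply is_lim_seq_spec in Hh.
  destruct (Hh (mkposreal (e / 2) ltac:(lra))) as [n1 Hn1]; simpl in Hn1.
  set (x := Rpower (Rmax C 1) (2 / e)).
  destruct (INR_unbounded x) as [n2 Hn2].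
  destruct (Hlow (n0 + n1 + n2 + 1)%nat) as (n & Hn & Hle).
  specialize (Hn1 n ltac:(lia)); rewrite Rminus_0_r in Hn1; apply Rabs_def2 in Hn1.
  pose proof (Rbar_le_trans _ _ _ Hle (Hfast n ltac:(lia))) as Hupper; simpl in Hupper.
  assert (Hn_ge_1 : 1 <= INR n) by (apply (le_INR 1); lia).
  assert (Hx : x < INR n) by (eapply Rlt_le_trans; [exact Hn2 | apply le_INR; lia]).
  assert (HC : Rmax C 1 < Rpower (INR n) (e / 2)).
  { replace (Rmax C 1) with (Rpower x (e / 2)).
    - apply Rlt_Rpower_l; [lra | split; [apply exp_pos | exact Hx]].
    - unfold x; rewrite Rpower_mult.
      replace (2 / e * (e / 2)) with 1 by (field; lra).
      apply Rpower_1; pose proof (Rmax_r C 1); lra. }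
  assert (Hlower : Rpower (INR n) (2 - e) * Rpower (INR n) (e / 2) <= Rpower (INR n) (2 - h n)).
  { rewrite <- Rpower_plus; apply Rle_Rpower; lra. }
  pose proof (Rmax_l C 1).
  assert (0 < Rpower (INR n) (2 - e)) by apply exp_pos.
  nra.
Qed.

Theorem theorem2 (r : nat) (eps : R) (J : index_algorithm) :
  strong_3SUM_hardness ->
  (4 <= r)%nat ->
  0 < eps ->
  solves_jumbled_indexing r J ->
  is_Omega (preprocessing_time r J)
           (fun s => Rpower (INR s) (2 - 2 / (INR r - 1) - eps)) \/
  is_Omega (query_time r J)
           (fun s => Rpower (INR s) (1 - 1 / (INR r - 1) - eps)).
Proof.
  intros Hhard Hr Heps HJ.
  destruct (Nat.le_exists_sub 3 r ltac:(lia)) as (k & -> & _).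
  replace (INR (k + 3) - 1) with (INR (k + 2)) by (rewrite !plus_INR; simpl; lra).
  set (e := Rmin eps (1 / 10)).
  assert (He : 0 < e <= 1 / 10) by (split; [apply Rmin_glb_lt; lra | apply Rmin_r]).
  assert (He_eps : e <= eps) by apply Rmin_l.
  apply NNPP; intros [Hpre Hqry]%not_or_and.
  apply (eventually_le_Rpower_of_not_is_Omega _ _ (2 - 2 / INR (k + 2) - e)) in Hpre as [s1 Hs1];
    [|lra].
  apply (eventually_le_Rpower_of_not_is_Omega _ _ (1 - 1 / INR (k + 2) - e)) in Hqry as [s2 Hs2];
    [|lra].
  destruct (conv_algorithm_time k e ltac:(lia) He J (s1 + s2) HJ) as [C HC].
  - intros s Hs; apply Hs1; lia.
  - intros s Hs; apply Hs2; lia.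
  - exact (strong_3SUM_hardness_lower_bound _ e C _ Hhard (conv_algorithm_solves k J HJ)
      (proj1 He) HC).
Qed.
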